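(* Let $\tau_0\subseteq[0,1]$ be a time interval. For all $\varepsilon>0$ there exist $\delta>0$ and a constant $c>0$ such that for all $\phi_1,\phi_2,\phi_3\in L^2(\mathbb{T}^3)$ and all dyadic numbers $N_1\ge N_2\ge N_3\ge1$, $$\Big\|\prod_{j=1}^{3}P_{N_j}e^{it\Delta}\phi_j\Big\|_{L^2(\tau_0\times\mathbb{T}^3)}\le c\Big(\frac{N_3}{N_1}+\frac1{N_2}\Big)^{\delta}N_2^{\frac34+\varepsilon}N_3^{\frac54-\varepsilon}\prod_{j=1}^3\|P_{N_j}\phi_j\|_{L^2(\mathbb{T}^3)}.$$
   Context: $\mathbb{T}^3=\mathbb{R}^3/\mathbb{Z}^3$, $\widehat f(n)=\int_{[0,1]^3}e^{-2\pi ix\cdot n}f(x)\,dx$ for $n\in\mathbb{Z}^3$. Fix $C>1$ and $\alpha_1,\alpha_2,\alpha_3\in(\frac1C,C)$, and put $Q(n)=\alpha_1n_1^2+\alpha_2n_2^2+\alpha_3n_3^2$. The linear Schrödinger evolution is $(e^{it\Delta}f)(x)=\sum_{n\in\mathbb{Z}^3}\widehat f(n)e^{2\pi i(n\cdot x+Q(n)t)}$. A dyadic number is a number $2^m$ with $m\in\mathbb{Z}_{\ge0}$. Fix a non-negative even $\psi\in C_0^\infty((-2,2))$ with $\psi(s)=1$ for $|s|\le1$; set $\psi_N(\xi)=\psi(|\xi|/N)-\psi(2|\xi|/N)$ for dyadic $N\ge2$ and $\psi_1(\xi)=\psi(|\xi|)$. $P_N$ is the Fourier multiplier with symbol $\psi_N$,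 i.e. $\widehat{P_Nf}(n)=\psi_N(n)\widehat f(n)$. The constant $c$ may depend on $C$, $\varepsilon$ and $\tau_0$, but not on the $\phi_j$ or $N_j$. *)

(* Defs.v *)
From HB Require Import structures.
From mathcomp Require Import all_boot all_order all_algebra.
From mathcomp Require Import all_classical all_reals all_analysis.
From mathcomp Require Import complex.

Set Implicit Arguments.
Unset Strict Implicit.
Unset Printing Implicit Defensive.

Import Order.TTheory GRing.Theory Num.Theory.
Import numFieldNormedType.Exports.

Local Open Scope classical_set_scope.
Local Open Scope ring_scope.

Section L2.
Variable R : realType.

(* L^2 norm over D of a complex-valued function; \_ extends by 0 outside D. *)
Definition L2norm d (T : measurableType d) (mu : {measure set T -> \bar R})
    (D : set T) (f : T -> R[i]) : \bar R :=
  'N[mu]_2%:E [ (fun x => (Normc.normc (f x))%:E) \_ D ]%E.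

Definition integralC d (T : measurableType d) (mu : {measure set T -> \bar R})
    (D : set T) (f : T -> R[i]) : R[i] :=
  ((\int[mu]_(x in D) complex.Re (f x))%R +i*
   (\int[mu]_(x in D) complex.Im (f x))%R)%C.

End L2.

Section Torus.
Variable R : realType.

Definition R3 := (R * R * R)%type.
Definition Z3 := (int * int * int)%type.

(* lebesgue_measure lives on measurableTypeR R, an alias of R with the same
   (Borel) sets but another display; R3m and R3 are convertible. *)
Definition R3m := (measurableTypeR R * measurableTypeR R * measurableTypeR R)%type.

Definition vol3 : set R3m -> \bar R :=
  ((@lebesgue_measure R \x @lebesgue_measure R) \x @lebesgue_measure R)%E.

HB.instance Definition _ := Measure.on vol3.

(* Needed since m1 \x m2 has no canonical sigma-finite instance for merely
   sigma-finite m1 and m2. *)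
Fact vol3_sigma_finite : sigma_finite [set: R3m] vol3.
Proof.
have /sigma_finiteP[F [TF ndF Foo]] := sigma_finiteT (@lebesgue_measure R).
exists (fun n => (F n `*` F n) `*` F n).
  rewrite predeqE => -[[x y] z]; split => // _.
  have FT (w : measurableTypeR R) : exists n, F n w.
    by have : setT w by []; rewrite TF => -[n _ Fnw]; exists n.
  have [[i Fx] [j Fy] [k Fz]] := And3 (FT x) (FT y) (FT z).
  exists (maxn (maxn i j) k) => //=; split; first split => /=.
  - by move: Fx; apply/subsetPset/ndF; rewrite !leq_max leqnn.
  - by move: Fy; apply/subsetPset/ndF; rewrite !leq_max leqnn orbT.
  - by move: Fz; apply/subsetPset/ndF; rewrite !leq_max leqnn orbT.
move=> k; have [mF Fk] := Foo k.
split; first exact: (measurableX (measurableX mF mF) mF).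
have mFF := measurableX mF mF.
have vF : vol3 ((F k `*` F k) `*` F k) =
    (lebesgue_measure (F k) * lebesgue_measure (F k) * lebesgue_measure (F k))%E.
  by rewrite /vol3 product_measure1E//= product_measure1E.
by rewrite vF !lte_mul_pinfty// ?ge0_fin_numE// ?mule_ge0// lte_mul_pinfty// ge0_fin_numE.
Qed.

HB.instance Definition _ :=
  Measure_isSigmaFinite.Build _ _ _ vol3 vol3_sigma_finite.

Definition vol_time_space : set (measurableTypeR R * R3m) -> \bar R :=
  (@lebesgue_measure R \x vol3)%E.

HB.instance Definition _ := Measure.on vol_time_space.

Definition cube : set R3 := (`[0, 1] `*` `[0, 1]) `*` `[0, 1].

Definition Z3toR3 (n : Z3) : R3 :=
  (n.1.1%:~R, n.1.2%:~R, n.2%:~R).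

Definition dot3 (a b : R3) : R := a.1.1 * b.1.1 + a.1.2 * b.1.2 + a.2 * b.2.

Definition normE3 (a : R3) : R := Num.sqrt (dot3 a a).

Definition L2normT3 (f : R3 -> R[i]) : \bar R := L2norm vol3 cube f.

(* Functions on R^3/Z^3 are represented by Z^3-periodic functions on R^3. *)
Definition L2T3 (f : R3 -> R[i]) : Prop :=
  [/\ forall (x : R3) (n : Z3), f (x + Z3toR3 n) = f x,
      measurable_fun [set: R3m] (fun x : R3m => complex.Re (f x)),
      measurable_fun [set: R3m] (fun x : R3m => complex.Im (f x)) &
      (L2normT3 f < +oo)%E].

(* e^{2 pi i s} *)
Definition expi2pi (s : R) : R[i] := (cos (2 * pi * s) +i* sin (2 * pi * s))%C.

Definition fourier (f : R3 -> R[i]) (n : Z3) : R[i] :=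
  integralC vol3 cube (fun x => expi2pi (- dot3 x (Z3toR3 n)) * f x).

Definition Qform (alpha : R3) (n : Z3) : R :=
  alpha.1.1 * n.1.1%:~R ^+ 2 + alpha.1.2 * n.1.2%:~R ^+ 2
  + alpha.2 * n.2%:~R ^+ 2.

Definition box (K : nat) : set Z3 :=
  [set n | [/\ (`|n.1.1| <= K)%N, (`|n.1.2| <= K)%N & (`|n.2| <= K)%N]].

Definition schrodinger_partial (alpha : R3) (t : R) (f : R3 -> R[i]) (K : nat)
    (x : R3) : R[i] :=
  \sum_(n \in box K)
    (fourier f n * expi2pi (dot3 (Z3toR3 n) x + Qform alpha n * t)).

(* The defining series of e^{it Delta} f converges in L^2(T^3), so its sum is
   determined up to null sets; xget picks a representative. The default value
   0 is never used for f in L^2(T^3), by the Riesz-Fischer theorem. *)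
Definition schrodinger (alpha : R3) (t : R) (f : R3 -> R[i]) : R3 -> R[i] :=
  xget (fun=> 0)
    [set u | L2T3 u /\
       L2normT3 (fun x => u x - schrodinger_partial alpha t f K x)
         @[K --> \oo] --> 0%E].

Definition cutoff (psi : R -> R) : Prop :=
  [/\ forall (k : nat) (s : R), derivable (derive1n k psi) s 1,
      closure [set s | psi s != 0] `<=` `]-2, 2[,
      forall s, 0 <= psi s,
      forall s, psi (- s) = psi s &
      forall s, `|s| <= 1 -> psi s = 1].

Definition dyadic (N : nat) : Prop := exists m : nat, N = (2 ^ m)%N.

Definition psiN (psi : R -> R) (N : nat) (xi : R3) : R :=
  if N == 1%N then psi (normE3 xi)
  else psi (normE3 xi / N%:R) - psi (2 * normE3 xi / N%:R).

(* The sum has finite support when psi has bounded support. *)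
Definition LPproj (psi : R -> R) (N : nat) (f : R3 -> R[i]) (x : R3) : R[i] :=
  \sum_(n \in [set: Z3])
    ((psiN psi N (Z3toR3 n))%:C%C * fourier f n
     * expi2pi (dot3 (Z3toR3 n) x)).

End Torus.

(* Main.v *)
Require Import Defs.
From HB Require Import structures.
From mathcomp Require Import all_boot all_order all_algebra.
From mathcomp Require Import all_classical all_reals all_analysis.
From mathcomp Require Import measurable_realfun complex ring lra zify.

Set Implicit Arguments.
Unset Strict Implicit.
Unset Printing Implicit Defensive.

Import Order.TTheory GRing.Theory Num.Theory.
Import numFieldNormedType.Exports.

Local Open Scope classical_set_scope.
Local Open Scope ring_scope.

(* Expanding the product and integrating over the torus leaves, for each
   total frequency [a], the time integral of the squared modulus of an
   exponential sum. Majorizing the indicator of [0, 1] by a triangle function,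
   whose Fourier transform is nonnegative and decays quadratically, Schur's test
   reduces the theorem to a bound on the number of (n1, n2, n3) with
   n1 + n2 + n3 = a and Q(n1) + Q(n2) + Q(n3) = b + O(1), at scales N1, N2, N3.

   With d = 2 n2 + n3 - a the form decouples into squares of the coordinates of
   d and n3, so a discrete Fejer kernel bounds this number by the time average of
   a product of one-dimensional quadratic Weyl sums, two for each coordinate.
   Hoelder's inequality separates the three (incommensurable) coordinates and
   the two scales; it uses the loss-free moments of order p > 4 of quadratic
   Weyl sums, which follow from Weyl differencing and Dirichlet approximation.
   This gives N2^(3/2+eps) N3^(5/2-eps), with a power of N3/N2 to spare.

   When N1 is much larger than N2, the constraint confines n1 to a slab, covered
   by (N2/M)^2 cubes of side M = 1 + N2^2/N1; applying the count to each of them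
   gains a power of M/N2 at the cost of a power of N2/N3, and the two bounds are
   interpolated. *)

(** * Elementary estimates *)

(** For [N3 = N2] the claimed power is [N2^2], with no epsilon left over. The fourth moment of a
    quadratic Weyl sum carries a logarithm, so both scales must use orders above 4. Hoelder asks for
    orders p at scale N2 and p' at scale N3 with 3/p + 3/p' = 1, which leaves room above 4. A moment
    N^(p-2) contributes N^(3-6/p); p slightly above 4 makes p' slightly below 12, whence 3/2 and
    5/2, twice the exponents 3/4 and 5/4 of the theorem. The total frequency a, of size up to N1,
    and the centres of the boxes enter only the linear and constant phases, in which the Weyl bounds
    are uniform; hence the basic count does not see N1. The gain is the quantity g = N3/N1 + 1/N2,
    which dominates (N3/N2)(M/N2): one of the two ratios is therefore small whenever g is, and each
    of the two counts exploits one of them. *)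

Section Elementary.
Variable R : realType.
Implicit Types (x y u : R).

(** The mean value theorem gives slope at least [cos 1] on [0, 1]; beyond 1,
    [sin u >= sin 1 >= cos 1] while [u < 2]. *)
Lemma sin_lower u : 0 <= u <= pi / 2 -> cos 1 / 2 * u <= sin u.
Proof.
have c1 : 0 < cos 1 :> R := cos1_gt0 R.
have c2 : cos 1 <= 1 :> R := cos_le1 1.
have sinc (v : R) : 0 <= v <= 1 -> cos 1 * v <= sin v.
  move=> /andP[]; rewrite le_eqVlt => /predU1P[<- _|v0 v1].
    by rewrite sin0 mulr0.
  have [z] : exists2 c, c \in `]0, v[%R & sin v - sin 0 = cos c * (v - 0).
    apply: MVT => //.
    by apply: continuous_subspaceT => ?; exact: continuous_sin.
  rewrite in_itv/= => /andP[z0 zv]; rewrite sin0 !subr0 => ->.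
  rewrite ler_wpM2r ?(ltW v0)//.
  have p2 := pihalf_ge1 R.
  rewrite leNgt ltr_cos ?in_itv/=; try lra.
move=> /andP[u0 u1]; have [ule|ugt] := leP u 1.
  by apply: le_trans (sinc u _); rewrite ?u0//; nra.
have p2 := pihalf_lt2 R; have p1 := pihalf_ge1 R.
have : sin 1 <= sin u.
  by rewrite leNgt ltr_sin ?in_itv/=; lra.
have := sinc 1; rewrite ler01 lexx => /(_ isT); nra.
Qed.

Lemma abs_sin_le u : `|sin u| <= `|u|.
Proof.
wlog u0 : u / 0 <= u.
  move=> H; have [/H//|/ltW u0] := leP 0 u.
  by rewrite -normrN -sinN -[leRHS]normrN H// oppr_ge0.
move: u0; rewrite le_eqVlt => /predU1P[<-|u0]; first by rewrite sin0 normr0.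
have [z _] : exists2 c, c \in `]0, u[%R & sin u - sin 0 = cos c * (u - 0).
  apply: MVT => //.
  by apply: continuous_subspaceT => ?; exact: continuous_sin.
rewrite sin0 !subr0 => ->.
by rewrite normrM ler_piMl ?cos_max.
Qed.

Lemma cos_ge_quadratic u : 1 - u ^+ 2 / 2 <= cos u.
Proof.
have -> : u = (u / 2) *+ 2 by rewrite mulr2n; field.
rewrite cos_mulr2n cos2sin2.
have := abs_sin_le (u / 2); rewrite -(@ler_pXn2r _ 2)// ?nnegrE//.
rewrite !real_normK ?num_real// => h; rewrite mulr2n; nra.
Qed.

Lemma sin_npi (n : nat) u : `|sin (u + n%:R * pi)| = `|sin u|.
Proof.
elim: n => [|n IH]; first by rewrite mul0r addr0.
by rewrite -natr1 mulrDl mul1r addrA sinDpi normrN.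
Qed.

(** On [0, 1], [Num.min x (1 - x)] is the distance to the nearest integer; the reflection of x to 1
    - x reduces to [0, 1/2]. *)
Lemma sin_pi_lower x : 0 <= x <= 1 -> cos 1 * Num.min x (1 - x) <= sin (pi * x).
Proof.
have c1 : 0 < cos 1 :> R := cos1_gt0 R.
have pi2 := pi_ge2 R.
have main y : 0 <= y <= 1 / 2 -> cos 1 * y <= sin (pi * y).
  move=> /andP[y0 y1]; apply: le_trans (sin_lower (u := pi * y) _); last by nra.
  have -> : cos 1 / 2 * (pi * y) = cos 1 * (pi / 2 * y) by field.
  by rewrite ler_wpM2l ?(ltW c1)// ler_peMl//; lra.
move=> /andP[x0 x1]; have [xh|xh] := leP x (1 / 2).
  by rewrite (min_idPl _); [apply: main; lra|lra].
rewrite (min_idPr _); last by lra.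
have -> : sin (pi * x) = sin (pi * (1 - x)).
  have -> : pi * (1 - x) = - (pi * x) + pi by ring.
  by rewrite sinDpi sinN opprK.
by apply: main; lra.
Qed.

(* Only the image of [s] matters, so repetitions in [s'] are harmless. *)
Lemma ler_sum_injective (I J : eqType) (s : seq I) (s' : seq J) (f : I -> J)
    (F : J -> R) :
  uniq s -> {in s &, injective f} -> (forall i, i \in s -> f i \in s') ->
  (forall j, 0 <= F j) ->
  \sum_(i <- s) F (f i) <= \sum_(j <- s') F j.
Proof.
move=> us finj im F0.
rewrite -(big_map f xpredT F).
have um : uniq (map f s) by rewrite map_inj_in_uniq.
have sub : {subset map f s <= s'} by move=> _ /mapP[i /im ? ->].
clear im; elim: (map f s) s' um sub => [|j t IH] s' /=.
  by move=> _ _; rewrite big_nil sumr_ge0.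
move=> /andP[jt ut] sub.
have js' : j \in s' by apply: sub; rewrite inE eqxx.
rewrite big_cons (big_rem j js')/= lerD2l IH// => k kt.
have : k \in s' by apply: sub; rewrite inE kt orbT.
rewrite (perm_mem (perm_to_rem js')) inE => /predU1P[kj|//].
by rewrite -kj kt in jt.
Qed.

(** Pigeonhole: two of the Q + 1 fractional parts of [i * x] share one of Q cells of length 1/Q.
    Dividing by the gcd only shrinks the error, and coprimality later makes multiplication by a
    injective modulo q. *)
Lemma dirichlet x (Q : nat) : 0 <= x -> (0 < Q)%N ->
  exists q a : nat, [/\ (0 < q <= Q)%N, coprime a q &
    `|q%:R * x - a%:R| <= Q%:R^-1].
Proof.
case: Q => // P x0 _; set Q := P.+1.
pose fr (i : nat) := i%:R * x - (Num.truncn (i%:R * x))%:R.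
have frP i : 0 <= fr i < 1.
  have /truncn_itv/andP[h1 h2] : 0 <= i%:R * x by rewrite mulr_ge0.
  by rewrite /fr; move: h2; rewrite -natr1; lra.
have Qr : 0 < Q%:R :> R by rewrite ltr0n.
pose cell (i : 'I_Q.+1) : 'I_P.+1 := inord (Num.truncn (Q%:R * fr i)).
have cellE i : (cell i : nat) = Num.truncn (Q%:R * fr i).
  have /andP[f0 f1] := frP i.
  by rewrite /cell inordK// truncn_lt_nat ?mulr_ge0 ?(ltW Qr)// gtr_pMr.
have /injectivePn[i [j ij cij]] : ~~ injectiveb cell.
  by apply/negP => /injectiveP/leq_card; rewrite !card_ord ltnn.
wlog lij : i j ij cij / (i < j)%N.
  move=> H; case: (ltngtP i j) => lij; first exact: (H i j).
    by apply: (H j i) => //; rewrite eq_sym.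
  by move/eqP: ij; case; apply: val_inj.
pose q := (j - i)%N; pose a := (Num.truncn (j%:R * x) - Num.truncn (i%:R * x))%N.
have lefl : (Num.truncn (i%:R * x) <= Num.truncn (j%:R * x))%N.
  by apply: le_truncn; rewrite ler_wpM2r// ler_nat ltnW.
have diff : `|q%:R * x - a%:R| <= Q%:R^-1.
  have -> : q%:R * x - a%:R = fr j - fr i.
    by rewrite /q /a /fr !natrB// 1?ltnW//; ring.
  have /andP[i0 i1] := frP i; have /andP[j0 j1] := frP j.
  have := congr1 val cij; rewrite /= !cellE => e.
  have /truncn_itv/andP[h1 h2] : 0 <= Q%:R * fr i by rewrite mulr_ge0// ltW.
  have /truncn_itv/andP[h3 h4] : 0 <= Q%:R * fr j by rewrite mulr_ge0// ltW.
  rewrite -e -natr1 in h3 h4; rewrite -natr1 in h2.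
  rewrite -(ler_pM2l Qr) mulfV ?gt_eqF// -{1}(ger0_norm (ltW Qr)) -normrM ler_norml.
  rewrite mulrBr; apply/andP; split; lra.
have q0 : (0 < q)%N by rewrite subn_gt0.
have g0 : (0 < gcdn a q)%N by rewrite gcdn_gt0 q0 orbT.
exists (q %/ gcdn a q)%N, (a %/ gcdn a q)%N; split.
- rewrite divn_gt0// dvdn_leq ?dvdn_gcdr//=.
  by apply: leq_trans (leq_div _ _) _; rewrite /q leq_subLR; have := ltn_ord j; lia.
- rewrite /coprime -(eqn_pmul2r g0) muln_gcdl !divnK ?dvdn_gcdl ?dvdn_gcdr//.
  by rewrite mul1n.
- have gr : 1 <= (gcdn a q)%:R :> R by rewrite ler1n.
  apply: le_trans diff.
  have -> : q%:R * x - a%:R =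
      (gcdn a q)%:R * ((q %/ gcdn a q)%:R * x - (a %/ gcdn a q)%:R).
    by rewrite mulrBr mulrA -!natrM ![(gcdn a q * _)%N]mulnC !divnK ?dvdn_gcdl ?dvdn_gcdr.
  by rewrite normrM ger0_norm ?ler0n// ler_peMl.
Qed.

End Elementary.

(** * Weyl sums *)

Section Weyl.
Variable R : realType.
Implicit Types (x y z a b u kappa : R).

Local Notation e := (@expi2pi R).

Lemma expi2piD x y : e (x + y) = e x * e y.
Proof. by rewrite /expi2pi mulrDr cosD sinD; simpc; congr (_ +i* _)%C; ring. Qed.

Lemma normc_expi2pi x : Normc.normc (e x) = 1.
Proof. by rewrite /= cos2Dsin2 sqrtr1. Qed.

Lemma normc_ge0 (z : R[i]) : 0 <= Normc.normc z.
Proof. by case: z => p q; rewrite sqrtr_ge0. Qed.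

Lemma sqr_normc_ReIm (z : R[i]) :
  Normc.normc z ^+ 2 = complex.Re z ^+ 2 + complex.Im z ^+ 2.
Proof. by case: z => p q /=; rewrite sqr_sqrtr// addr_ge0 ?sqr_ge0. Qed.

Lemma Re_sum (I : Type) (s : seq I) (F : I -> R[i]) :
  complex.Re (\sum_(i <- s) F i) = \sum_(i <- s) complex.Re (F i).
Proof. by elim/big_rec2: _ => // i y1 y2 _ <-; case: (F i) y2 => ? ? []. Qed.

Lemma Im_sum (I : Type) (s : seq I) (F : I -> R[i]) :
  complex.Im (\sum_(i <- s) F i) = \sum_(i <- s) complex.Im (F i).
Proof. by elim/big_rec2: _ => // i y1 y2 _ <-; case: (F i) y2 => ? ? []. Qed.

Lemma normc_sum_le (I : Type) (s : seq I) (F : I -> R[i]) :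
  Normc.normc (\sum_(i <- s) F i) <= \sum_(i <- s) Normc.normc (F i).
Proof.
elim/big_rec2: _ => [|i y1 y2 _ h]; first by rewrite Normc.normc0.
by apply: le_trans (le_normcD _ _) _; rewrite lerD2l.
Qed.

Lemma sqr_normc_sum_expi (I : Type) (s : seq I) (phi : I -> R) :
  Normc.normc (\sum_(i <- s) e (phi i)) ^+ 2 =
  \sum_(i <- s) \sum_(j <- s) cos (2 * pi * (phi i - phi j)).
Proof.
rewrite sqr_normc_ReIm Re_sum Im_sum !expr2 /=.
rewrite !big_distrl -big_split/=; apply: eq_bigr => i _.
rewrite !big_distrr -big_split/=; apply: eq_bigr => j _.
by rewrite mulrBr cosB.
Qed.

(** Pairs are grouped by their difference h, each unordered pair counting twice. It serves both Weyl
    differencing and the Fejer kernel. *)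
Lemma symmetric_double_sum (g : nat -> nat -> R) (N : nat) :
  (forall i j, g i j = g j i) ->
  \sum_(0 <= i < N) \sum_(0 <= j < N) g i j =
  \sum_(0 <= i < N) g i i +
  2 * \sum_(1 <= h < N) \sum_(0 <= j < N - h) g (j + h)%N j.
Proof.
move=> gC; elim: N => [|N IH]; first by rewrite !big_geq// mulr0 addr0.
rewrite big_nat_recr//= [\sum_(0 <= i < N.+1) g i i]big_nat_recr//=.
under eq_bigr do rewrite big_nat_recr//=.
rewrite big_split/= IH big_nat_recr//=.
have -> : \sum_(1 <= h < N.+1) \sum_(0 <= j < N.+1 - h) g (j + h)%N j =
  \sum_(1 <= h < N) \sum_(0 <= j < N - h) g (j + h)%N j + \sum_(0 <= j < N) g N j.
  transitivity (\sum_(1 <= h < N.+1) \sum_(0 <= j < N - h) g (j + h)%N j +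
    \sum_(1 <= h < N.+1) g N (N - h)%N).
    rewrite -big_split/=; apply: eq_big_nat => h /andP[h1 hN].
    by rewrite subSn// big_nat_recr//= subnK.
  congr (_ + _).
    case: N {IH} => [|N]; first by rewrite !big_geq.
    by rewrite big_nat_recr//= subnn [X in _ + X]big_geq// addr0.
  rewrite big_add1 /= [RHS]big_nat_rev/=.
  by apply: eq_big_nat => h /andP[_ hN]; congr (g _ _); lia.
under [\sum_(0 <= i < N) g i N]eq_bigr do rewrite gC.
ring.
Qed.

(** The factor [sin b] makes the sum telescope; it stays on the left because it may vanish. *)
Lemma sin_mul_sum_cos b y (n : nat) :
  `|sin b * \sum_(0 <= j < n) cos (2 * b * j%:R + y)| <= 1.
Proof.
have -> : sin b * \sum_(0 <= j < n) cos (2 * b * j%:R + y) =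
    (sin (2 * b * n%:R - b + y) - sin (- b + y)) / 2.
  elim: n => [|n IH]; first by rewrite big_geq// !mulr0 add0r subrr mul0r.
  rewrite big_nat_recr//= mulrDr IH -[n.+1%:R]natr1.
  have -> : 2 * b * (n%:R + 1) - b + y = (2 * b * n%:R + y) + b by ring.
  have -> : 2 * b * n%:R - b + y = (2 * b * n%:R + y) - b by ring.
  by rewrite [sin (_ + y + b)]sinD [sin (_ + y - b)]sinB; field.
have := sin_max (2 * b * n%:R - b + y); have := sin_max (- b + y).
by rewrite !ler_norml => /andP[? ?] /andP[? ?]; apply/andP; split; lra.
Qed.

Definition quadratic_sum (N : nat) (th y z : R) : R[i] :=
  \sum_(0 <= i < N) e (th * i%:R ^+ 2 + y * i%:R + z).

(** At lag h the squares cancel and the phase difference is linear in j with slope [2 * th * h]. Its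
    cosine sum, [G h] in modulus, is thus bounded both trivially and as a geometric sum. *)
Lemma weyl_differencing (N : nat) (th y z : R) :
  exists G : nat -> R,
    [/\ forall h, 0 <= G h <= N%:R,
        forall h, G h * `|sin (pi * (h%:R * (2 * th)))| <= 1 &
        Normc.normc (quadratic_sum N th y z) ^+ 2 <=
          N%:R + 2 * \sum_(1 <= h < N) G h].
Proof.
pose phi (i : nat) := th * i%:R ^+ 2 + y * i%:R + z.
pose g h := `|\sum_(0 <= j < N - h) cos (2 * pi * (phi (j + h)%N - phi j))|.
exists g; split.
- move=> h; rewrite normr_ge0/=; apply: le_trans (ler_norm_sum _ _ _) _.
  apply: (@le_trans _ _ (\sum_(0 <= j < N - h) 1)).
    by apply: ler_sum => j _; exact: cos_max.
  by rewrite big_const_nat iter_addr_0 subn0 ler_nat leq_subr.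
- move=> h; rewrite mulrC -normrM.
  under eq_bigr => j _.
    have -> : 2 * pi * (phi (j + h)%N - phi j) =
        2 * (pi * (h%:R * (2 * th))) * j%:R + 2 * pi * (th * h%:R ^+ 2 + y * h%:R).
      by rewrite /phi natrD; ring.
    over.
  exact: sin_mul_sum_cos.
- rewrite /quadratic_sum sqr_normc_sum_expi.
  rewrite (@symmetric_double_sum (fun i j => cos (2 * pi * (phi i - phi j)))); last first.
    by move=> i j; rewrite -cosN; congr cos; ring.
  apply: lerD.
    under eq_bigr do rewrite subrr mulr0 cos0.
    by rewrite big_const_nat iter_addr_0 subn0.
  rewrite ler_pM2l//; apply: ler_sum => h _; exact: ler_norm.
Qed.

(** Bernoulli's inequality for an exponent below 1, obtained from Young's inequality with weights
    kappa and 1 - kappa. *)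
Lemma powR_le1Bmul kappa u : 0 < kappa < 1 -> 0 <= u <= 1 ->
  (1 - u) `^ kappa <= 1 - kappa * u.
Proof.
move=> /andP[k0 k1] /andP[u0 u1].
have h : 0 < kappa^-1 by rewrite invr_gt0.
have h' : 0 < (1 - kappa)^-1 by rewrite invr_gt0 subr_gt0.
have := @conjugate_powR R ((1 - u) `^ kappa) 1 _ _ (powR_ge0 _ _) ler01 h h'.
rewrite !invrK subrKC => /(_ erefl).
rewrite mulr1 -powRrM mulfV ?gt_eqF// powRr1 ?subr_ge0// powR1 mul1r.
by move=> /le_trans; apply; lra.
Qed.

(** By Bernoulli, n^kappa <= (n+1)^kappa (1 - kappa/(n+1)), so the right side grows at each step by
    at least the new term. *)
Lemma sum_powR_le kappa (n : nat) : 0 < kappa < 1 ->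
  \sum_(1 <= l < n.+1) l%:R `^ (kappa - 1) <= n%:R `^ kappa / kappa.
Proof.
move=> k01; have /andP[k0 k1] := k01.
elim: n => [|n IH]; first by rewrite big_geq// divr_ge0 ?powR_ge0 ?ltW.
rewrite big_nat_recr//=; apply: (le_trans (lerD IH (lexx _))).
have n0 : 0 < n.+1%:R :> R by rewrite ltr0n.
have nE : n%:R = n.+1%:R * (1 - n.+1%:R^-1) :> R.
  by rewrite mulrBr mulr1 mulfV ?gt_eqF// -[n.+1%:R]natr1 addrK.
have i1 : n.+1%:R^-1 <= 1 :> R by rewrite invf_le1// ler1n.
have i0 : 0 <= n.+1%:R^-1 :> R by rewrite invr_ge0 ltW.
rewrite nE powRM ?subr_ge0 ?(ltW n0)//.
rewrite -[X in _ + X <= _](mulfK (lt0r_neq0 k0)) -mulrDl ler_pM2r ?invr_gt0//.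
have -> : n.+1%:R `^ (kappa - 1) = n.+1%:R `^ kappa * n.+1%:R^-1 :> R.
  by rewrite powRB ?powRr1 ?(ltW n0)// lt0r_neq0// implybT.
rewrite -mulrA -mulrDr ler_piMr ?powR_ge0//.
have := @powR_le1Bmul kappa n.+1%:R^-1 k01; rewrite i0 i1 => /(_ isT).
by move: (n.+1%:R^-1) => v h; lra.
Qed.

Lemma ler_powR_neg a b (s : R) : s <= 0 -> 0 < a -> a <= b -> b `^ s <= a `^ s.
Proof.
move=> s0 a0 ab; have b0 := lt_le_trans a0 ab.
rewrite -[s]opprK !(powRN _ (- s)) lef_pV2 ?posrE ?powR_gt0//.
by rewrite ge0_ler_powR ?nnegrE ?oppr_ge0// ltW.
Qed.

End Weyl.

(** * Major and minor arcs in the differenced sum *)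

Section Arcs.
Variable R : realType.
Implicit Types (x y z u kappa : R).

Lemma sum_powR_sub1_le kappa (n : nat) X : 0 < kappa < 1 -> n%:R <= X ->
  \sum_(1 <= l < n.+1) l%:R `^ (kappa - 1) <= X `^ kappa / kappa.
Proof.
move=> k01 nX; have /andP[k0 k1] := k01.
apply: le_trans (sum_powR_le n k01) _.
by rewrite ler_pM2r ?invr_gt0// ge0_ler_powR ?nnegrE ?(ltW k0)// (le_trans _ nX).
Qed.

(* When q divides h the size of the term is governed by |q x - a|, otherwise by
   the residue r of a h modulo q. *)
Lemma weyl_term_bound (N q a h : nat) x (g : R) : 0 <= x ->
  (0 < q)%N -> (0 < h < N)%N -> `|q%:R * x - a%:R| <= (2 * N)%:R^-1 ->
  0 <= g <= N%:R -> g * `|sin (pi * (h%:R * x))| <= 1 ->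
  let r := (h %% q * a %% q)%N in
  if r == 0%N then (coprime a q -> h = (h %/ q * q)%N /\
      g * (cos 1 * ((h %/ q)%:R * `|q%:R * x - a%:R|)) <= 1)
  else g <= 2 * q%:R / cos 1 * (r%:R^-1 + (q - r)%:R^-1).
Proof.
move=> x0 q0 /andP[h0 hN] dq /andP[g0 gN] gs r.
have c1 : 0 < cos 1 :> R := cos1_gt0 R.
have qr : 0 < q%:R :> R by rewrite ltr0n.
have N0 : 0 < N%:R :> R by rewrite ltr0n; lia.
have hNr : h%:R <= N%:R :> R by rewrite ler_nat ltnW.
have hr0 : 0 < h%:R :> R by rewrite ltr0n.
set d := q%:R * x - a%:R in dq *.
(* Since h < N, the error h d moves the residue r by at most a half, so h x modulo 1 stays close to
   r/q. *)
have hd : `|h%:R * d| <= 1 / 2.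
  rewrite normrM ger0_norm ?(ltW hr0)//.
  apply: (@le_trans _ _ (N%:R * (2 * N)%:R^-1)).
    by rewrite ler_pM ?(ltW hr0).
  by rewrite natrM invfM mulrCA mulfV ?gt_eqF// mul1r mulr1.
pose m := (h * a %/ q)%N.
have rE : r = (h * a %% q)%N by rewrite /r modnMml.
have haE : h%:R * a%:R = m%:R * q%:R + r%:R :> R.
  by rewrite rE -!natrM -natrD -divn_eq.
(* [w] is [h * x] minus the integer [m], which does not change the modulus of the sine. *)
pose w := (r%:R + h%:R * d) / q%:R.
have hx : pi * (h%:R * x) = pi * w + m%:R * pi.
  have -> : h%:R * x = w + m%:R.
    apply: (mulIf (lt0r_neq0 qr)); rewrite mulrDl /w mulfVK ?gt_eqF// /d.
    by rewrite mulrBr haE; ring.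
  by ring.
have sE : `|sin (pi * (h%:R * x))| = `|sin (pi * w)| by rewrite hx sin_npi.
rewrite sE in gs.
have rq : (r < q)%N by rewrite /r ltn_mod.
case: eqP => [r0|/eqP r0].
  move=> caq; have qh : (q %| h)%N.
    by move: r0; rewrite rE => /eqP; rewrite -/(dvdn _ _) Gauss_dvdl// coprime_sym.
  have hE : h = (h %/ q * q)%N by rewrite divnK.
  split=> //; set l := (h %/ q)%N.
  have wE : w = l%:R * d.
    apply: (mulIf (lt0r_neq0 qr)); rewrite /w mulfVK ?gt_eqF// r0 add0r.
    by rewrite hE natrM -/l; ring.
  have wl : `|w| <= 1 / 2.
    rewrite /w r0 add0r normrM normfV (ger0_norm (ltW qr)) ler_pdivrMr//.
    by apply: le_trans hd _; rewrite ler_peMr// ler1n.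
  have -> : l%:R * `|d| = `|w| by rewrite wE normrM ger0_norm.
  apply: le_trans gs; rewrite ler_wpM2l//.
  have := @sin_pi_lower R `|w|; rewrite normr_ge0 (le_trans wl) ?ler1Dl; last by lra.
  move=> /(_ isT); rewrite (min_idPl _); last by lra.
  move=> /le_trans; apply; apply: le_trans (ler_norm _) _.
  case: (ger0P w) => // _; by rewrite mulrN sinN normrN.
have r1 : 1 <= r%:R :> R by rewrite ler1n lt0n.
have qr1 : 1 <= (q - r)%:R :> R by rewrite ler1n subn_gt0.
have qB : (q - r)%:R = q%:R - r%:R :> R by rewrite natrB// ltnW.
have /andP[hd1 hd2] : - (1/2) <= h%:R * d <= 1 / 2 by rewrite -ler_norml.
(* As r and q - r are at least 1 and |h d| is at most 1/2, the distances of w to 0 and to 1 are at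
   least half of r/q and of (q - r)/q. *)
have w1 : r%:R / (2 * q%:R) <= w.
  rewrite /w ler_pdivlMr// invfM mulrA mulfVK ?gt_eqF//; lra.
have w2 : (q - r)%:R / (2 * q%:R) <= 1 - w.
  rewrite /w -(@ler_pM2r _ q%:R)// mulrBl mulfVK ?gt_eqF// mul1r invfM mulrA.
  rewrite mulfVK ?gt_eqF//; rewrite qB in qr1 *; lra.
have mn0 : 0 <= r%:R / (2 * q%:R) :> R by rewrite divr_ge0 ?mulr_ge0.
have mn1 : 0 <= (q - r)%:R / (2 * q%:R) :> R by rewrite divr_ge0 ?mulr_ge0.
have := @sin_pi_lower R w; rewrite (le_trans mn0 w1) -subr_ge0 (le_trans mn1 w2).
move=> /(_ isT) sl.
have {}sl : g * (cos 1 * Num.min w (1 - w)) <= 1.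
  apply: le_trans gs; rewrite ler_wpM2l//.
  by apply: le_trans sl _; exact: ler_norm.
have key (v : R) : 0 < v -> g * (cos 1 * (v / (2 * q%:R))) <= 1 ->
    g <= 2 * q%:R / cos 1 * v^-1.
  move=> v0 hv; rewrite -(@ler_pM2r _ (cos 1 * (v / (2 * q%:R)))) ?mulr_gt0 ?invr_gt0 ?mulr_gt0//.
  apply: le_trans hv _; rewrite [leRHS](_ : _ = 1)//; field.
  by rewrite !gt_eqF.
rewrite mulrDr; have [ww|ww] := leP w (1 - w).
  rewrite (min_idPl ww) in sl.
  apply: (@le_trans _ _ (2 * q%:R / cos 1 * r%:R^-1)); last first.
    by rewrite lerDl mulr_ge0 ?invr_ge0 ?divr_ge0 ?mulr_ge0 ?(ltW c1) ?(ltW qr).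
  apply: key; first by lra.
  by apply: le_trans sl; rewrite ler_wpM2l// ler_wpM2l// ltW.
rewrite (min_idPr (ltW ww)) in sl.
apply: (@le_trans _ _ (2 * q%:R / cos 1 * (q - r)%:R^-1)); last first.
  by rewrite lerDr mulr_ge0 ?invr_ge0 ?divr_ge0 ?mulr_ge0 ?(ltW c1) ?(ltW qr).
apply: key; first by lra.
by apply: le_trans sl; rewrite ler_wpM2l// ler_wpM2l// ltW.
Qed.

(** Write h = l q + i. For i = 0 the bounds N and 1/(l d) are combined and weakened to the power
    kappa - 1 of l, whose sum produces no logarithm: this is the major arc term. For i nonzero, the
    residues of i a give a harmonic sum of size q log q for each of about N/q + 1 values of l, hence
    the loss N^(1+kappa). *)
Lemma sum_weyl_terms kappa : 0 < kappa < 1 -> exists K : R, 0 < K /\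
  forall (N : nat) x (G : nat -> R), (0 < N)%N -> 0 <= x ->
  (forall h, 0 <= G h <= N%:R) ->
  (forall h, G h * `|sin (pi * (h%:R * x))| <= 1) ->
  exists q a : nat, [/\ (0 < q <= 2 * N)%N, a%:R <= q%:R * (x + 1) &
  \sum_(1 <= h < N) G h <= K * (N%:R `^ (1 + kappa) +
    N%:R ^+ 2 / q%:R * (1 + N%:R ^+ 2 * `|x - a%:R / q%:R|) `^ (kappa - 1))].
Proof.
move=> k01; have /andP[k0 k1] := k01.
have c1 : 0 < cos 1 :> R := cos1_gt0 R.
have c1le : cos 1 <= 1 :> R := cos_le1 1.
pose Ka := 2 * cos 1 `^ (kappa - 1) / kappa : R.
pose Kb := 24 / (cos 1 * kappa) : R.
have Ka0 : 0 < Ka by rewrite divr_gt0 ?mulr_gt0 ?powR_gt0.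
have Kb0 : 0 < Kb by rewrite divr_gt0 ?mulr_gt0.
exists (Ka + Kb); split; first exact: addr_gt0.
move=> N x G N0 x0 GN Gs.
have [|q [a [/andP[q0 q2N] caq dq]]] := @dirichlet R x (2 * N) x0.
  by rewrite muln_gt0.
exists q, a; split; first by rewrite q0.
  have /lerNnormlW : `|q%:R * x - a%:R| <= 1.
    by apply: le_trans dq _; rewrite invf_le1 ?ler1n ?ltr0n muln_gt0.
  by have : 1 <= q%:R :> R; [rewrite ler1n|lra].
have qr : 0 < q%:R :> R by rewrite ltr0n.
have Nr : 0 < N%:R :> R by rewrite ltr0n.
set d := `|q%:R * x - a%:R| in dq.
have d0 : 0 <= d by exact: normr_ge0.
have dE : `|x - a%:R / q%:R| = d / q%:R.
  have -> : x - a%:R / q%:R = (q%:R * x - a%:R) / q%:R by field; rewrite gt_eqF.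
  by rewrite normrM normfV (ger0_norm (ltW qr)).
rewrite dE; set z := N%:R ^+ 2 * (d / q%:R).
have z0 : 0 <= z by rewrite mulr_ge0 ?exprn_ge0 ?divr_ge0 ?(ltW qr).
pose L := N%:R / q%:R : R.
have L0 : 0 < L by rewrite divr_gt0.
(* Chosen so that 2 N / (1 + w) <= P l^(kappa - 1), where w = cos 1 l d N and 1 + w >= cos 1 (1 + z)
   l / L. *)
pose P := (2 * N%:R * (cos 1 `^ (kappa - 1) * (1 + z) `^ (kappa - 1) *
   L `^ (1 - kappa))).
have P0 : 0 <= P by rewrite !mulr_ge0 ?powR_ge0.
pose A (l : nat) := P * l%:R `^ (kappa - 1).
pose B (r : nat) := 2 * q%:R / cos 1 * (r%:R^-1 + (q - r)%:R^-1) : R.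
have A0 l : 0 <= A l by rewrite mulr_ge0 ?powR_ge0.
have B0 r : 0 <= B r.
  by rewrite !mulr_ge0 ?addr_ge0 ?invr_ge0 ?(ltW c1) ?(ltW qr).
pose F (p : nat * nat) := if p.2 == 0%N then A p.1 else B (p.2 * a %% q)%N.
have Glow h : (0 < h < N)%N -> G h <= F (h %/ q, h %% q)%N.
  move=> hh; have /andP[h0 hN] := hh.
  have := @weyl_term_bound N q a h x (G h) x0 q0 hh dq (GN h) (Gs h).
  rewrite /= /F /=; case: ifP => [/eqP r0 /(_ caq)[hE gd]|r0 gB]; last first.
    by case: ifP => // /eqP r1; rewrite r1 mul0n mod0n eqxx in r0.
  have -> : (h %% q == 0)%N by rewrite hE modnMl.
  set l := (h %/ q)%N in hE gd *.
  have l0 : (0 < l)%N by rewrite lt0n; apply: contraTneq h0 => l0; rewrite hE l0.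
  have lr : 0 < l%:R :> R by rewrite ltr0n.
  have lL : l%:R / L <= 1.
    rewrite ler_pdivrMr// mul1r ler_pdivlMr// -natrM -hE ler_nat ltnW//.
  have /andP[g0 gN] := GN h.
  pose w := cos 1 * (l%:R * d) * N%:R.
  have w0 : 0 <= w by rewrite !mulr_ge0 ?(ltW c1).
  have gw : G h <= 2 * N%:R / (1 + w).
    rewrite ler_pdivlMr; last by rewrite ltr_wpDr.
    have : G h * w <= N%:R by rewrite /w mulrA -[leRHS]mul1r ler_wpM2r.
    by move=> ?; rewrite mulrDr mulr1 mulr_natl mulr2n lerD.
  apply: (le_trans gw); rewrite /A /P -!mulrA ler_pM2l// ler_pM2l//.
  have low : cos 1 * (1 + z) * (l%:R / L) <= 1 + w.
    have -> : w = cos 1 * z * (l%:R / L).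
      by rewrite /w /z /L; field; rewrite !gt_eqF.
    have : cos 1 * (l%:R / L) <= 1.
      by rewrite -[leRHS]mulr1 ler_pM ?divr_ge0 ?(ltW c1) ?(ltW L0).
    by move: (l%:R / L) => v; lra.
  have pos : 0 < cos 1 * (1 + z) * (l%:R / L).
    by rewrite !mulr_gt0 ?invr_gt0 ?ltr_wpDr.
  apply: (@le_trans _ _ ((1 + w) `^ (kappa - 1))).
    rewrite -powR_inv1; last by rewrite addr_ge0.
    by apply: ler_powR; [rewrite lerDl|lra].
  apply: (le_trans (ler_powR_neg _ pos low)); first by lra.
  rewrite (@powRM _ (cos 1 * (1 + z)) (l%:R / L)) ?mulr_ge0 ?invr_ge0 ?addr_ge0 ?(ltW c1) ?(ltW L0)//.
  rewrite (@powRM _ (cos 1)) ?addr_ge0 ?(ltW c1)// (@powRM _ l%:R L^-1) ?invr_ge0 ?(ltW L0)//.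
  rewrite -(powR_inv1 (ltW L0)) -powRrM mulN1r opprB.
  by rewrite le_eqVlt; apply/orP; left; apply/eqP; ring.
apply: (@le_trans _ _ (\sum_(h <- index_iota 1 N) F (h %/ q, h %% q)%N)).
  by rewrite !big_seq; apply: ler_sum => h; rewrite mem_index_iota; exact: Glow.
pose n := (N %/ q)%N.
have nL : n%:R <= L by rewrite ler_pdivlMr// -natrM ler_nat leq_divM.
apply: (@le_trans _ _
   (\sum_(p <- [seq (l, i) | l <- iota 0 n.+1, i <- iota 0 q]) F p)).
  apply: (@ler_sum_injective R _ _ _ _ (fun h => (h %/ q, h %% q)%N) F).
  - exact: iota_uniq.
  - by move=> h h' _ _ [e1 e2]; rewrite (divn_eq h q) e1 e2 -divn_eq.
  - move=> h; rewrite mem_index_iota => /andP[h1 hN].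
    apply: allpairs_f; rewrite mem_iota add0n ?ltn_mod//.
    by rewrite ltnS leq_div2r// ltnW.
  - by case=> l i; rewrite /F; case: ifP.
rewrite big_allpairs_dep/=.
(* Multiplication by a permutes the nonzero residues modulo q; injectivity and nonvanishing are
   enough for the comparison of sums. *)
have inner l : \sum_(i <- iota 0 q) F (l, i) <= A l + \sum_(1 <= r < q) B r.
  have -> : iota 0 q = 0%N :: iota 1 q.-1 by case: (q) q0.
  rewrite big_cons /F /= lerD2l.
  rewrite (eq_big_seq (fun i => B (i * a %% q)%N)); last first.
    by case=> [|i]; rewrite mem_iota.
  rewrite (_ : index_iota 1 q = iota 1 q.-1); last first.
    by rewrite /index_iota subn1.
  apply: (@ler_sum_injective R _ _ _ _ (fun i => i * a %% q)%N B) => //.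
  - exact: iota_uniq.
  - move=> i j; rewrite !mem_iota => /andP[i0 iq] /andP[j0 jq] /eqP.
    wlog ij : i j i0 iq j0 jq / (i <= j)%N.
      move=> H; case: (leqP i j) => [|/ltnW] ij; first exact: H.
      by rewrite eq_sym => ?; apply/esym; apply: H.
    rewrite eq_sym eqn_mod_dvd ?leq_mul2r ?ij ?orbT// -mulnBl Gauss_dvdl 1?coprime_sym//.
    move=> qij; apply/eqP; rewrite eqn_leq ij /= -subn_eq0 -leqn0 leqNgt.
    apply/negP => /dvdn_leq/(_ qij) qle.
    have := leq_ltn_trans (leq_trans qle (leq_subr i j)) jq.
    by rewrite add1n prednK// ltnn.
  - move=> i; rewrite !mem_iota => /andP[i0 iq].
    rewrite add1n prednK// in iq *.
    rewrite ltn_mod q0 andbT lt0n; apply/negP; rewrite -/(dvdn _ _).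
    rewrite Gauss_dvdl 1?coprime_sym// => /(dvdn_leq i0).
    by rewrite leqNgt iq.
apply: (le_trans (ler_sum _ (fun l _ => inner l))).
rewrite big_split/= mulrDl mulrDr mulrDr addrACA.
have sA : \sum_(l <- iota 0 n.+1) A l <= Ka * (N%:R ^+ 2 / q%:R * (1 + z) `^ (kappa - 1)).
  (* The index l = 0 contributes nothing to [A]: a zero base with nonzero exponent has power 0. *)
  rewrite /= big_cons {1}/A powR0 ?mulr0 ?add0r; last by rewrite lt_eqF// subr_lt0.
  rewrite /A -mulr_sumr.
  have -> : iota 1 n = index_iota 1 n.+1 by rewrite /index_iota subn1.
  apply: (le_trans (ler_wpM2l P0 (sum_powR_sub1_le k01 nL))).
  rewrite /P /Ka.
  have LL : L `^ (1 - kappa) * L `^ kappa = L.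
    rewrite -powRD ?subrK ?powRr1 ?(ltW L0)//.
    by rewrite (lt0r_neq0 L0) implybT.
  have -> : 2 * N%:R * (cos 1 `^ (kappa - 1) * (1 + z) `^ (kappa - 1) * L `^ (1 - kappa)) *
    (L `^ kappa / kappa) = 2 * N%:R * (cos 1 `^ (kappa - 1) * (1 + z) `^ (kappa - 1)) / kappa
     * (L `^ (1 - kappa) * L `^ kappa) by ring.
  rewrite LL /L [leLHS](_ : _ = 2 * cos 1 `^ (kappa - 1) / kappa *
    (N%:R ^+ 2 / q%:R * (1 + z) `^ (kappa - 1)))//.
  by field; rewrite !gt_eqF.
have sB : \sum_(l <- iota 0 n.+1) \sum_(1 <= r < q) B r <= Kb * N%:R `^ (1 + kappa).
  rewrite big_const_seq count_predT size_iota iter_addr_0.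
  have Bs : \sum_(1 <= r < q) B r <= 4 * q%:R / cos 1 * ((2 * N)%:R `^ kappa / kappa).
    rewrite /B -mulr_sumr big_split/=.
    have h1 : \sum_(1 <= r < q) r%:R^-1 <= (2 * N)%:R `^ kappa / kappa :> R.
      case: q q0 q2N {qr dq dE z z0 L L0 P P0 A B A0 B0 F Glow n nL inner sA caq d d0} => // q _ q2N.
      apply: (@le_trans _ _ (\sum_(1 <= l < q.+1) l%:R `^ (kappa - 1))).
        rewrite big_seq [leRHS]big_seq; apply: ler_sum => l; rewrite mem_index_iota => /andP[l1 _].
        by rewrite -powR_inv1//; apply: ler_powR; [rewrite ler1n|lra].
      by apply: sum_powR_sub1_le => //; rewrite ler_nat ltnW.
    have h2 : \sum_(1 <= r < q) (q - r)%:R^-1 = \sum_(1 <= r < q) r%:R^-1 :> R.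
      rewrite [RHS]big_nat_rev/=; apply: eq_big_nat => i /andP[i1 i2].
      by rewrite add1n subSS.
    rewrite h2; move: h1; move: (\sum_(1 <= r < q) r%:R^-1) => S h1.
    rewrite [leLHS](_ : _ = 4 * q%:R / cos 1 * S); last by field; rewrite gt_eqF.
    by rewrite ler_wpM2l// mulr_ge0 ?invr_ge0 ?mulr_ge0 ?(ltW c1) ?(ltW qr).
  rewrite -[leLHS]mulr_natl.
  apply: le_trans (ler_wpM2l _ Bs) _ => //.
  have nq : n.+1%:R * q%:R <= 3 * N%:R :> R.
    rewrite -!natrM ler_nat mulSn (mulSn 2) addnC leq_add ?leq_divM//.
  have N2 : (2 * N)%:R `^ kappa <= 2 * N%:R `^ kappa :> R.
    rewrite natrM powRM// ler_wpM2r ?powR_ge0// -[leRHS]powRr1//.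
    by apply: ler_powR; [lra|exact: ltW].
  have -> : n.+1%:R * (4 * q%:R / cos 1 * ((2 * N)%:R `^ kappa / kappa)) =
     4 / (cos 1 * kappa) * (n.+1%:R * q%:R * (2 * N)%:R `^ kappa).
    by field; rewrite !gt_eqF.
  have -> : Kb * N%:R `^ (1 + kappa) = 4 / (cos 1 * kappa) * (3 * N%:R * (2 * N%:R `^ kappa)).
    rewrite powRD ?(lt0r_neq0 Nr) ?implybT// powRr1// /Kb.
    by field; rewrite !gt_eqF.
  rewrite ler_pM2l ?divr_gt0 ?mulr_gt0//.
  by rewrite ler_pM ?mulr_ge0 ?powR_ge0.
have U0 : 0 <= Ka * N%:R `^ (1 + kappa) by rewrite mulr_ge0 ?powR_ge0 ?ltW.
have V0 : 0 <= Kb * (N%:R ^+ 2 / q%:R * (1 + z) `^ (kappa - 1)).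
  apply: mulr_ge0; first exact: ltW.
  apply: mulr_ge0; last exact: powR_ge0.
  by apply: divr_ge0; [exact: exprn_ge0|exact: ltW].
move: sA sB => /= sA sB; lra.
Qed.

End Arcs.

(** * Convergent power sums and Hoelder's inequality for finite sums *)

Section Moments.
Variable R : realType.
Implicit Types (x y z u s kappa rho beta : R).

(** Comparison with an integral. The induction runs on the sharper bound from which the tail
    n^(-rho)/rho is subtracted. *)
Lemma sum_inv_powR_le rho (n : nat) : 0 < rho ->
  \sum_(1 <= q < n.+1) q%:R `^ (- 1 - rho) <= 1 + rho^-1.
Proof.
move=> r0; have ri0 : 0 < rho^-1 by rewrite invr_gt0.
case: n => [|n]; first by rewrite big_geq// addr_ge0// ltW.
suff : \sum_(1 <= q < n.+2) q%:R `^ (- 1 - rho) <=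
    1 + rho^-1 - n.+1%:R `^ (- rho) / rho.
  by move=> /le_trans; apply; rewrite gerDl oppr_le0 mulr_ge0 ?powR_ge0 ?ltW.
elim: n => [|n IH].
  by rewrite big_nat1 !powR1 mul1r addrK.
rewrite big_nat_recr//=; apply: (le_trans (lerD IH (lexx _))).
have n0 : 0 < n.+2%:R :> R by rewrite ltr0n.
have i0 : 0 < n.+2%:R^-1 :> R by rewrite invr_gt0.
have i1 : n.+2%:R^-1 < 1 :> R by rewrite invf_lt1// ltr1n.
have nE : n.+1%:R = n.+2%:R * (1 - n.+2%:R^-1) :> R.
  by rewrite mulrBr mulr1 mulfV ?gt_eqF// -[n.+2%:R]natr1 addrK.
rewrite nE powRM ?subr_ge0 ?(ltW n0) ?(ltW i1)//.
have -> : n.+2%:R `^ (- 1 - rho) = n.+2%:R `^ (- rho) * n.+2%:R^-1 :> R.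
  rewrite addrC powRD ?powR_inv1 ?(ltW n0)//.
  by rewrite lt0r_neq0// implybT.
have B : 1 + rho * n.+2%:R^-1 <= (1 - n.+2%:R^-1) `^ (- rho) :> R.
  rewrite /powR gt_eqF ?subr_gt0//; apply: le_trans (expR_ge1Dx _).
  rewrite lerD2l mulNr -mulrN ler_wpM2l ?(ltW r0)// lerNr.
  by apply: le_ln1Dx; rewrite ltrN2.
have P0 : 0 <= n.+2%:R `^ (- rho) / rho :> R by rewrite divr_ge0 ?powR_ge0 ?ltW.
have := ler_wpM2l P0 B.
have -> : n.+2%:R `^ (- rho) / rho * (1 + rho * n.+2%:R^-1) =
  n.+2%:R `^ (- rho) / rho + n.+2%:R `^ (- rho) * n.+2%:R^-1 :> R.
  by field; rewrite !gt_eqF.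
rewrite [_ `^ (- rho) / rho * _]mulrAC.
move: (_ `^ (- rho) * _ `^ (- rho) / rho) (_ `^ (- rho) / rho) => a b.
by move: (_ `^ (- rho) * _^-1) => c; lra.
Qed.

(* [x / (1 + |x|)] is a bounded primitive of [(1 + |x|) ^- 2]. *)
Lemma sum_inv_sqr_le s u (J : nat) : 0 < s <= 1 ->
  \sum_(0 <= j < J) (1 + `|s * j%:R - u|) ^- 2 <= 4 / s.
Proof.
move=> /andP[s0 s1]; pose g x := x / (1 + `|x|).
have d0 x : 0 < 1 + `|x| by rewrite ltr_wpDr.
have g1 x : `|g x| <= 1.
  rewrite /g normrM normfV (ger0_norm (ltW (d0 x))) ler_pdivrMr// mul1r.
  by rewrite lerDr.
(* The factor 2 absorbs the change of [1 + |x|] over one step, of length s at most 1. *)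
have step x : s * (1 + `|x|) ^- 2 <= 2 * (g (x + s) - g x).
  rewrite /g; case: (leP 0 x) => x0.
    rewrite !ger0_norm ?addr_ge0 ?(ltW s0)//.
    have -> : 2 * ((x + s) / (1 + (x + s)) - x / (1 + x)) =
      s * (2 / ((1 + x) * (1 + (x + s)))).
      by field; apply/andP; split; lra.
    rewrite ler_pM2l// expr2 -[_^-1]mul1r ler_pdivrMr; last by nra.
    rewrite mulrAC ler_pdivlMr; nra.
  rewrite (ltr0_norm x0); case: (leP 0 (x + s)) => xs.
    rewrite (ger0_norm xs).
    have h1 : (x + s) / 2 <= (x + s) / (1 + (x + s)).
      by rewrite ler_wpM2l// lef_pV2 ?posrE; lra.
    have h2 : - x / 2 <= - x / (1 - x).
      by rewrite ler_wpM2l ?lef_pV2 ?posrE; lra.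
    have h3 : s * (1 - x) ^- 2 <= s.
      by rewrite ler_piMr ?(ltW s0)// invf_le1 ?exprn_gt0 ?exprn_ege1; lra.
    by move: h2; rewrite mulNr [- x / (1 - x)]mulNr; lra.
  rewrite (ltr0_norm xs).
  have -> : 2 * ((x + s) / (1 - (x + s)) - x / (1 - x)) =
      s * (2 / ((1 - x) * (1 - (x + s)))).
    by field; apply/andP; split; lra.
  rewrite ler_pM2l// expr2 -[_^-1]mul1r ler_pdivrMr; last by nra.
  rewrite mulrAC ler_pdivlMr; nra.
rewrite ler_pdivlMr// mulrC mulr_sumr.
apply: (@le_trans _ _ (2 * (g (s * J%:R - u) - g (- u)))).
  elim: J => [|J IH]; first by rewrite big_geq// mulr0 add0r subrr mulr0.
  rewrite big_nat_recr//=; apply: (le_trans (lerD IH (step _))).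
  have -> : s * J.+1%:R - u = s * J%:R - u + s by rewrite -[J.+1%:R]natr1; ring.
  lra.
have := g1 (s * J%:R - u); have := g1 (- u).
by rewrite !ler_norml => /andP[? ?] /andP[? ?]; lra.
Qed.

(** The sums are normalised by their positive upper bounds [A] and [B], which avoids the case of
    vanishing sums; Young's inequality then applies term by term. *)
Lemma hoelder_sum (J : nat) (f g : nat -> R) (p q A B : R) :
  (forall j, 0 <= f j) -> (forall j, 0 <= g j) ->
  0 < p -> 0 < q -> p^-1 + q^-1 = 1 -> 0 < A -> 0 < B ->
  \sum_(0 <= j < J) f j `^ p <= A -> \sum_(0 <= j < J) g j `^ q <= B ->
  \sum_(0 <= j < J) f j * g j <= A `^ p^-1 * B `^ q^-1.
Proof.
move=> f0 g0 p0 q0 pq A0 B0 fA gB.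
have a0 : 0 < A `^ p^-1 by rewrite powR_gt0.
have b0 : 0 < B `^ q^-1 by rewrite powR_gt0.
rewrite -[leRHS]mul1r -ler_pdivrMr ?mulr_gt0// mulr_suml.
apply: (@le_trans _ _ (\sum_(0 <= j < J) (f j `^ p / A / p + g j `^ q / B / q))).
  apply: ler_sum => j _.
  have -> : f j * g j / (A `^ p^-1 * B `^ q^-1) = (f j / A `^ p^-1) * (g j / B `^ q^-1).
    by field; rewrite !gt_eqF.
  apply: le_trans (conjugate_powR _ _ p0 q0 pq) _; rewrite ?divr_ge0 ?(ltW a0) ?(ltW b0)//.
  have rootK (a t : R) : 0 < a -> 0 < t -> (a `^ t^-1)^-1 `^ t = a^-1.
    move=> a1 t1; rewrite -powRN -powRrM mulNr mulVf ?gt_eqF//.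
    by rewrite powR_inv1// ltW.
  by rewrite !powRM ?invr_ge0 ?(ltW a0) ?(ltW b0)// !rootK.
rewrite big_split/= -!mulr_suml -pq lerD//.
  by rewrite -[leRHS]mul1r ler_pM2r ?invr_gt0// ler_pdivrMr// mul1r.
by rewrite -[leRHS]mul1r ler_pM2r ?invr_gt0// ler_pdivrMr// mul1r.
Qed.

End Moments.

(** * Loss-free moments of quadratic Weyl sums *)

Section QuadraticMoment.
Variable R : realType.
Implicit Types (x y z u s kappa rho beta : R).

Lemma weyl_bound kappa : 0 < kappa < 1 -> exists K : R, 0 < K /\
  forall (N : nat) th y z, (0 < N)%N -> 0 <= th ->
  exists q a : nat, [/\ (0 < q <= 2 * N)%N, a%:R <= q%:R * (2 * th + 1) &
  Normc.normc (quadratic_sum N th y z) ^+ 2 <= K * (N%:R `^ (1 + kappa) +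
    N%:R ^+ 2 / q%:R * (1 + N%:R ^+ 2 * `|2 * th - a%:R / q%:R|) `^ (kappa - 1))].
Proof.
move=> k01; have /andP[k0 k1] := k01.
have [K [K0 HK]] := sum_weyl_terms k01.
exists (2 * K + 1); split; first by rewrite addr_gt0 ?mulr_gt0.
move=> N th y z N0 th0; have [G [GN Gs h]] := weyl_differencing N th y z.
have x0 : 0 <= 2 * th by rewrite mulr_ge0.
have [q [a [qN aq hS]]] := HK N (2 * th) G N0 x0 GN Gs.
exists q, a; split => //; apply: le_trans h _.
have : N%:R <= N%:R `^ (1 + kappa) :> R.
  by apply: le1r_powR; rewrite ?ler1n ?lerDl// ltW.
have : 0 <= N%:R ^+ 2 / q%:R * (1 + N%:R ^+ 2 * `|2 * th - a%:R / q%:R|) `^ (kappa - 1).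
  by rewrite mulr_ge0 ?powR_ge0 ?divr_ge0.
by move: hS; move: (_ / q%:R * _) (\sum_(1 <= h < N) G h) => T S; lra.
Qed.

Lemma powRD_le u v rho : 0 <= u -> 0 <= v -> 0 <= rho ->
  (u + v) `^ rho <= 2 `^ rho * (u `^ rho + v `^ rho).
Proof.
move=> u0 v0 r0; wlog uv : u v u0 v0 / u <= v.
  move=> H; have [/H|/ltW/H] := leP u v; first exact.
  by rewrite addrC (addrC (u `^ _)); exact.
apply: (@le_trans _ _ ((2 * v) `^ rho)).
  by rewrite ge0_ler_powR ?nnegrE ?addr_ge0 ?mulr_ge0//; lra.
by rewrite powRM// ler_wpM2l ?powR_ge0// lerDr powR_ge0.
Qed.

(** The order r = 2/(1 - kappa) of the squared modulus is dictated by [weyl_bound]: (1 + kappa) r =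
    2 r - 2 gives the minor arc term the right size, and (kappa - 1) r = -2 makes the major arc term
    decay quadratically. As r > 2, the sum over q of q^(1-r), the numerators being about q in
    number, converges, so no power of N is lost. The J sample times resolve arcs of width N^(-2). *)
Lemma quadratic_moment kappa (B : nat) : 0 < kappa < 1 -> (0 < B)%N ->
  exists K : R, 0 < K /\
  forall (N J : nat) beta (y z : nat -> R), (0 < N)%N ->
  B%:R^-1 <= beta <= B%:R -> (2 * B * N ^ 2 <= J)%N ->
  \sum_(0 <= j < J)
    (Normc.normc (quadratic_sum N (beta * (j%:R / J%:R)) (y j) (z j)) ^+ 2)
      `^ (2 / (1 - kappa)) <=
  K * J%:R * N%:R `^ (2 * (2 / (1 - kappa)) - 2).
Proof.
move=> k01 B0; have /andP[k0 k1] := k01; have [K [K0 HK]] := weyl_bound k01.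
have k1' : 0 < 1 - kappa by rewrite subr_gt0.
set r := 2 / (1 - kappa).
have r2 : 2 < r by rewrite ltr_pdivlMr//; lra.
have r0 : 0 < r by apply: lt_trans r2.
have Br : 1 <= B%:R :> R by rewrite ler1n.
have Br0 : 0 < B%:R :> R by rewrite ltr0n.
(* Only numerators a <= q (2 th + 1) occur, and th <= beta <= B. *)
pose A := (2 * B).+1.
pose K1 := (A.+1%:R * (2 * B)%:R * (1 + (r - 2)^-1)) : R.
have K10 : 0 <= K1.
  by rewrite /K1 !mulr_ge0// addr_ge0// invr_ge0 subr_ge0 ltW.
exists (K `^ r * 2 `^ r * (1 + K1)); split.
  by rewrite !mulr_gt0 ?powR_gt0 ?ltr_wpDr.
move=> N J beta y z N0 /andP[b0 bB] NJ.
have beta0 : 0 < beta by apply: lt_le_trans b0; rewrite invr_gt0.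
have Nr : 0 < N%:R :> R by rewrite ltr0n.
have J0 : (0 < J)%N by apply: leq_trans NJ; rewrite !muln_gt0 B0 ?expn_gt0 N0.
have Jr : 0 < J%:R :> R by rewrite ltr0n.
pose Phi (q a j : nat) : R := (N%:R ^+ 2 / q%:R) `^ r *
  (1 + N%:R ^+ 2 * `|2 * (beta * (j%:R / J%:R)) - a%:R / q%:R|) ^- 2.
have Phi0 q a j : 0 <= Phi q a j.
  by rewrite mulr_ge0 ?powR_ge0// invr_ge0 exprn_ge0// addr_ge0// mulr_ge0// exprn_ge0.
(* The approximating fraction a/q depends on j; summing over all candidates removes this
   dependence. *)
have point j : (j < J)%N ->
    (Normc.normc (quadratic_sum N (beta * (j%:R / J%:R)) (y j) (z j)) ^+ 2) `^ r <=
    K `^ r * 2 `^ r * (N%:R `^ (2 * r - 2) +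
      \sum_(1 <= q < (2 * N).+1) \sum_(0 <= a < (A * q).+1) Phi q a j).
  move=> jJ; have th0 : 0 <= beta * (j%:R / J%:R) by rewrite mulr_ge0 ?divr_ge0 ?(ltW beta0).
  have [q [a [/andP[q0 q2N] aq hS]]] := HK N _ (y j) (z j) N0 th0.
  have qr : 0 < q%:R :> R by rewrite ltr0n.
  have U0 : 0 <= N%:R `^ (1 + kappa) :> R by rewrite powR_ge0.
  set T := N%:R ^+ 2 / q%:R * _ in hS.
  have T0 : 0 <= T by rewrite /T mulr_ge0 ?powR_ge0 ?divr_ge0.
  apply: (@le_trans _ _ ((K * (N%:R `^ (1 + kappa) + T)) `^ r)).
    apply: ge0_ler_powR; rewrite ?nnegrE ?sqr_ge0 ?(ltW r0)//.
    by rewrite mulr_ge0 ?(ltW K0) ?addr_ge0.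
  rewrite powRM ?(ltW K0) ?addr_ge0// -mulrA ler_wpM2l ?powR_ge0//.
  apply: (le_trans (powRD_le U0 T0 (ltW r0))); rewrite ler_wpM2l ?powR_ge0//.
  apply: lerD.
    rewrite -powRrM (_ : (1 + kappa) * r = 2 * r - 2)// /r; field.
    by rewrite gt_eqF.
  have aA : (a <= A * q)%N.
    rewrite -(ler_nat R); apply: (le_trans aq); rewrite natrM mulrC ler_wpM2r ?(ltW qr)//.
    rewrite /A -[(2 * B).+1%:R]natr1 lerD2r natrM ler_pM2l//.
    apply: le_trans bB; rewrite ler_piMr ?(ltW beta0)// ler_pdivrMr// mul1r.
    by rewrite ler_nat ltnW.
  have TE : T `^ r = Phi q a j.
    have w0 : 0 <= 1 + N%:R ^+ 2 * `|2 * (beta * (j%:R / J%:R)) - a%:R / q%:R|.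
      by rewrite addr_ge0// mulr_ge0// exprn_ge0.
    rewrite /T /Phi powRM ?powR_ge0 ?divr_ge0// -powRrM.
    have -> : (kappa - 1) * r = - 2%:R by rewrite /r; field; rewrite gt_eqF.
    by rewrite powR_invn.
  rewrite TE.
  apply: (@le_trans _ _ (\sum_(0 <= a < (A * q).+1) Phi q a j)).
    rewrite (bigD1_seq a) ?iota_uniq ?mem_index_iota//=.
    by rewrite lerDl sumr_ge0.
  rewrite [leRHS](bigD1_seq q) ?iota_uniq ?mem_index_iota ?q0//=.
  by rewrite lerDl sumr_ge0// => q' _; rewrite sumr_ge0.
rewrite big_seq.
apply: (@le_trans _ _ (\sum_(0 <= j < J) K `^ r * 2 `^ r * (N%:R `^ (2 * r - 2) +
      \sum_(1 <= q < (2 * N).+1) \sum_(0 <= a < (A * q).+1) Phi q a j))).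
  rewrite [leRHS]big_seq; apply: ler_sum => j; rewrite mem_index_iota => /andP[_ jJ].
  exact: point.
rewrite -mulr_sumr -!mulrA ler_wpM2l ?powR_ge0// ler_wpM2l ?powR_ge0//.
rewrite big_split/= big_const_nat iter_addr_0 subn0 [leRHS]mulrDl mul1r.
apply: lerD; first by rewrite [leRHS]mulr_natl.
rewrite exchange_big/=.
(* [s] is the increment of N^2 (2 th) between consecutive sample times; the lower bound on J ensures
   s <= 1. *)
pose s := 2 * beta * N%:R ^+ 2 / J%:R.
have s0 : 0 < s by rewrite divr_gt0 ?mulr_gt0 ?exprn_gt0.
have s1 : s <= 1.
  have NJr : 2 * B%:R * N%:R ^+ 2 <= J%:R :> R by rewrite -natrX -!natrM ler_nat.
  rewrite ler_pdivrMr// mul1r; apply: le_trans NJr; rewrite ler_wpM2r ?exprn_ge0 ?(ltW Nr)//; lra.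
have inner q a : \sum_(0 <= j < J) Phi q a j <=
    (N%:R ^+ 2 / q%:R) `^ r * ((2 * B)%:R * J%:R / N%:R ^+ 2).
  rewrite /Phi -mulr_sumr ler_wpM2l ?powR_ge0//.
  have s01 : 0 < s <= 1 by rewrite s0.
  have := @sum_inv_sqr_le R s (N%:R ^+ 2 * (a%:R / q%:R)) J s01.
  rewrite (eq_bigr (fun j : nat =>
    (1 + N%:R ^+ 2 * `|2 * (beta * (j%:R / J%:R)) - a%:R / q%:R|) ^- 2)); last first.
    move=> j _; congr ((1 + _) ^- 2).
    rewrite -[in RHS](@ger0_norm _ (N%:R ^+ 2)) ?exprn_ge0// -normrM; congr `|_|.
    rewrite mulrBr; congr (_ - _).
    by rewrite /s; field; rewrite gt_eqF.
  move=> /le_trans; apply; rewrite ler_pdivrMr//.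
  have -> : (2 * B)%:R * J%:R / N%:R ^+ 2 * s = 4 * (B%:R * beta).
    by rewrite /s natrM; field; rewrite !gt_eqF.
  have : B%:R^-1 * B%:R <= beta * B%:R by rewrite ler_wpM2r ?ler0n.
  by rewrite mulVf ?gt_eqF//; lra.
apply: (@le_trans _ _ (\sum_(1 <= q < (2 * N).+1) A.+1%:R * (2 * B)%:R * J%:R *
    N%:R `^ (2 * r - 2) * q%:R `^ (- 1 - (r - 2)))).
  rewrite big_seq [leRHS]big_seq; apply: ler_sum => q; rewrite mem_index_iota => /andP[q0 _].
  have qr : 0 < q%:R :> R by rewrite ltr0n.
  rewrite exchange_big/=.
  apply: (le_trans (ler_sum _ (fun a _ => inner q a))).
  rewrite big_const_nat iter_addr_0 subn0 -[leLHS]mulr_natl.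
  have -> : (N%:R ^+ 2 / q%:R) `^ r * ((2 * B)%:R * J%:R / N%:R ^+ 2) =
     (2 * B)%:R * J%:R * (N%:R `^ (2 * r - 2) * (q%:R `^ (- 1 - (r - 2)) / q%:R)).
    have -> : q%:R `^ (-1 - (r - 2)) / q%:R = q%:R `^ (- r).
      rewrite -(powR_inv1 (ltW qr)) -powRD ?lt0r_neq0 ?implybT//.
      by congr (_ `^ _); ring.
    have -> : N%:R `^ (2 * r - 2) = (N%:R ^+ 2) `^ r / N%:R ^+ 2 :> R.
      rewrite powRB ?lt0r_neq0 ?implybT// powRrM (powR_mulrn 2) ?(ltW Nr)//.
    rewrite powRM ?exprn_ge0 ?invr_ge0 ?(ltW qr)//.
    rewrite -(powR_inv1 (ltW qr)) -powRrM mulN1r; ring.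
  have A1 : (A * q).+1%:R <= A.+1%:R * q%:R :> R.
    by rewrite -natrM ler_nat mulSn -add1n leq_add2r.
  rewrite [leRHS](_ : _ = A.+1%:R * q%:R * ((2 * B)%:R * J%:R *
     (N%:R `^ (2 * r - 2) * (q%:R `^ (- 1 - (r - 2)) / q%:R)))); last by field; rewrite gt_eqF.
  by rewrite ler_wpM2r// !mulr_ge0 ?powR_ge0// ?invr_ge0 ?(ltW qr).
rewrite -mulr_sumr /K1.
have r20 : 0 < r - 2 by rewrite subr_gt0.
have := sum_inv_powR_le (2 * N) r20.
have P0 : 0 <= A.+1%:R * (2 * B)%:R * J%:R * N%:R `^ (2 * r - 2) :> R.
  by rewrite !mulr_ge0 ?powR_ge0.
move=> /(ler_wpM2l P0) /le_trans; apply.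
by rewrite le_eqVlt; apply/orP; left; apply/eqP; ring.
Qed.

End QuadraticMoment.

(** * Counting lattice points *)

Section Counting.
Variable R : realType.
Implicit Types (x y z u s t kappa beta : R).

Local Notation e := (@expi2pi R).
Local Notation normc := Normc.normc.

Definition fejer (J : nat) x : R :=
  normc (\sum_(0 <= j < J) e (x * (j%:R / J%:R))) ^+ 2 / J%:R ^+ 2.

Lemma fejer_ge0 (J : nat) x : 0 <= fejer J x.
Proof. by rewrite divr_ge0 ?exprn_ge0 ?normc_ge0. Qed.

(** For |x| <= 1/8 all phases 2 pi x j/J are at most 1 in modulus, because pi < 4, so every cosine
    is at least 1/2. This is the origin of the tolerance 1/8 in the counts. *)
Lemma fejer_lower (J : nat) x : (0 < J)%N -> `|x| <= 1 / 8 ->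
  1 <= 4 * fejer J x.
Proof.
move=> J0 x8; have Jr : 0 < J%:R :> R by rewrite ltr0n.
rewrite /fejer mulrA ler_pdivlMr ?exprn_gt0// mul1r.
have low : J%:R / 2 <= complex.Re (\sum_(0 <= j < J) e (x * (j%:R / J%:R))).
  rewrite Re_sum.
  have -> : J%:R / 2 = \sum_(0 <= j < J) 2^-1 :> R.
    by rewrite big_const_nat iter_addr_0 subn0 -[RHS]mulr_natl.
  rewrite big_seq [leRHS]big_seq; apply: ler_sum => j; rewrite mem_index_iota => /andP[_ jJ] /=.
  apply: le_trans (cos_ge_quadratic _).
  have jJr : 0 <= (j%:R / J%:R : R) <= 1.
    apply/andP; split; first exact: divr_ge0.
    by rewrite ler_pdivrMr// mul1r ler_nat ltnW.
  move: (_ / _) jJr => w /andP[w0 w1].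
  have h : `|2 * pi * (x * w)| <= 1.
    have p2 := pihalf_lt2 R; have p0 := pi_gt0 R.
    rewrite !normrM (ger0_norm w0) (ger0_norm (ltW p0)) ger0_norm//.
    apply: (@le_trans _ _ (2 * pi * (`|x| * 1))); last by have n0 := normr_ge0 x; nra.
    by rewrite ler_pM2l ?mulr_gt0// ler_wpM2l.
  have : (2 * pi * (x * w)) ^+ 2 <= 1.
    by rewrite -real_normK ?num_real// -[leRHS](expr1n _ 2) ler_pXn2r ?nnegrE.
  lra.
rewrite sqr_normc_ReIm.
have h0 : 0 <= J%:R / 2 :> R by rewrite divr_ge0.
have : (J%:R / 2) ^+ 2 <= complex.Re (\sum_(0 <= j < J) e (x * (j%:R / J%:R))) ^+ 2.
  by rewrite ler_pXn2r ?nnegrE// (le_trans h0).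
have := sqr_ge0 (complex.Im (\sum_(0 <= j < J) e (x * (j%:R / J%:R)))).
by rewrite expr_div_n; lra.
Qed.

(** After expanding the square, the sum over i depends on the two times only through their distance,
    and each distance occurs at most 2 J times. *)
Lemma sum_fejer_le (J : nat) (I : Type) (s : seq I) (Y : I -> R) : (0 < J)%N ->
  \sum_(i <- s) fejer J (Y i) <=
  2 / J%:R * \sum_(0 <= j < J) normc (\sum_(i <- s) e (Y i * (j%:R / J%:R))).
Proof.
move=> J0; have Jr : 0 < J%:R :> R by rewrite ltr0n.
pose H (h : nat) := normc (\sum_(i <- s) e (Y i * (h%:R / J%:R))).
pose d (j k : nat) := (maxn j k - minn j k)%N.
have H0 h : 0 <= H h by exact: normc_ge0.
rewrite /fejer -mulr_suml ler_pdivrMr ?exprn_gt0//.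
under eq_bigr do rewrite sqr_normc_sum_expi.
rewrite exchange_big/=; under eq_bigr do rewrite exchange_big/=.
apply: (@le_trans _ _ (\sum_(0 <= j < J) \sum_(0 <= k < J) H (d j k))).
  apply: ler_sum => j _; apply: ler_sum => k _.
  rewrite (eq_bigr (fun i => complex.Re (e (Y i * ((d j k)%:R / J%:R))))); last first.
    move=> i _ /=; rewrite -mulrBr -mulrBl /d.
    case: (leqP k j) => kj.
      by rewrite natrB.
    rewrite natrB 1?ltnW// -cosN -mulrN -mulrN -mulNr opprB//.
  rewrite -Re_sum /H; case: (\sum_(i <- s) _) => p q /=.
  apply: le_trans (ler_norm _) _; rewrite -sqrtr_sqr ler_wsqrtr// lerDl sqr_ge0//.
rewrite symmetric_double_sum; last by move=> i j; rewrite /d maxnC minnC.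
rewrite [leRHS](_ : _ = 2 * (J%:R * \sum_(0 <= j < J) H j)); last first.
  by rewrite /H; field; rewrite gt_eqF.
have dE j h : d (j + h)%N j = h by rewrite /d; lia.
have d0 j : d j j = 0%N by rewrite /d; lia.
under eq_bigr do rewrite d0.
rewrite big_const_nat iter_addr_0 subn0 -[X in X + _]mulr_natl.
case: J J0 Jr @H @d H0 dE d0 => // J _ Jr H d H0 dE d0.
rewrite (big_nat_recl _ _ _ (leq0n J))/= [X in _ <= 2 * (_ * (_ + X))](_ : _ =
   \sum_(1 <= h < J.+1) H h); last by rewrite big_add1.
apply: (@le_trans _ _ (J.+1%:R * H 0%N + 2 * (J.+1%:R * \sum_(1 <= h < J.+1) H h))).
  rewrite lerD2l ler_pM2l// mulr_sumr; apply: ler_sum => h _.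
  under eq_bigr do rewrite dE.
  rewrite big_const_nat iter_addr_0 subn0 -[leLHS]mulr_natl.
  by rewrite ler_wpM2r// ler_nat leq_subr.
by have := mulr_ge0 (ltW Jr) (H0 0%N); lra.
Qed.

(** For d = 2 n + m - a one has n^2 + m^2 + (a - n - m)^2 = (d^2 + 3 m^2 - 2 a m + a^2)/2. Here d =
    D + p.1 and m = M + p.2, the offsets turning both variables into natural indices. *)
Definition coord_phase (al a D M : R) (p : nat * nat) : R :=
  al / 2 * (3 * (M + p.2%:R) ^+ 2 - 2 * a * (M + p.2%:R) + a ^+ 2 + (D + p.1%:R) ^+ 2).

Definition index_pairs (N N' : nat) : seq (nat * nat) :=
  [seq (k, l) | k <- iota 0 N, l <- iota 0 N'].

(** The phase has no cross term, so the sum factors. The parameters [a], [D] and [M] enter only the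
    linear and constant phases. *)
Lemma sum_coord_phase (N N' : nat) al a D M t :
  \sum_(p <- index_pairs N N') e (coord_phase al a D M p * t) =
  quadratic_sum N (al / 2 * t) (al * t * D) (al * t * D ^+ 2 / 2) *
  quadratic_sum N' (3 * al / 2 * t) (3 * al * t * M - al * t * a)
    (al / 2 * t * (3 * M ^+ 2 - 2 * a * M + a ^+ 2)).
Proof.
rewrite big_allpairs_dep/= /quadratic_sum /index_iota !subn0 big_distrl/=.
apply: eq_bigr => k _; rewrite big_distrr/=; apply: eq_bigr => l _.
by rewrite -expi2piD /coord_phase; congr expi2pi; field.
Qed.

(** Hoelder with the orders p = 4/(1 - kappa) and p' = 4/(1/3 + kappa), both above 4 and satisfying
    3/p + 3/p' = 1. The exponents 3 - 6/p and 3 - 6/p' are those of N and N'. The cube is there for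
    the three coordinates. *)
Lemma moment_product kappa (B : nat) : 0 < kappa < 2 / 3 -> (0 < B)%N ->
  exists K : R, 0 < K /\ forall (N N' J : nat) beta beta' (y z y' z' : nat -> R),
  (0 < N)%N -> (0 < N')%N -> B%:R^-1 <= beta <= B%:R -> B%:R^-1 <= beta' <= B%:R ->
  (2 * B * N ^ 2 <= J)%N -> (2 * B * N' ^ 2 <= J)%N ->
  \sum_(0 <= j < J)
    (normc (quadratic_sum N (beta * (j%:R / J%:R)) (y j) (z j)) *
     normc (quadratic_sum N' (beta' * (j%:R / J%:R)) (y' j) (z' j))) ^+ 3 <=
  K * J%:R * N%:R `^ (3 / 2 + 3 / 2 * kappa) * N'%:R `^ (5 / 2 - 3 / 2 * kappa).
Proof.
move=> /andP[k0 k2] B0.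
have k01 : 0 < kappa < 1 by apply/andP; split; lra.
have k01' : 0 < 2 / 3 - kappa < 1 by apply/andP; split; lra.
have [K [K0 HK]] := @quadratic_moment R kappa B k01 B0.
have [K' [K0' HK']] := @quadratic_moment R (2 / 3 - kappa) B k01' B0.
pose p : R := 4 / 3 / (1 - kappa); pose p' : R := 4 / 3 / (1 - (2 / 3 - kappa)).
have p0 : 0 < p by rewrite divr_gt0//; lra.
have p0' : 0 < p' by rewrite divr_gt0//; lra.
exists (K `^ p^-1 * K' `^ p'^-1); split; first by rewrite mulr_gt0 ?powR_gt0.
move=> N N' J beta beta' y z y' z' N0 N0' hb hb' NJ NJ'.
have h := HK N J beta y z N0 hb NJ; have h' := HK' N' J beta' y' z' N0' hb' NJ'.
have J0 : (0 < J)%N by apply: leq_trans NJ; rewrite !muln_gt0 B0 ?expn_gt0 N0.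
have Jr : 0 < J%:R :> R by rewrite ltr0n.
have Nr : 0 < N%:R :> R by rewrite ltr0n.
have Nr' : 0 < N'%:R :> R by rewrite ltr0n.
pose f j := normc (quadratic_sum N (beta * (j%:R / J%:R)) (y j) (z j)).
pose f' j := normc (quadratic_sum N' (beta' * (j%:R / J%:R)) (y' j) (z' j)).
have cube (u w : R) : 0 <= u -> (u ^+ 3) `^ (4 / 3 / w) = (u ^+ 2) `^ (2 / w).
  move=> u0; rewrite -!powR_mulrn// -!powRrM; congr (_ `^ _).
  by rewrite !mulrA; congr (_ / _); field.
have pp : p^-1 + p'^-1 = 1 by rewrite /p /p'; field; rewrite !gt_eqF//; lra.
have hs : \sum_(0 <= j < J) (f j ^+ 3) `^ p <=
    K * J%:R * N%:R `^ (2 * (2 / (1 - kappa)) - 2).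
  by apply: le_trans h; apply: ler_sum => j _; rewrite cube ?normc_ge0.
have hs' : \sum_(0 <= j < J) (f' j ^+ 3) `^ p' <=
    K' * J%:R * N'%:R `^ (2 * (2 / (1 - (2 / 3 - kappa))) - 2).
  by apply: le_trans h'; apply: ler_sum => j _; rewrite cube ?normc_ge0.
have := @hoelder_sum R J (fun j => f j ^+ 3) (fun j => f' j ^+ 3) p p' _ _
  (fun j => exprn_ge0 _ (normc_ge0 _)) (fun j => exprn_ge0 _ (normc_ge0 _)) p0 p0' pp _ _ hs hs'.
rewrite !mulr_gt0 ?powR_gt0// => /(_ isT isT).
under eq_bigr do rewrite -exprMn.
move=> /le_trans; apply.
rewrite !powRM ?mulr_ge0 ?powR_ge0 ?(ltW K0) ?(ltW K0') ?(ltW Jr)//.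
rewrite -!powRrM.
have -> : (2 * (2 / (1 - kappa)) - 2) * p^-1 = 3 / 2 + 3 / 2 * kappa.
  by rewrite /p; field; rewrite gt_eqF//; lra.
have -> : (2 * (2 / (1 - (2 / 3 - kappa))) - 2) * p'^-1 = 5 / 2 - 3 / 2 * kappa.
  by rewrite /p'; field; rewrite gt_eqF//; lra.
have JJ : J%:R `^ p^-1 * J%:R `^ p'^-1 = J%:R :> R.
  by rewrite -powRD ?pp ?powRr1// (lt0r_neq0 Jr) implybT.
rewrite -[in leRHS]JJ le_eqVlt; apply/orP; left; apply/eqP; ring.
Qed.

End Counting.

(** * Counting solutions with two frequencies in given cubes *)

Section BoxCount.
Variable R : realType.
Implicit Types (x y z b t kappa beta : R).

Local Notation e := (@expi2pi R).
Local Notation normc := Normc.normc.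

Definition in_zbox (c : Z3) (L : nat) (n : Z3) : bool :=
  [&& (`|(n.1.1 - c.1.1)%R| <= L)%N, (`|(n.1.2 - c.1.2)%R| <= L)%N &
      (`|(n.2 - c.2)%R| <= L)%N].

(** The subtracted offsets are the least values of 2 n + m and of m on the two boxes, so that the
    absolute values change no sign there. *)
Definition coord_index (c c' : int) (L L' : nat) (n m : int) : nat * nat :=
  (`|(2 * n + m - (2 * c - 2 * L%:Z + c' - L'%:Z))%R|%N, `|(m - (c' - L'%:Z))%R|%N).

Lemma coord_index_ge0 (c c' : int) (L L' : nat) (n m : int) :
  (`|(n - c)%R| <= L)%N -> (`|(m - c')%R| <= L')%N ->
  (coord_index c c' L L' n m).1%:Z = 2 * n + m - (2 * c - 2 * L%:Z + c' - L'%:Z) /\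
  (coord_index c c' L L' n m).2%:Z = m - (c' - L'%:Z).
Proof. by rewrite /coord_index/= => h1 h2; split; rewrite gez0_abs//; lia. Qed.

(** The values of 2 n + m range over 4 L + 2 L' + 1 <= 7 L integers, those of m over 2 L' + 1 <= 3
    L'. The indices that occur satisfy a parity condition; dropping it is harmless because Fejer
    kernels are nonnegative. *)
Lemma coord_indexP (c c' a : int) (L L' : nat) (n m : int) (al : R) :
  (`|(n - c)%R| <= L)%N -> (`|(m - c')%R| <= L')%N -> (0 < L')%N -> (L' <= L)%N ->
  coord_index c c' L L' n m \in index_pairs (7 * L) (3 * L') /\
  al * n%:~R ^+ 2 + al * m%:~R ^+ 2 + al * (a - n - m)%:~R ^+ 2 =
  coord_phase al a%:~R (2 * c - 2 * L%:Z + c' - L'%:Z - a)%:~R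
    (c' - L'%:Z)%:~R (coord_index c c' L L' n m).
Proof.
move=> h1 h2 L0 LL; have [e1 e2] := coord_index_ge0 h1 h2; split.
  case: (coord_index _ _ _ _ _ _) e1 e2 => k l /= e1 e2.
  by apply: allpairs_f; rewrite mem_iota add0n; lia.
have e1' : (coord_index c c' L L' n m).1%:R =
    (2 * n + m - (2 * c - 2 * L%:Z + c' - L'%:Z))%:~R :> R by rewrite -e1.
have e2' : (coord_index c c' L L' n m).2%:R = (m - (c' - L'%:Z))%:~R :> R by rewrite -e2.
by rewrite /coord_phase e1' e2' !(intrD, intrB, intrM, mulrNz, mulrzBr); field.
Qed.

Lemma coord_index_inj (c c' : int) (L L' : nat) (n m n' m' : int) :
  (`|(n - c)%R| <= L)%N -> (`|(m - c')%R| <= L')%N ->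
  (`|(n' - c)%R| <= L)%N -> (`|(m' - c')%R| <= L')%N ->
  coord_index c c' L L' n m = coord_index c c' L L' n' m' -> n = n' /\ m = m'.
Proof.
move=> h1 h2 h1' h2' E.
have [e1 e2] := coord_index_ge0 h1 h2; have [e1' e2'] := coord_index_ge0 h1' h2'.
rewrite E in e1 e2; lia.
Qed.

(** Stands for Hoelder's inequality with three equal exponents: the three coordinates obey the same
    cubic bound, so their arithmetic mean costs nothing. *)
Lemma amgm3 x y z : 0 <= x -> 0 <= y -> 0 <= z ->
  x * y * z <= (x ^+ 3 + y ^+ 3 + z ^+ 3) / 3.
Proof.
move=> x0 y0 z0; rewrite -subr_ge0.
have -> : (x ^+ 3 + y ^+ 3 + z ^+ 3) / 3 - x * y * z =
  (x + y + z) * ((x - y) ^+ 2 + (y - z) ^+ 2 + (z - x) ^+ 2) / 6 by field.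
by rewrite divr_ge0// mulr_ge0 ?addr_ge0 ?sqr_ge0.
Qed.

Lemma sum_triples (P : seq (nat * nat)) (F1 F2 F3 : nat * nat -> R) b t :
  \sum_(q <- [seq (q, w) | q <- [seq (u, v) | u <- P, v <- P], w <- P])
     e ((F1 q.1.1 + F2 q.1.2 + F3 q.2 - b) * t) =
  e (- b * t) * ((\sum_(u <- P) e (F1 u * t)) * (\sum_(u <- P) e (F2 u * t)) *
    (\sum_(u <- P) e (F3 u * t))).
Proof.
rewrite big_allpairs_dep/= big_allpairs_dep/= -mulrA mulr_suml mulr_sumr.
apply: eq_bigr => u _; rewrite mulr_suml mulr_sumr mulr_sumr.
apply: eq_bigr => v _; rewrite !mulr_sumr.
apply: eq_bigr => w _; rewrite -!expi2piD; congr expi2pi; ring.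
Qed.

(** The third frequency [a - p.1 - p.2] is free, and the bound is uniform in the centres; this
    allows the pair to be chosen as (n2, n3) or as (n3, n1). *)
Lemma box_count kappa C : 0 < kappa < 2 / 3 -> 1 < C ->
  exists K : R, 0 < K /\ forall alpha : R3 R,
  C^-1 < alpha.1.1 < C -> C^-1 < alpha.1.2 < C -> C^-1 < alpha.2 < C ->
  forall (L L' : nat) (c c' a : Z3) (b : R) (s : seq (Z3 * Z3)),
  (0 < L')%N -> (L' <= L)%N -> uniq s ->
  (forall p, p \in s -> [/\ in_zbox c L p.1, in_zbox c' L' p.2 &
    `|Qform alpha p.1 + Qform alpha p.2 + Qform alpha (a - p.1 - p.2) - b| <= 1 / 8]) ->
  (size s)%:R <=
    K * L%:R `^ (3 / 2 + 3 / 2 * kappa) * L'%:R `^ (5 / 2 - 3 / 2 * kappa).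
Proof.
move=> hk C1; have /andP[k0 k2] := hk.
have C0 : 0 < C by apply: lt_trans C1.
(* B > 2 C places both leading coefficients, al/2 and 3 al/2, between 1/B and B. *)
pose B := (Num.truncn (2 * C)).+1.
have BC : 2 * C < B%:R by rewrite truncnS_gt.
have [K [K0 HK]] := @moment_product R kappa B hk isT.
exists (8 * K * (7 `^ (3 / 2 + 3 / 2 * kappa) * 3 `^ (5 / 2 - 3 / 2 * kappa))); split.
  by rewrite !mulr_gt0 ?powR_gt0.
move=> alpha h1 h2 h3 L L' c c' a b s L0' LL us hs.
have L0 : (0 < L)%N by apply: leq_trans LL.
pose N := (7 * L)%N; pose N' := (3 * L')%N.
have N0 : (0 < N)%N by rewrite muln_gt0.
have N0' : (0 < N')%N by rewrite muln_gt0.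
(* The two scales must share their sample times, so J is large enough for both. *)
pose J := (2 * B * (N + N') ^ 2)%N.
have J0 : (0 < J)%N by rewrite !muln_gt0 ?expn_gt0 addn_gt0 N0.
have Jr : 0 < J%:R :> R by rewrite ltr0n.
have NJ : (2 * B * N ^ 2 <= J)%N by rewrite leq_mul2l leq_exp2r// leq_addr orbT.
have NJ' : (2 * B * N' ^ 2 <= J)%N by rewrite leq_mul2l leq_exp2r// leq_addl orbT.
pose D (c0 c0' a0 : int) : R := (2 * c0 - 2 * L%:Z + c0' - L'%:Z - a0)%:~R.
pose M (c0' : int) : R := (c0' - L'%:Z)%:~R.
pose f1 := coord_phase alpha.1.1 a.1.1%:~R (D c.1.1 c'.1.1 a.1.1) (M c'.1.1).
pose f2 := coord_phase alpha.1.2 a.1.2%:~R (D c.1.2 c'.1.2 a.1.2) (M c'.1.2).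
pose f3 := coord_phase alpha.2 a.2%:~R (D c.2 c'.2 a.2) (M c'.2).
pose P := index_pairs N N'.
pose T := [seq (q, w) | q <- [seq (u, v) | u <- P, v <- P], w <- P].
pose Y (q : (nat * nat) * (nat * nat) * (nat * nat)) := f1 q.1.1 + f2 q.1.2 + f3 q.2 - b.
pose idx (p : Z3 * Z3) := (coord_index c.1.1 c'.1.1 L L' p.1.1.1 p.2.1.1,
  coord_index c.1.2 c'.1.2 L L' p.1.1.2 p.2.1.2, coord_index c.2 c'.2 L L' p.1.2 p.2.2).
have idxP p : p \in s -> idx p \in T /\ 1 <= 4 * fejer J (Y (idx p)).
  move=> /hs[/and3P[n1 n2 n3] /and3P[m1 m2 m3] hQ].
  have [i1 e1] := coord_indexP a.1.1 alpha.1.1 n1 m1 L0' LL.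
  have [i2 e2] := coord_indexP a.1.2 alpha.1.2 n2 m2 L0' LL.
  have [i3 e3] := coord_indexP a.2 alpha.2 n3 m3 L0' LL.
  split; first by apply: allpairs_f => //; apply: allpairs_f.
  apply: fejer_lower => //; apply: le_trans hQ.
  rewrite le_eqVlt; apply/orP; left; apply/eqP; congr `|_|.
  by rewrite /Y /f1 /f2 /f3 /D /M /idx/= -e1 -e2 -e3 /Qform/=; ring.
have idx_inj : {in s &, injective idx}.
  move=> [[[x1 x2] x3] [[y1 y2] y3]] [[[u1 u2] u3] [[v1 v2] v3]].
  move=> /hs[/and3P/=[? ? ?] /and3P/=[? ? ?] _] /hs[/and3P/=[? ? ?] /and3P/=[? ? ?] _].
  rewrite /idx/= => /pair_equal_spec[/pair_equal_spec[E1 E2] E3].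
  have [] := coord_index_inj _ _ _ _ E1 => // -> ->.
  have [] := coord_index_inj _ _ _ _ E2 => // -> ->.
  by have [] := coord_index_inj _ _ _ _ E3 => // -> ->.
apply: (@le_trans _ _ (\sum_(q <- T) 4 * fejer J (Y q))).
  apply: (@le_trans _ _ (\sum_(p <- s) 4 * fejer J (Y (idx p)))).
    have -> : (size s)%:R = \sum_(p <- s) 1 :> R.
      by rewrite big_const_seq count_predT iter_addr_0.
    by rewrite big_seq [leRHS]big_seq; apply: ler_sum => p /idxP[].
  apply: (@ler_sum_injective R _ _ s T idx (fun q => 4 * fejer J (Y q))) => //.
    by move=> p /idxP[].
  by move=> q; rewrite mulr_ge0 ?fejer_ge0.
rewrite -mulr_sumr.
have E0 : 0 <= N%:R `^ (3 / 2 + 3 / 2 * kappa) * N'%:R `^ (5 / 2 - 3 / 2 * kappa) :> R.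
  by rewrite mulr_ge0 ?powR_ge0.
pose X (al a0 D0 M0 : R) (j : nat) := normc (\sum_(p <- P) e (coord_phase al a0 D0 M0 p * (j%:R / J%:R))).
have X0 al a0 D0 M0 j : 0 <= X al a0 D0 M0 j by exact: normc_ge0.
have Xsum al a0 D0 M0 : C^-1 < al < C -> \sum_(0 <= j < J) X al a0 D0 M0 j ^+ 3 <=
    K * J%:R * N%:R `^ (3 / 2 + 3 / 2 * kappa) * N'%:R `^ (5 / 2 - 3 / 2 * kappa).
  move=> /andP[al1 al2].
  have B0 : 0 < B%:R :> R by rewrite ltr0n.
  have BV : B%:R^-1 <= C^-1 / 2.
    rewrite -invfM lef_pV2 ?posrE ?mulr_gt0//; lra.
  have CV : 0 < C^-1 by rewrite invr_gt0.
  apply: le_trans (HK N N' J (al / 2) (3 * al / 2)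
    (fun j => al * (j%:R / J%:R) * D0) (fun j => al * (j%:R / J%:R) * D0 ^+ 2 / 2)
    (fun j => 3 * al * (j%:R / J%:R) * M0 - al * (j%:R / J%:R) * a0)
    (fun j => al / 2 * (j%:R / J%:R) * (3 * M0 ^+ 2 - 2 * a0 * M0 + a0 ^+ 2))
    N0 N0' _ _ NJ NJ').
  - by apply: ler_sum => j _; rewrite /X /P sum_coord_phase Normc.normcM.
  - by apply/andP; split; lra.
  - by apply/andP; split; lra.
apply: (@le_trans _ _ (4 * (2 / J%:R * (K * J%:R * N%:R `^ (3 / 2 + 3 / 2 * kappa) *
    N'%:R `^ (5 / 2 - 3 / 2 * kappa))))).
  rewrite ler_pM2l//; apply: (le_trans (sum_fejer_le _ _ J0)).
  rewrite ler_pM2l ?divr_gt0//.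
  pose X1 := X alpha.1.1 a.1.1%:~R (D c.1.1 c'.1.1 a.1.1) (M c'.1.1).
  pose X2 := X alpha.1.2 a.1.2%:~R (D c.1.2 c'.1.2 a.1.2) (M c'.1.2).
  pose X3 := X alpha.2 a.2%:~R (D c.2 c'.2 a.2) (M c'.2).
  apply: (@le_trans _ _ (\sum_(0 <= j < J) (X1 j ^+ 3 + X2 j ^+ 3 + X3 j ^+ 3) / 3)).
    apply: ler_sum => j _; rewrite /Y /T sum_triples !Normc.normcM normc_expi2pi mul1r.
    by apply: amgm3; exact: normc_ge0.
  rewrite -mulr_suml !big_split/= ler_pdivrMr//.
  have := Xsum alpha.1.1 a.1.1%:~R (D c.1.1 c'.1.1 a.1.1) (M c'.1.1) h1.
  have := Xsum alpha.1.2 a.1.2%:~R (D c.1.2 c'.1.2 a.1.2) (M c'.1.2) h2.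
  have := Xsum alpha.2 a.2%:~R (D c.2 c'.2 a.2) (M c'.2) h3.
  rewrite -/X1 -/X2 -/X3.
  move: (\sum_(0 <= j < J) X1 j ^+ 3) (\sum_(0 <= j < J) X2 j ^+ 3)
    (\sum_(0 <= j < J) X3 j ^+ 3) (K * _ * _ * _) => S1 S2 S3 S4; lra.
have -> (U V : R) : 4 * (2 / J%:R * (K * J%:R * U * V)) = 8 * K * U * V.
  by field; rewrite gt_eqF.
rewrite /N /N' !natrM !powRM// le_eqVlt; apply/orP; left; apply/eqP; ring.
Qed.

End BoxCount.

(** * Slabs *)

Section SlabCount.
Variable R : realType.
Implicit Types (b t kappa eps C : R).

Lemma size_le_fibers (I K : eqType) (s : seq I) (key : I -> K) (ks : seq K) X :
  (forall i, i \in s -> key i \in ks) ->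
  (forall k, (size [seq i <- s | key i == k])%:R <= X :> R) ->
  (size s)%:R <= (size ks)%:R * X.
Proof.
move=> hk hX.
apply: (@le_trans _ _ (\sum_(k <- ks) (size [seq i <- s | key i == k])%:R)).
  rewrite -natr_sum ler_nat -sum1_size.
  apply: (@leq_trans (\sum_(i <- s) \sum_(k <- ks) (key i == k))).
    rewrite big_seq [X in (_ <= X)%N]big_seq; apply: leq_sum => i /hk.
    by move=> ki; rewrite (big_rem _ ki)/= eqxx leq_addr.
  rewrite exchange_big/=; apply: leq_sum => k _.
  by rewrite size_filter -sum1_count [X in (_ <= X)%N]big_mkcond leq_sum// => i _; case: eqP.
apply: le_trans (ler_sum _ (fun k _ => hX k)) _.
by rewrite big_const_seq count_predT iter_addr_0 -[leLHS]mulr_natl.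
Qed.

Definition sqZ3 (n : Z3) : int := n.1.1 ^+ 2 + n.1.2 ^+ 2 + n.2 ^+ 2.

(* The frequencies [(n1, n2, n3)] of a fixed total frequency [a] and a fixed
   modulation [b], up to O(1), at scales [N1 >= N2 >= N3]. *)
Definition resonant (alpha : R3 R) (N1 N2 N3 : nat) (a : Z3) b (p : Z3 * Z3 * Z3) : Prop :=
  [/\ in_zbox 0 (2 * N1) p.1.1, (1 < N1)%N -> (N1%:Z ^+ 2 <= 4 * sqZ3 p.1.1)%R,
      in_zbox 0 (2 * N2) p.1.2, in_zbox 0 (2 * N3) p.2 &
      p.1.1 + p.1.2 + p.2 = a /\
      `|Qform alpha p.1.1 + Qform alpha p.1.2 + Qform alpha p.2 - b| <= 1 / 8].

Lemma Qform_bound (alpha : R3 R) C (N : nat) (n : Z3) :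
  0 <= alpha.1.1 <= C -> 0 <= alpha.1.2 <= C -> 0 <= alpha.2 <= C ->
  in_zbox 0 (2 * N) n -> 0 <= Qform alpha n <= 12 * C * N%:R ^+ 2.
Proof.
move=> /andP[a1 b1] /andP[a2 b2] /andP[a3 b3] /and3P[]; rewrite !subr0 => h1 h2 h3.
have sq (m : int) (al : R) : 0 <= al -> al <= C -> (`|m| <= 2 * N)%N ->
    0 <= al * m%:~R ^+ 2 <= 4 * C * N%:R ^+ 2.
  move=> al0 alC hm; rewrite mulr_ge0 ?sqr_ge0//=.
  have m2 : m%:~R ^+ 2 <= (2 * N%:R) ^+ 2 :> R.
    rewrite -real_normK ?num_real// ler_pXn2r ?nnegrE ?mulr_ge0//.
    by rewrite -intr_norm -(natrM _ 2) pmulrn ler_int; lia.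
  apply: (@le_trans _ _ (C * (2 * N%:R) ^+ 2)); last by rewrite exprMn; lra.
  by rewrite ler_pM ?sqr_ge0.
have /andP[? ?] := sq _ _ a1 b1 h1; have /andP[? ?] := sq _ _ a2 b2 h2.
have /andP[? ?] := sq _ _ a3 b3 h3.
by rewrite /Qform; apply/andP; split; lra.
Qed.

Lemma absz_add_le (w w' : int) (N : nat) :
  (`|w| <= 2 * N)%N -> (`|w'| <= 2 * N)%N -> (`|(w + w')%R| <= 4 * N)%N.
Proof. lia. Qed.

Lemma absz_add_ge (x x' x0 : int) (N1 N2 : nat) :
  (64 * N2 <= N1)%N -> (N1 <= 4 * `|x0|)%N -> (`|(x - x0)%R| <= 8 * N2)%N ->
  (`|(x' - x0)%R| <= 8 * N2)%N -> (N1 <= `|(x + x')%R| * 4)%N.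
Proof. lia. Qed.

(* [x], [y], [z] are the coordinates in an order such that the large
   coordinate of [n1] comes first: once [y] and [z] are known up to [M], the
   modulation constraint determines [x] up to [O(M)]. *)
Lemma cell_diameter (A B D C : R) (N1 N2 M : nat) (x y z x' y' z' x0 : int) :
  1 < C -> C^-1 < A -> A < C -> 0 < B -> B < C -> 0 < D -> D < C ->
  (0 < N2)%N -> (64 * N2 <= N1)%N -> (N2 ^ 2 <= M * N1)%N ->
  (N1 <= 4 * `|x0|)%N -> (`|(x - x0)%R| <= 8 * N2)%N -> (`|(x' - x0)%R| <= 8 * N2)%N ->
  (`|(y - y')%R| <= M)%N -> (`|(z - z')%R| <= M)%N ->
  (`|y| <= 2 * N1)%N -> (`|y'| <= 2 * N1)%N -> (`|z| <= 2 * N1)%N -> (`|z'| <= 2 * N1)%N ->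
  `|(A * x%:~R ^+ 2 + B * y%:~R ^+ 2 + D * z%:~R ^+ 2) -
    (A * x'%:~R ^+ 2 + B * y'%:~R ^+ 2 + D * z'%:~R ^+ 2)| <= 25 * C * N2%:R ^+ 2 ->
  `|(x - x')%:~R| <= 132 * C ^+ 2 * M%:R :> R.
Proof.
move=> C1 A1 A2 B1 B2 D1 D2 N20 N12 NM hx0 hx hx' hy hz y1 y2 z1 z2 hQ.
have C0 : 0 < C by lra.
have A0 : 0 < A by apply: lt_trans A1; rewrite invr_gt0.
have N1r : 0 < N1%:R :> R by rewrite ltr0n (leq_trans _ N12)// muln_gt0.
have NMr : N2%:R ^+ 2 <= M%:R * N1%:R :> R by rewrite -natrX -natrM ler_nat.
have sqd (E : R) (w w' : int) : 0 < E -> E < C -> (`|(w - w')%R| <= M)%N ->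
    (`|w| <= 2 * N1)%N -> (`|w'| <= 2 * N1)%N ->
    `|E * w%:~R ^+ 2 - E * w'%:~R ^+ 2| <= C * (M%:R * (4 * N1%:R)).
  move=> E0 EC h1 h2 h3.
  have -> : E * w%:~R ^+ 2 - E * w'%:~R ^+ 2 = E * ((w - w')%:~R * (w + w')%:~R).
    by rewrite intrB intrD; ring.
  rewrite normrM (ger0_norm (ltW E0)) ler_pM ?normr_ge0 ?(ltW E0) ?(ltW EC)//.
  rewrite normrM ler_pM ?normr_ge0// -intr_norm -?(natrM _ 4) pmulrn ler_int lez_nat//.
  exact: absz_add_le.
have hB := sqd B y y' B1 B2 hy y1 y2; have hD := sqd D z z' D1 D2 hz z1 z2.
(* 33 = 25 + 4 + 4, after N2^2 is replaced by M N1. *)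
have hA : `|A * x%:~R ^+ 2 - A * x'%:~R ^+ 2| <= 33 * C * (M%:R * N1%:R).
  have : C * N2%:R ^+ 2 <= C * (M%:R * N1%:R) by rewrite ler_pM2l.
  move: hQ hB hD; rewrite !ler_norml => /andP[? ?] /andP[? ?] /andP[? ?] ?.
  by apply/andP; split; lra.
(* Both x and x' lie within 8 N2 <= N1/8 of x0, and |x0| >= N1/4, so x + x' cannot cancel. This is
   the origin of the threshold 64. *)
have hs : N1%:R / 4 <= `|(x + x')%:~R| :> R.
  rewrite ler_pdivrMr// -intr_norm -(intrM _ _ 4) pmulrn ler_int.
  by have := absz_add_ge N12 hx0 hx hx'; rewrite -lez_nat.
move: hA; have -> : A * x%:~R ^+ 2 - A * x'%:~R ^+ 2 = A * ((x - x')%:~R * (x + x')%:~R).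
  by rewrite intrB intrD; ring.
rewrite !normrM (ger0_norm (ltW A0)).
move: (`|(x - x')%:~R|) (normr_ge0 ((x - x')%:~R : R)) => v v0 hA.
have h1 : C^-1 * (v * (N1%:R / 4)) <= 33 * C * (M%:R * N1%:R).
  apply: le_trans hA; rewrite ler_pM ?invr_ge0 ?(ltW A1) ?(ltW C0)//.
    by rewrite mulr_ge0 ?divr_ge0.
  by rewrite ler_wpM2l.
have := ler_wpM2l (ltW C0) h1; rewrite mulVKf ?gt_eqF// [leLHS]mulrA ler_pdivrMr// => h2.
rewrite -(ler_pM2r N1r); apply: (le_trans h2).
by rewrite le_eqVlt; apply/orP; left; apply/eqP; ring.
Qed.

End SlabCount.

(** * Covering the slab by cubes *)

Section SlabCounting.
Variable R : realType.
Implicit Types (b t kappa eps C : R).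

Lemma absz_sub_third (u v w u' v' w' : int) (N2 N3 : nat) : (N3 <= N2)%N ->
  (`|v| <= 2 * N2)%N -> (`|w| <= 2 * N3)%N -> (`|v'| <= 2 * N2)%N -> (`|w'| <= 2 * N3)%N ->
  u + v + w = u' + v' + w' -> (`|(u - u')%R| <= 8 * N2)%N.
Proof. lia. Qed.

(** The shift by N makes the entries of [-N, N] nonnegative before they are cut into intervals of M
    integers. *)
Definition cell_of (M N : nat) (w : int) : nat := (`|(w + N%:Z)%R| %/ M)%N.

Lemma cell_of_lt (M N : nat) (w : int) : (`|w| <= N)%N -> (cell_of M N w <= 2 * N %/ M)%N.
Proof. by move=> h; apply: leq_div2r; lia. Qed.

Lemma same_cell (M N : nat) (w w' : int) : (0 < M)%N -> (`|w| <= N)%N -> (`|w'| <= N)%N ->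
  cell_of M N w = cell_of M N w' -> (`|(w - w')%R| <= M)%N.
Proof.
rewrite /cell_of => M0 h h' hc.
have := divn_eq `|(w + N%:Z)%R| M; rewrite hc.
have := divn_eq `|(w' + N%:Z)%R| M.
have := ltn_pmod `|(w + N%:Z)%R| M0; have := ltn_pmod `|(w' + N%:Z)%R| M0.
move: (_ %/ M * M)%N (_ %% M)%N (_ %% M)%N => T r1 r2; clear hc; lia.
Qed.

(** [x], [y], [z] are a permutation of the coordinates, given abstractly because any of them can be
    the large one. All n1 stay within 8 N2 of that of [p0], coordinatewise; cutting y and z into
    intervals of length M leaves about (N2/M)^2 cells, and in each of them [box_count] applies to
    the pair (n3, n1), at scales N3 >= M. *)
Lemma slab_count_coord eps C : 0 < eps <= 1 / 8 -> 1 < C ->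
  exists K : R, 0 < K /\ forall (alpha : R3 R) (x y z : Z3 -> int) (A B D : R),
  C^-1 < alpha.1.1 < C -> C^-1 < alpha.1.2 < C -> C^-1 < alpha.2 < C ->
  C^-1 < A < C -> C^-1 < B < C -> C^-1 < D < C ->
  (forall n, Qform alpha n = A * (x n)%:~R ^+ 2 + B * (y n)%:~R ^+ 2 + D * (z n)%:~R ^+ 2) ->
  (forall c L n, in_zbox c L n =
    [&& (`|(x n - x c)%R| <= L)%N, (`|(y n - y c)%R| <= L)%N & (`|(z n - z c)%R| <= L)%N]) ->
  (forall n m, x (n + m) = x n + x m) -> (forall n m, y (n + m) = y n + y m) ->
  (forall n m, z (n + m) = z n + z m) ->
  forall (N1 N2 N3 M : nat) (a : Z3) b (s : seq (Z3 * Z3 * Z3)) (p0 : Z3 * Z3 * Z3),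
  (0 < N3)%N -> (N3 <= N2)%N -> (64 * N2 <= N1)%N -> (0 < M)%N -> (N2 ^ 2 <= M * N1)%N ->
  (M <= N3)%N -> uniq s -> (forall p, p \in s -> resonant alpha N1 N2 N3 a b p) ->
  p0 \in s -> (N1 <= 4 * `|x p0.1.1|)%N ->
  (size s)%:R <= K * (N2%:R ^+ 2 * N3%:R `^ (3 / 2 + eps) * M%:R `^ (1 / 2 - eps)).
Proof.
move=> /andP[eps0 eps8] C1.
have C0 : 0 < C by lra.
(* With kappa = 2 eps/3 the term 3 kappa/2 in the exponents becomes eps. *)
have hk : 0 < 2 / 3 * eps < 2 / 3 by apply/andP; split; lra.
have [K [K0 HK]] := box_count hk C1.
have k32 : 3 / 2 * (2 / 3 * eps) = eps by field.
rewrite k32 in HK.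
(* An integer above the constant of [cell_diameter]: within one cell, n1 lies in a cube of radius E
   M. *)
pose E := (Num.truncn (132 * C ^+ 2)).+1.
have EC : 132 * C ^+ 2 < E%:R by rewrite truncnS_gt.
have E0 : 0 < E%:R :> R by rewrite ltr0n.
exists (289 * (K * ((2 * E)%:R `^ (3 / 2 + eps) * E%:R `^ (5 / 2 - eps)))); split.
  by rewrite !mulr_gt0 ?powR_gt0 ?ltr0n// muln_gt0.
move=> alpha x y z A B D hal1 hal2 hal3 /andP[A1 A2] /andP[B1 B2] /andP[D1 D2] HQ Hbox xD yD zD
  N1 N2 N3 M a b s p0 N30 N32 N12 M0 NM M3 us hs p0s hx0.
have N20 : (0 < N2)%N by apply: leq_trans N32.
have CV0 : 0 < C^-1 by rewrite invr_gt0.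
have w0 (w : Z3 -> int) : (forall n m, w (n + m) = w n + w m) -> w 0 = 0.
  by move=> wD; apply: (addrI (w 0)); rewrite -wD !addr0.
have [x0 y0 z0] := And3 (w0 x xD) (w0 y yD) (w0 z zD).
have near (w : Z3 -> int) : (forall n m, w (n + m) = w n + w m) ->
    (forall n (L : nat), in_zbox 0 L n -> (`|w n| <= L)%N) ->
    forall p q, p \in s -> q \in s -> (`|(w p.1.1 - w q.1.1)%R| <= 8 * N2)%N.
  move=> wD wB p q /hs[_ _ /wB p2 /wB p3 [pa _]] /hs[_ _ /wB q2 /wB q3 [qa _]].
  apply: (absz_sub_third N32 p2 p3 q2 q3).
  by rewrite -!wD pa qa.
have xB n (L : nat) : in_zbox 0 L n -> (`|x n| <= L)%N.
  by rewrite Hbox x0 y0 z0 !subr0 => /and3P[].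
have yB n (L : nat) : in_zbox 0 L n -> (`|y n| <= L)%N.
  by rewrite Hbox x0 y0 z0 !subr0 => /and3P[].
have zB n (L : nat) : in_zbox 0 L n -> (`|z n| <= L)%N.
  by rewrite Hbox x0 y0 z0 !subr0 => /and3P[].
have xn := near x xD xB; have yn := near y yD yB; have zn := near z zD zB.
pose cell (w : Z3 -> int) (p : Z3 * Z3 * Z3) := cell_of M (8 * N2) (w p.1.1 - w p0.1.1).
pose key p := (cell y p, cell z p).
pose W := (2 * (8 * N2) %/ M).+1.
pose ks := [seq (i, j) | i <- iota 0 W, j <- iota 0 W].
have keyP p : p \in s -> key p \in ks.
  move=> ps; have := yn p p0 ps p0s; have := zn p p0 ps p0s => hz hy.
  by apply: allpairs_f; rewrite mem_iota add0n /W ltnS cell_of_lt.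
have cellP (w : Z3 -> int) p q :
    (`|(w p.1.1 - w p0.1.1)%R| <= 8 * N2)%N -> (`|(w q.1.1 - w p0.1.1)%R| <= 8 * N2)%N ->
    cell w p = cell w q -> (`|(w p.1.1 - w q.1.1)%R| <= M)%N.
  move=> h1 h2 /(same_cell M0 h1 h2).
  by rewrite opprB addrA subrK.
pose X := K * (2 * E * N3)%:R `^ (3 / 2 + eps) * (E * M)%:R `^ (5 / 2 - eps).
have X0 : 0 <= X by rewrite !mulr_ge0 ?powR_ge0// ltW.
(* 25 = 12 + 12 + 1: the forms at n2 and n3 vary by at most 12 C N2^2 each, and the two tolerances
   1/8 fit into C N2^2 >= 1. *)
have Qle p q : p \in s -> q \in s ->
    `|Qform alpha p.1.1 - Qform alpha q.1.1| <= 25 * C * N2%:R ^+ 2.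
  have bnd (u : R) : C^-1 < u < C -> 0 <= u <= C.
    by move=> /andP[? ?]; apply/andP; split; lra.
  have Qb := @Qform_bound R alpha C _ _ (bnd _ hal1) (bnd _ hal2) (bnd _ hal3).
  move=> /hs[_ _ /Qb/andP[? ?] /Qb/andP[p3 p3'] [_]].
  rewrite ler_norml => /andP[? ?] /hs[_ _ /Qb/andP[? ?] /Qb/andP[q3 q3'] [_]].
  rewrite ler_norml => /andP[? ?].
  have h : C * N3%:R ^+ 2 <= C * N2%:R ^+ 2 by rewrite ler_pM2l// ler_pXn2r ?nnegrE// ler_nat.
  have h1 : 1 <= C * N2%:R ^+ 2.
    by rewrite -[leLHS]mulr1 ler_pM ?(ltW C1)// -natrX ler1n expn_gt0 N20.
  by rewrite ler_norml; apply/andP; split; lra.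
apply: (@le_trans _ _ ((size ks)%:R * X)).
  apply: (size_le_fibers keyP) => k; set sk := [seq i <- s | key i == k].
  case skE : sk => [|q sk']; first exact: X0.
  have qsk : q \in sk by rewrite skE inE eqxx.
  rewrite -skE; move: qsk; rewrite mem_filter => /andP[/eqP qk qs].
  have -> : size sk = size [seq (p.2, p.1.1) | p <- sk] by rewrite size_map.
  rewrite -[leRHS]/(K * _ * _).
  apply: (HK alpha hal1 hal2 hal3 _ _ 0 q.1.1 a b).
  - by rewrite muln_gt0 M0.
  - by rewrite [(2 * E)%N]mulnC -mulnA leq_mul2l (leq_trans M3) ?orbT// leq_pmull.
  - rewrite map_inj_in_uniq ?filter_uniq//.
    move=> p p'; rewrite !mem_filter => /andP[_ /hs[_ _ _ _ [pa _]]] /andP[_ /hs[_ _ _ _ [pa' _]]].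
    move=> [e1 e2]; case: p pa e1 e2 => [[u v] w] /= pa e1 e2.
    case: p' pa' e1 e2 => [[u' v'] w'] /= pa' e1 e2; congr (_, _, _) => //.
    apply: (addrI u); apply: (addIr w); rewrite pa e1 e2 pa'; reflexivity.
  - move=> _ /mapP[p + ->]; rewrite mem_filter => /andP[/eqP pk ps] /=.
    have [p1 _ p2 p3 [pa pQ]] := hs _ ps; have [q1 _ _ _ _] := hs _ qs.
    have [ky kz] : cell y p = cell y q /\ cell z p = cell z q.
      by move: pk; rewrite -qk /key => -[-> ->].
    have py := cellP y p q (yn _ _ ps p0s) (yn _ _ qs p0s) ky.
    have pz := cellP z p q (zn _ _ ps p0s) (zn _ _ qs p0s) kz.
    have := @cell_diameter R A B D C N1 N2 M (x p.1.1) (y p.1.1) (z p.1.1)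
      (x q.1.1) (y q.1.1) (z q.1.1) (x p0.1.1) C1 A1 A2 (lt_trans CV0 B1) B2
      (lt_trans CV0 D1) D2 N20 N12 NM hx0 (xn _ _ ps p0s) (xn _ _ qs p0s) py pz
      (yB _ _ p1) (yB _ _ q1) (zB _ _ p1) (zB _ _ q1).
    rewrite -!HQ => /(_ (Qle _ _ ps qs)) hx.
    have M1 : (M <= E * M)%N by rewrite leq_pmull.
    split.
    + move: p3; rewrite !Hbox => /and3P[h1 h2 h3].
      have le3 : (2 * N3 <= 2 * E * N3)%N by rewrite leq_mul// leq_pmulr.
      by apply/and3P; split; [exact: leq_trans h1 le3|exact: leq_trans h2 le3|exact: leq_trans h3 le3].
    + rewrite Hbox (leq_trans py M1) (leq_trans pz M1) !andbT.
      have : (`|(x p.1.1 - x q.1.1)%R|%N)%:R <= (E * M)%:R :> R.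
        rewrite pmulrn intr_norm natrM; apply: le_trans hx _.
        by rewrite ler_wpM2r// ltW.
      by rewrite ler_nat.
    + have -> : a - p.2 - p.1.1 = p.1.2 by rewrite -pa; ring.
      move: pQ; rewrite [Qform alpha p.2 + _ + _](_ : _ =
        Qform alpha p.1.1 + Qform alpha p.1.2 + Qform alpha p.2)//; ring.
have Mr : 0 < M%:R :> R by rewrite ltr0n.
(* 17 = 16 + 1, the one coming from rounding and M <= N2. *)
have Wle : W%:R <= 17 * N2%:R / M%:R :> R.
  rewrite ler_pdivlMr// -!natrM ler_nat /W mulSn [(17 * _)%N]mulSn mulnA.
  by rewrite leq_add ?leq_divM// (leq_trans M3).
rewrite size_allpairs !size_iota natrM.
apply: (@le_trans _ _ ((17 * N2%:R / M%:R) * (17 * N2%:R / M%:R) * X)).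
  by rewrite ler_wpM2r// ler_pM.
rewrite /X !natrM !powRM ?mulr_ge0 ?(ltW E0)//.
have -> : M%:R `^ (5 / 2 - eps) = M%:R `^ (1 / 2 - eps) * M%:R ^+ 2 :> R.
  rewrite -(powR_mulrn 2 (ltW Mr)) -powRD ?(lt0r_neq0 Mr) ?implybT//.
  by congr (_ `^ _); field.
rewrite le_eqVlt; apply/orP; left; apply/eqP; field.
by rewrite gt_eqF.
Qed.

End SlabCounting.

(** * Interpolating the two counts *)

Section ResonanceCount.
Variable R : realType.
Implicit Types (b t kappa eps C : R).

(** If all coordinates were below N/4 in modulus, 16 |n|^2 would be less than 3 N^2. *)
Lemma large_coordinate (N : nat) (n : Z3) : (0 < N)%N -> N%:Z ^+ 2 <= 4 * sqZ3 n ->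
  [\/ (N <= 4 * `|n.1.1|)%N, (N <= 4 * `|n.1.2|)%N | (N <= 4 * `|n.2|)%N].
Proof.
move=> N0 hN.
case: (leqP N (4 * `|n.1.1|)) => h1; first by apply: Or31.
case: (leqP N (4 * `|n.1.2|)) => h2; first by apply: Or32.
case: (leqP N (4 * `|n.2|)) => h3; first by apply: Or33.
have sq (m : int) : (4 * `|m| < N)%N -> 16 * m ^+ 2 < N%:Z ^+ 2.
  move=> h; have -> : 16 * m ^+ 2 = (4 * `|m|)%N%:Z ^+ 2.
    by rewrite PoszM exprMn abszE real_normK ?num_real.
  by rewrite ltr_pXn2r ?nnegrE// ltz_nat.
have := sq _ h1; have := sq _ h2; have := sq _ h3.
have : 0 <= N%:Z ^+ 2 by exact: sqr_ge0.
move: hN; rewrite /sqZ3; move: (n.1.1 ^+ 2) (n.1.2 ^+ 2) (n.2 ^+ 2) (N%:Z ^+ 2) => a b c d; lia.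
Qed.

Lemma slab_count eps C : 0 < eps <= 1 / 8 -> 1 < C ->
  exists K : R, 0 < K /\ forall alpha : R3 R,
  C^-1 < alpha.1.1 < C -> C^-1 < alpha.1.2 < C -> C^-1 < alpha.2 < C ->
  forall (N1 N2 N3 M : nat) (a : Z3) b (s : seq (Z3 * Z3 * Z3)),
  (0 < N3)%N -> (N3 <= N2)%N -> (64 * N2 <= N1)%N -> (0 < M)%N -> (N2 ^ 2 <= M * N1)%N ->
  (M <= N3)%N -> uniq s -> (forall p, p \in s -> resonant alpha N1 N2 N3 a b p) ->
  (size s)%:R <= K * (N2%:R ^+ 2 * N3%:R `^ (3 / 2 + eps) * M%:R `^ (1 / 2 - eps)).
Proof.
move=> he C1; have [K [K0 HK]] := slab_count_coord he C1.
exists K; split => // alpha h1 h2 h3 N1 N2 N3 M a b s N30 N32 N12 M0 NM M3 us hs.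
case sE : s => [|p0 s']; first by rewrite mulr_ge0 ?(ltW K0) ?mulr_ge0 ?powR_ge0 ?exprn_ge0.
rewrite -sE; have p0s : p0 \in s by rewrite sE inE eqxx.
have N1gt : (1 < N1)%N.
  by apply: leq_trans N12; rewrite -[2%N]muln1 leq_mul// (leq_trans N30).
have [_ /(_ N1gt) big _ _ _] := hs _ p0s.
have [hx|hy|hz] := large_coordinate (ltnW N1gt) big.
- apply: (HK alpha (fun n => n.1.1) (fun n => n.1.2) (fun n => n.2) _ _ _ h1 h2 h3 h1 h2 h3 _ _ _ _ _
    N1 N2 N3 M a b s p0) => //.
- apply: (HK alpha (fun n => n.1.2) (fun n => n.1.1) (fun n => n.2) _ _ _ h1 h2 h3 h2 h1 h3 _ _ _ _ _
    N1 N2 N3 M a b s p0) => //.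
    by move=> n; rewrite /Qform; ring.
  by move=> c L n; rewrite /in_zbox andbCA.
- apply: (HK alpha (fun n => n.2) (fun n => n.1.2) (fun n => n.1.1) _ _ _ h1 h2 h3 h3 h2 h1 _ _ _ _ _
    N1 N2 N3 M a b s p0) => //.
    by move=> n; rewrite /Qform; ring.
  by move=> c L n; apply/idP/idP => /and3P[h h' h'']; apply/and3P.
Qed.

Lemma powR_le_root (x g eps : R) (k : nat) :
  0 < x -> x ^+ k.+1 <= g -> 0 < eps -> x `^ eps <= g `^ (eps / k.+1%:R).
Proof.
move=> x0 xg e0; have epsE : eps = k.+1%:R * (eps / k.+1%:R) by rewrite mulrC divfK// pnatr_eq0.
rewrite [leLHS](_ : _ = x `^ (k.+1%:R * (eps / k.+1%:R))); last by rewrite -epsE.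
rewrite powRrM powR_mulrn ?(ltW x0)// ge0_ler_powR ?nnegrE ?divr_ge0 ?(ltW e0)//.
  by rewrite exprn_ge0 ?ltW.
by apply: le_trans xg; rewrite exprn_ge0 ?ltW.
Qed.

(* Interpolation of the two bounds [A x^eps] and [A y^(1/4) / x] when
   [x y <= g]: the balance point is [y = x^8]. *)
Lemma interpolate_gain (x y g eps S A : R) : 0 < eps <= 1 / 8 ->
  0 < x <= 1 -> 0 < y <= 1 -> x * y <= g -> 0 <= A ->
  S <= A * x `^ eps -> (y <= x -> S <= A * (y `^ 4^-1 / x)) ->
  S <= A * g `^ (eps / 9).
Proof.
move=> /andP[e0 e8] /andP[x0 x1] /andP[y0 y1] xyg A0 h1 h2.
have e9 : 0 < eps / 9 by rewrite divr_gt0.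
have [xy|yx] := leP (x ^+ 8) y.
  apply: (le_trans h1); rewrite ler_wpM2l// powR_le_root//.
  by apply: le_trans xyg; rewrite exprS ler_pM2l.
have yxle : y <= x.
  apply: (le_trans (ltW yx)); rewrite exprS ler_piMr ?(ltW x0)//.
  by rewrite exprn_ile1 ?(ltW x0).
apply: (le_trans (h2 yxle)); rewrite ler_wpM2l//.
pose z := y `^ 8^-1.
have z0 : 0 < z by rewrite powR_gt0.
have z8 : z ^+ 8 = y.
  by rewrite -powR_mulrn ?(ltW z0)// -powRrM mulVf ?powRr1 ?(ltW y0)// pnatr_eq0.
have z4 : y `^ 4^-1 = z ^+ 2.
  by rewrite -powR_mulrn ?(ltW z0)// -powRrM; congr (_ `^ _); field.
have zx : z <= x.
  by rewrite -(@ler_pXn2r _ 8)// ?nnegrE ?(ltW z0) ?(ltW x0)// z8 ltW.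
have z1 : z <= 1 by apply: le_trans x1.
rewrite z4; apply: (@le_trans _ _ (z `^ eps)).
  apply: (@le_trans _ _ z).
    by rewrite ler_pdivrMr// expr2 ler_pM2l.
  rewrite -[leLHS]powRr1 ?(ltW z0)//.
  by apply: ger_powR; [rewrite z0|lra].
apply: powR_le_root => //; apply: le_trans xyg.
by rewrite exprS z8 ler_pM2r.
Qed.

(** The slab bound in units of n = N2, with x = N3/N2 and y = M/N2: it is the target times
    y^(1/4)/x, times powers of x and y with nonnegative exponents when eps <= 1/8. *)
Lemma slab_power_identity (n x y eps : R) : 0 < n -> 0 < x -> 0 < y ->
  n ^+ 2 * (x * n) `^ (3 / 2 + eps) * (y * n) `^ (1 / 2 - eps) =
  n `^ (3 / 2 + 2 * eps) * (x * n) `^ (5 / 2 - 2 * eps) * (y `^ 4^-1 / x) *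
    (x `^ (3 * eps) * y `^ (1 / 4 - eps)).
Proof.
move=> n0 x0 y0; rewrite !powRM ?(ltW x0) ?(ltW y0) ?(ltW n0)//.
have -> : n ^+ 2 * (x `^ (3 / 2 + eps) * n `^ (3 / 2 + eps)) *
    (y `^ (1 / 2 - eps) * n `^ (1 / 2 - eps)) = x `^ (3 / 2 + eps) * y `^ (1 / 2 - eps) *
    (n `^ 2 * n `^ (3 / 2 + eps) * n `^ (1 / 2 - eps)).
  by rewrite powR_mulrn ?(ltW n0)//; ring.
have -> : n `^ (3 / 2 + 2 * eps) * (x `^ (5 / 2 - 2 * eps) * n `^ (5 / 2 - 2 * eps)) *
    (y `^ 4^-1 / x) * (x `^ (3 * eps) * y `^ (1 / 4 - eps)) =
    (x `^ (5 / 2 - 2 * eps) * x^-1 * x `^ (3 * eps)) * (y `^ 4^-1 * y `^ (1 / 4 - eps)) *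
    (n `^ (3 / 2 + 2 * eps) * n `^ (5 / 2 - 2 * eps)) by ring.
have nz (w : R) : 0 < w -> forall c, (c == 0) ==> (w != 0).
  by move=> w0 c; rewrite lt0r_neq0 ?implybT.
rewrite -(powR_inv1 (ltW x0)) -!powRD ?nz//.
by congr (_ `^ _ * _ `^ _ * _ `^ _); field.
Qed.

Lemma resonance_count eps C : 0 < eps <= 1 / 8 -> 1 < C ->
  exists K : R, 0 < K /\ forall alpha : R3 R,
  C^-1 < alpha.1.1 < C -> C^-1 < alpha.1.2 < C -> C^-1 < alpha.2 < C ->
  forall (N1 N2 N3 : nat) (a : Z3) b (s : seq (Z3 * Z3 * Z3)),
  (0 < N3)%N -> (N3 <= N2)%N -> (N2 <= N1)%N ->
  uniq s -> (forall p, p \in s -> resonant alpha N1 N2 N3 a b p) ->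
  (size s)%:R <= K * (N3%:R / N1%:R + N2%:R^-1) `^ (eps / 9) *
    (N2%:R `^ (3 / 2 + 2 * eps) * N3%:R `^ (5 / 2 - 2 * eps)).
Proof.
move=> he C1; have /andP[e0 e8] := he.
have hk : 0 < 2 / 3 * eps < 2 / 3 by apply/andP; split; lra.
have [KA [KA0 HA]] := box_count hk C1.
have k32 : 3 / 2 * (2 / 3 * eps) = eps by field.
rewrite k32 in HA.
have [KB [KB0 HB]] := slab_count he C1.
pose KA' := KA * (2 `^ (3 / 2 + eps) * 2 `^ (5 / 2 - eps)).
have KA'0 : 0 < KA' by rewrite !mulr_gt0 ?powR_gt0.
exists ((KA' + KB) * 64); split; first by rewrite mulr_gt0 ?addr_gt0.
move=> alpha hal1 hal2 hal3 N1 N2 N3 a b s N30 N32 N21 us hs.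
have N20 : (0 < N2)%N by apply: leq_trans N32.
have N10 : (0 < N1)%N by apply: leq_trans N21.
have r1 : 0 < N1%:R :> R by rewrite ltr0n.
have r2 : 0 < N2%:R :> R by rewrite ltr0n.
have r3 : 0 < N3%:R :> R by rewrite ltr0n.
set T := N2%:R `^ (3 / 2 + 2 * eps) * _.
have T0 : 0 <= T by rewrite mulr_ge0 ?powR_ge0.
set g := N3%:R / N1%:R + N2%:R^-1.
have g0 : 0 < g by rewrite addr_gt0 ?divr_gt0 ?invr_gt0.
pose x : R := N3%:R / N2%:R.
have x0 : 0 < x by rewrite divr_gt0.
have x1 : x <= 1 by rewrite ler_pdivrMr// mul1r ler_nat.
have e9 : 0 < eps / 9 by rewrite divr_gt0.
(* The count is run with eps while the target allows 2 eps; the difference of exponents leaves the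
   factor (N3/N2)^eps. *)
have TA : (size s)%:R <= KA' * T * x `^ eps.
  have -> : KA' * T * x `^ eps =
      KA * (2 * N2)%:R `^ (3 / 2 + eps) * (2 * N3)%:R `^ (5 / 2 - eps).
    rewrite /KA' /T /x !natrM !powRM ?invr_ge0 ?(ltW r2) ?(ltW r3)//.
    have -> : N2%:R `^ (3 / 2 + 2 * eps) = N2%:R `^ (3 / 2 + eps) * N2%:R `^ eps :> R.
      by rewrite -powRD ?(lt0r_neq0 r2) ?implybT//; congr (_ `^ _); ring.
    have -> : N3%:R `^ (5 / 2 - eps) = N3%:R `^ (5 / 2 - 2 * eps) * N3%:R `^ eps :> R.
      by rewrite -powRD ?(lt0r_neq0 r3) ?implybT//; congr (_ `^ _); ring.
    have : N2%:R `^ eps * N2%:R^-1 `^ eps = 1 :> R.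
      by rewrite -powRM ?invr_ge0 ?(ltW r2)// mulfV ?gt_eqF// powR1.
    move: (N2%:R `^ eps) (N2%:R^-1 `^ eps) (N3%:R `^ eps) => u v w uv.
    transitivity (KA * (2 `^ (3 / 2 + eps) * 2 `^ (5 / 2 - eps)) *
       (N2%:R `^ (3 / 2 + eps) * (u * v) * (N3%:R `^ (5 / 2 - 2 * eps) * w))); first by ring.
    by rewrite uv; ring.
  have -> : size s = size [seq (p.1.2, p.2) | p <- s] by rewrite size_map.
  apply: (HA alpha hal1 hal2 hal3 _ _ 0 0 a b).
  - by rewrite muln_gt0.
  - by rewrite leq_mul2l.
  - rewrite map_inj_in_uniq// => p p' /hs[_ _ _ _ [pa _]] /hs[_ _ _ _ [pa' _]].
    move=> [e1 e2]; case: p pa e1 e2 => [[u v] w] /= pa e1 e2.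
    case: p' pa' e1 e2 => [[u' v'] w'] /= pa' e1 e2; congr (_, _, _) => //.
    by apply: (addIr v); apply: (addIr w); rewrite pa e1 e2 pa'.
  - move=> _ /mapP[p /hs[_ _ p2 p3 [pa pQ]] ->] /=; split => //.
    have -> : a - p.1.2 - p.2 = p.1.1 by rewrite -pa; ring.
    move: pQ; rewrite [Qform alpha p.1.2 + _ + _](_ : _ =
      Qform alpha p.1.1 + Qform alpha p.1.2 + Qform alpha p.2)//; ring.
(* When N1 < 64 N2, the quantity g is at least (N3/N2)/64, so the factor in [TA] is already the
   gain. *)
have [N12|N12] := leqP (64 * N2) N1; last first.
  apply: (le_trans TA).
  apply: (@le_trans _ _ ((KA' + KB) * T * (64 * g `^ (eps / 9)))); last first.
    by rewrite le_eqVlt; apply/orP; left; apply/eqP; ring.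
  apply: ler_pM; [by rewrite mulr_ge0 ?(ltW KA'0)|exact: powR_ge0| |].
    by rewrite ler_wpM2r// lerDl ltW.
  apply: (@le_trans _ _ (x `^ (eps / 9))).
    by apply: ger_powR; [rewrite x0|lra].
  apply: (@le_trans _ _ ((64 * g) `^ (eps / 9))).
    rewrite ge0_ler_powR ?nnegrE ?(ltW e9) ?mulr_ge0 ?(ltW x0) ?(ltW g0)//.
    apply: (@le_trans _ _ (64 * (N3%:R / N1%:R))).
      rewrite /x ler_pdivrMr// [leRHS](_ : _ = N3%:R * (64 * N2%:R / N1%:R)); last by ring.
      rewrite ler_peMr ?(ltW r3)//.
      by rewrite ler_pdivlMr// mul1r -natrM ler_nat ltnW.
    by rewrite ler_pM2l// lerDl invr_ge0.
  rewrite powRM ?(ltW g0)// ler_wpM2r ?powR_ge0//.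
  rewrite -[leRHS]powRr1//; apply: ler_powR; first by rewrite ler1n.
  by lra.
(* The successor makes M positive and gives N2^2 <= M N1; still M <= N2, because N1 > N2. *)
pose M := (N2 ^ 2 %/ N1).+1.
have NM : (N2 ^ 2 <= M * N1)%N by rewrite ltnW// ltn_ceil.
have rM : 0 < M%:R :> R by rewrite ltr0n.
pose y : R := M%:R / N2%:R.
have MN2 : (M <= N2)%N.
  rewrite /M ltn_divLR// expnS expn1 ltn_mul2l N20/= (leq_trans _ N12)//.
  by rewrite ltn_Pmull.
have y0 : 0 < y by rewrite divr_gt0.
have y1 : y <= 1 by rewrite ler_pdivrMr// mul1r ler_nat.
have Mle : M%:R <= N2%:R ^+ 2 / N1%:R + 1 :> R.
  rewrite /M -[_.+1%:R]natr1 lerD2r ler_pdivlMr// -natrX -natrM ler_nat.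
  exact: leq_divM.
(* By the bound on M, x y is at most N3/N1 + N3/N2^2, and N3 <= N2; this explains the shape of g. *)
have xyg : x * y <= g.
  rewrite /x /y /g mulrACA -invfM.
  rewrite ler_pdivrMr ?mulr_gt0//.
  apply: (le_trans (ler_wpM2l (ltW r3) Mle)).
  have -> : (N3%:R / N1%:R + N2%:R^-1) * (N2%:R * N2%:R) =
     N3%:R * (N2%:R ^+ 2 / N1%:R) + N2%:R :> R by field; rewrite !gt_eqF.
  by rewrite mulrDr mulr1 lerD2l ler_nat.
apply: (@le_trans _ _ ((KA' + KB) * T * g `^ (eps / 9))); last first.
  have -> : (KA' + KB) * 64 * g `^ (eps / 9) * T = (KA' + KB) * T * g `^ (eps / 9) * 64 by ring.
  rewrite ler_peMr//; first by rewrite !mulr_ge0 ?powR_ge0 ?addr_ge0 ?(ltW KA'0) ?(ltW KB0).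
  by rewrite ler1n.
apply: (@interpolate_gain x y g eps) => //.
- by rewrite x0.
- by rewrite y0.
- by rewrite mulr_ge0 ?addr_ge0 ?(ltW KA'0) ?(ltW KB0).
- apply: (le_trans TA); rewrite ler_wpM2r ?powR_ge0// ler_wpM2r// lerDl ltW//.
move=> yx; have MN3 : (M <= N3)%N.
  by move: yx; rewrite /x /y ler_pM2r ?invr_gt0// ler_nat.
apply: le_trans (HB alpha hal1 hal2 hal3 N1 N2 N3 M a b s N30 N32 N12 _ NM MN3 us hs) _ => //.
apply: (@le_trans _ _ (KB * T * (y `^ 4^-1 / x))); last first.
  by rewrite ler_wpM2r ?mulr_ge0 ?powR_ge0 ?invr_ge0 ?(ltW x0)// ler_wpM2r// lerDr ltW.
rewrite -[leRHS]mulrA ler_pM2l//.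
pose u := x `^ (3 * eps); pose v := y `^ (1 / 4 - eps).
have uv : u * v <= 1.
  rewrite -[leRHS]mulr1 ler_pM ?powR_ge0//.
    by rewrite -[leRHS](powRr0 x); apply: ger_powR; [rewrite x0|lra].
  by rewrite -[leRHS](powRr0 y); apply: ger_powR; [rewrite y0|lra].
have -> : N2%:R ^+ 2 * N3%:R `^ (3 / 2 + eps) * M%:R `^ (1 / 2 - eps) =
   T * (y `^ 4^-1 / x) * (u * v).
  have := slab_power_identity eps r2 x0 y0.
  by rewrite /x /y !mulfVK ?gt_eqF.
by rewrite ler_piMr// mulr_ge0 ?divr_ge0 ?powR_ge0 ?(ltW x0).
Qed.

End ResonanceCount.

(** * Integration on the torus *)

Section FubiniBounded.
Local Open Scope ereal_scope.
Context d1 d2 (T1 : measurableType d1) (T2 : measurableType d2) (R : realType).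
Variables (m1 : {sigma_finite_measure set T1 -> \bar R})
  (m2 : {sigma_finite_measure set T2 -> \bar R}).

Lemma bounded_integrable d (T : measurableType d) (mu : {measure set T -> \bar R})
    (A : set T) (f : T -> R) (K : R) :
  measurable A -> mu A < +oo -> measurable_fun [set: T] f ->
  (forall x, (`|f x| <= K)%R) -> mu.-integrable A (EFin \o f).
Proof.
move=> mA Afin mf fK; apply: measurable_bounded_integrable => //.
  exact: measurable_funS mf.
exists K; split; first exact: num_real.
by move=> M KM x _; apply: le_trans (fK x) (ltW KM).
Qed.

Lemma integral_setX_bounded (A : set T1) (B : set T2) (f : T1 * T2 -> R) (K : R) :
  measurable A -> measurable B -> m1 A < +oo -> m2 B < +oo ->
  measurable_fun [set: T1 * T2] f -> (forall z, (`|f z| <= K)%R) ->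
  \int[m1 \x m2]_(z in A `*` B) (f z)%:E =
  \int[m1]_(x in A) \int[m2]_(y in B) (f (x, y))%:E.
Proof.
move=> mA mB A1 B1 mf fK.
have mAB : measurable (A `*` B) by exact: measurableX.
have ABfin : (m1 \x m2) (A `*` B) < +oo.
  by rewrite product_measure1E// lte_mul_pinfty// ge0_fin_numE.
have fi : (m1 \x m2).-integrable (A `*` B) (EFin \o f).
  exact: bounded_integrable fK.
rewrite integral_mkcond [RHS]integral_mkcond.
have fi' : (m1 \x m2).-integrable [set: T1 * T2] ((EFin \o f) \_ (A `*` B)).
  by apply/(integrable_mkcond (EFin \o f) mAB).
rewrite -(integral12_prod_meas1 fi'); apply: eq_integral => x _.
rewrite /fubini_F patchE; case: ifPn => [xA|xA].
  rewrite [RHS]integral_mkcond; apply: eq_integral => y _.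
  by rewrite !patchE in_setX xA.
by rewrite integral0_eq// => y _; rewrite patchE in_setX (negbTE xA).
Qed.

Import HBNNSimple.

(* The evolution [schrodinger] is chosen by [xget] separately for each time, so
   that its joint measurability in time and space is not available. *)
Lemma ge0_le_integral_nonmeasurable d (T : measurableType d)
    (mu : {measure set T -> \bar R}) (A B : set T) (f g : T -> \bar R) :
  A `<=` B -> (forall x, A x -> 0 <= f x) -> (forall x, B x -> 0 <= g x) ->
  (forall x, A x -> f x <= g x) ->
  \int[mu]_(x in A) f x <= \int[mu]_(x in B) g x.
Proof.
move=> AB f0 g0 fg; rewrite !ge0_integralE//.
apply: ereal_sup_le => _ [h hf <-]; exists h => // x; apply: le_trans (hf x) _.
rewrite !patchE; case: ifPn => [/set_mem Ax|_].
  by rewrite (mem_set (AB _ Ax)) fg.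
by case: ifPn => // /set_mem/g0.
Qed.

Lemma L2normE d (T : measurableType d) (mu : {measure set T -> \bar R})
    (D : set T) (f : T -> R[i]) :
  L2norm mu D f = (\int[mu]_(x in D) (Normc.normc (f x) ^+ 2)%:E) `^ 2^-1.
Proof.
rewrite /L2norm unlock; congr (_ `^ _); rewrite [RHS]integral_mkcond.
apply: eq_integral => x _; rewrite !patchE; case: ifPn => _.
  by rewrite /= powR_mulrn ?normr_ge0// real_normK ?num_real.
by rewrite abse0 poweR0r// pnatr_eq0.
Qed.

End FubiniBounded.

(** * Integrals of cosines over intervals *)

Section TrigIntegrals.
Variable R : realType.
Implicit Types (A t : R) (m : Z3).

Local Notation leb := (@lebesgue_measure R).

Lemma integral_derive (f F : R -> R) (a b : R) : (a < b)%R ->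
  (forall x, is_derive x (1 : R) F (f x)) -> continuous f ->
  (\int[leb]_(x in [set` `[a, b]]) (f x)%:E = (F b - F a)%:E)%E.
Proof.
move=> ab dF cf.
have cF x : {for x, continuous F}.
  by apply: differentiable_continuous; apply/derivable1_diffP; have [] := dF x.
rewrite (@continuous_FTC2 R f F a b)//.
- exact: continuous_subspaceT.
- split.
  + by move=> x _; have [] := dF x.
  + exact/cvg_at_right_filter/cF.
  + exact/cvg_at_left_filter/cF.
- by move=> x _; rewrite derive1E; have [_ ->] := dF x.
Qed.

Lemma integral_cos_linear (a A : R) : a != 0 ->
  (\int[leb]_(x in [set` `[0%R, 1%R]]) (cos (a * x + A))%:E =
   ((sin (a + A) - sin A) / a)%:E)%E.
Proof.
move=> a0.
have dF (x : R) : is_derive x (1 : R) (fun x => a^-1 * sin (a * x + A)) (cos (a * x + A)).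
  apply: trigger_derive => /=; rewrite /GRing.scale/=.
  by field.
rewrite (@integral_derive (fun x => cos (a * x + A)) (fun x => a^-1 * sin (a * x + A)))//.
- by rewrite mulr1 mulr0 add0r -mulrBr mulrC.
- move=> x; apply: continuous_comp; last exact: continuous_cos.
  by apply: cvgD; [apply: cvgM; [exact: cvg_cst|exact: cvg_id]|exact: cvg_cst].
Qed.

(* Fejer kernel: [(2 - t) sin (a t) / a - cos (a t) / a ^ 2] is a primitive. *)
Lemma integral_fejer (a : R) : a != 0 ->
  (\int[leb]_(t in [set` `[0%R, 2%R]]) ((2 - t) * cos (a * t))%:E =
   ((1 - cos (2 * a)) / a ^+ 2)%:E)%E.
Proof.
move=> a0.
pose F (t : R) := (2 - t) * (a^-1 * sin (a * t)) - a^-2 * cos (a * t).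
have dF (x : R) : is_derive x (1 : R) F ((2 - x) * cos (a * x)).
  apply: trigger_derive => /=; rewrite /GRing.scale/=.
  by field.
rewrite (@integral_derive (fun t => (2 - t) * cos (a * t)) F)//.
- by congr EFin; rewrite /F mulr0 sin0 cos0 (mulrC 2 a); field.
- move=> x; apply: cvgM; first by apply: cvgB; [exact: cvg_cst|exact: cvg_id].
  apply: continuous_comp; last exact: continuous_cos.
  by apply: cvgM; [exact: cvg_cst|exact: cvg_id].
Qed.

End TrigIntegrals.

(** * Orthogonality of characters on the unit cube *)

Section CubeIntegrals.
Variable R : realType.
Implicit Types (A t : R) (m : Z3).

Local Notation leb := (@lebesgue_measure R).
Local Notation e := (@expi2pi R).
Local Notation U := [set` `[0%R, 1%R]].

(** The first factor of [vol3], named so that it can carry the structure needed to integrate one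
    coordinate at a time. *)
Definition vol2 : set (measurableTypeR R * measurableTypeR R) -> \bar R := (leb \x leb)%E.

HB.instance Definition _ := Measure.on vol2.

Fact vol2_sigma_finite : sigma_finite setT vol2.
Proof.
have /sigma_finiteP[F [TF ndF Foo]] := sigma_finiteT leb.
exists (fun n => F n `*` F n).
  rewrite predeqE => -[x y]; split => // _.
  have FT (w : measurableTypeR R) : exists n, F n w.
    by have : setT w by []; rewrite TF => -[n _ Fnw]; exists n.
  have [[i Fx] [j Fy]] := (FT x, FT y).
  exists (maxn i j) => //=; split => /=.
  - by move: Fx; apply/subsetPset/ndF; rewrite leq_max leqnn.
  - by move: Fy; apply/subsetPset/ndF; rewrite leq_max leqnn orbT.
move=> k; have [mF Fk] := Foo k.
split; first exact: measurableX.
by rewrite /vol2 product_measure1E// lte_mul_pinfty// ge0_fin_numE.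
Qed.

HB.instance Definition _ := Measure_isSigmaFinite.Build _ _ _ vol2 vol2_sigma_finite.

Lemma lebU : leb U = 1%E.
Proof. by rewrite lebesgue_measure_itv/= lte_fin ltr01 oppr0 adde0. Qed.

Lemma measurable_unit_itv : measurable (U : set (measurableTypeR R)).
Proof. exact: measurable_itv. Qed.

Lemma measurable_cube : measurable (@cube R : set (R3m R)).
Proof. by apply: measurableX; [apply: measurableX|]; exact: measurable_unit_itv. Qed.

Lemma vol2UU : vol2 (U `*` U) = 1%E.
Proof.
rewrite /vol2 product_measure1E//.
by transitivity (leb U * leb U)%E => //; rewrite lebU mule1.
Qed.

Lemma vol3_cube : @vol3 R (@cube R) = 1%E.
Proof.
have mU := measurable_unit_itv; have mUU := measurableX mU mU.
rewrite /vol3 /cube product_measure1E//= product_measure1E//.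
by transitivity (leb U * leb U * leb U)%E => //; rewrite lebU !mule1.
Qed.

Lemma vol3_cube_fin : (@vol3 R (@cube R) < +oo)%E.
Proof. by rewrite vol3_cube ltry. Qed.

Lemma sin_2pi_int (k : int) A : sin (2 * pi * k%:~R + A) = sin A.
Proof.
have per (n : nat) (B : R) : sin (B + 2 * pi * n%:R) = sin B.
  rewrite -[RHS](periodicn (@sinD2pi R) n); congr (sin (_ + _)).
  by rewrite mulr_natr mulr_natl.
case: k => n; first by rewrite addrC per.
rewrite -[LHS](per n.+1); congr sin; rewrite NegzE mulrNz pmulrn; ring.
Qed.

Lemma integral_cos_int (k : int) A :
  (\int[leb]_(x in U) (cos (2 * pi * k%:~R * x + A))%:E =
   ((k == 0)%:R * cos A)%:E)%E.
Proof.
have [->|k0] := eqVneq k 0.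
  under eq_integral do rewrite mulr0 mul0r add0r.
  by rewrite integral_cst// [X in (_ * X)%E]lebU mule1 mul1r.
have a0 : 2 * pi * k%:~R != 0 :> R.
  by rewrite !mulf_neq0 ?intr_eq0// gt_eqF// pi_gt0.
by rewrite integral_cos_linear// sin_2pi_int subrr !mul0r.
Qed.

Lemma measurable_fun_cos d (T : measurableType d) (f : T -> R) :
  measurable_fun [set: T] f -> measurable_fun [set: T] (fun x => cos (f x)).
Proof.
move=> mf; apply: (@measurableT_comp _ _ _ _ _ _ (@cos R)) => //.
by apply: continuous_measurable_fun; exact: continuous_cos.
Qed.

Lemma measurable_dot3 (m : R3 R) : measurable_fun [set: R3m R] (fun x : R3m R => dot3 m x).
Proof.
rewrite /dot3; apply: measurable_funD; first apply: measurable_funD.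
- apply: measurable_funM => //.
  exact: (measurableT_comp measurable_fst measurable_fst).
- apply: measurable_funM => //.
  exact: (measurableT_comp measurable_snd measurable_fst).
- by apply: measurable_funM => //; exact: measurable_snd.
Qed.

(** The free phase [A] lets one formula serve cosines (A = 0) and sines (A = pi/2). *)
Lemma integral_cube_cos m A :
  (\int[@vol3 R]_(x in @cube R) (cos (2 * pi * dot3 (Z3toR3 R m) x + A))%:E =
   ((m == 0)%:R * cos A)%:E)%E.
Proof.
have mU := measurable_unit_itv; have mUU := measurableX mU mU.
pose f (x : R3m R) : R := cos (2 * pi * dot3 (Z3toR3 R m) x + A).
have mf : measurable_fun setT f.
  apply: measurable_fun_cos; apply: measurable_funD => //.
  by apply: measurable_funM => //; exact: measurable_dot3.
have f1 z : `|f z| <= 1 by exact: cos_max.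
have v2 : (vol2 (U `*` U) < +oo)%E by rewrite vol2UU ltry.
have l1 : (leb U < +oo)%E by rewrite lebU ltry.
have h := @integral_setX_bounded _ _ _ _ R vol2 leb (U `*` U) U f 1 mUU mU v2 l1 mf f1.
etransitivity; first exact: h.
pose g (p : measurableTypeR R * measurableTypeR R) : R :=
  (m.2 == 0)%:R * cos (2 * pi * (m.1.1%:~R * p.1 + m.1.2%:~R * p.2) + A).
transitivity (\int[vol2]_(p in U `*` U) (g p)%:E)%E.
  apply: eq_integral => p _; rewrite /g -integral_cos_int.
  apply: eq_integral => z _; rewrite /f /dot3/=; congr (cos _)%:E; ring.
have mg : measurable_fun setT g.
  apply: measurable_funM => //; apply: measurable_fun_cos; apply: measurable_funD => //.
  apply: measurable_funM => //; apply: measurable_funD; apply: measurable_funM => //.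
have g1 p : `|g p| <= 1.
  by rewrite normrM; case: eqP => _; rewrite ?normr0 ?mul0r// normr1 mul1r cos_max.
have h' := @integral_setX_bounded _ _ _ _ R leb leb U U g 1 mU mU l1 l1 mg g1.
etransitivity; first exact: h'.
transitivity (\int[leb]_(x in U) ((m.2 == 0)%:R * ((m.1.2 == 0)%:R *
   cos (2 * pi * m.1.1%:~R * x + A)))%:E)%E.
  apply: eq_integral => x _.
  under eq_integral do rewrite /g/= EFinM.
  rewrite integralZl//; last first.
    apply: (@bounded_integrable R _ _ leb U _ 1 mU l1) => //.
      apply: measurable_fun_cos; apply: measurable_funD => //; apply: measurable_funM => //.
      by apply: measurable_funD => //; apply: measurable_funM.
    by move=> y; exact: cos_max.
  rewrite EFinM; congr (_ * _)%E.
  rewrite -integral_cos_int; apply: eq_integral => y _; congr (cos _)%:E; ring.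
have ic : leb.-integrable U (EFin \o (fun x => cos (2 * pi * m.1.1%:~R * x + A))).
  apply: (@bounded_integrable R _ _ leb U _ 1 mU l1) => //.
    by apply: measurable_fun_cos; apply: measurable_funD => //; apply: measurable_funM.
  by move=> y; exact: cos_max.
under eq_integral do rewrite mulrA EFinM.
rewrite integralZl// integral_cos_int -EFinM mulrA; congr (_ * _)%:E.
case: m {f mf f1 h g mg g1 h' ic} => [[a b] c] /=.
rewrite -[(a, b, c) == 0]/[&& (a == 0) && (b == 0) & c == 0].
by case: (a == 0); case: (b == 0); case: (c == 0); rewrite /= ?mulr0 ?mul0r ?mulr1.
Qed.

End CubeIntegrals.

(** * Parseval's identity with repeated frequencies *)

Section Parseval.
Variable R : realType.
Implicit Types (t y : R).

Local Notation leb := (@lebesgue_measure R).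
Local Notation e := (@expi2pi R).
Local Notation normc := Normc.normc.

Lemma integral_finite_sum d (T : measurableType d) (mu : {measure set T -> \bar R})
    (D : set T) (I : Type) (s : seq I) (F : I -> T -> R) (G : I -> R) :
  measurable D -> (forall i, mu.-integrable D (EFin \o F i)) ->
  (forall i, \int[mu]_(x in D) (F i x)%:E = (G i)%:E)%E ->
  (\int[mu]_(x in D) (\sum_(i <- s) F i x)%:E = (\sum_(i <- s) G i)%:E)%E.
Proof.
move=> mD Fi FG.
under eq_integral do rewrite -sumEFin.
rewrite (@integral_sum _ _ _ _ _ mD I (fun i x => (F i x)%:E))//.
by under eq_bigr do rewrite FG; rewrite sumEFin.
Qed.

(** [redot z w] and [imdot z w] are the real and imaginary parts of z times the conjugate of w. *)
Definition redot (z w : R[i]) : R :=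
  complex.Re z * complex.Re w + complex.Im z * complex.Im w.
Definition imdot (z w : R[i]) : R :=
  complex.Im z * complex.Re w - complex.Re z * complex.Im w.

Lemma redotE (z w : R[i]) t y :
  redot (z * e t) (w * e y) =
  redot z w * cos (2 * pi * (t - y)) - imdot z w * sin (2 * pi * (t - y)).
Proof.
by case: z => a b; case: w => c d; rewrite /redot /imdot/= !mulrBr cosB sinB; ring.
Qed.

(** Lagrange's identity: the defect in the squared inequality is [imdot z w ^+ 2]. *)
Lemma redot_le (z w : R[i]) : redot z w <= normc z * normc w.
Proof.
apply: le_trans (ler_norm _) _; rewrite -(@ler_pXn2r _ 2)// ?nnegrE ?mulr_ge0 ?normc_ge0//.
rewrite real_normK ?num_real// exprMn !sqr_normc_ReIm /redot -subr_ge0.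
have -> : (complex.Re z ^+ 2 + complex.Im z ^+ 2) * (complex.Re w ^+ 2 + complex.Im w ^+ 2) -
   (complex.Re z * complex.Re w + complex.Im z * complex.Im w) ^+ 2 = imdot z w ^+ 2.
  by rewrite /imdot; ring.
exact: sqr_ge0.
Qed.

Lemma sqr_normc_sum (I : Type) (s : seq I) (z : I -> R[i]) :
  normc (\sum_(i <- s) z i) ^+ 2 = \sum_(i <- s) \sum_(j <- s) redot (z i) (z j).
Proof.
rewrite sqr_normc_ReIm Re_sum Im_sum !expr2 !big_distrl -big_split/=.
apply: eq_bigr => i _; rewrite !big_distrr -big_split/=.
by apply: eq_bigr => j _; rewrite /redot.
Qed.

(** Terms are indexed by an arbitrary type, with possible repetitions among the frequencies, so that
    a product of three such sums is again one, indexed by triples. *)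
Definition trig_sum (I : Type) (s : seq I) (c : I -> R[i]) (nu : I -> Z3) (x : R3 R) : R[i] :=
  \sum_(i <- s) c i * e (dot3 (Z3toR3 R (nu i)) x).

Definition resonant_energy (I : Type) (s : seq I) (c : I -> R[i]) (nu : I -> Z3) : R :=
  \sum_(i <- s) \sum_(j <- s) (nu i == nu j)%:R * redot (c i) (c j).

Lemma dot3B (m n : Z3) (x : R3 R) :
  dot3 (Z3toR3 R m) x - dot3 (Z3toR3 R n) x = dot3 (Z3toR3 R (m - n)) x.
Proof. by rewrite /dot3 /= !intrB; ring. Qed.

Lemma integrable_cube_cos (r A : R) (m : Z3) :
  (@vol3 R).-integrable (@cube R) (EFin \o (fun x => r * cos (2 * pi * dot3 (Z3toR3 R m) x + A))).
Proof.
apply: (@bounded_integrable R _ _ _ _ _ `|r|).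
- exact: measurable_cube.
- exact: vol3_cube_fin.
- apply: measurable_funM => //; apply: measurable_fun_cos; apply: measurable_funD => //.
  by apply: measurable_funM => //; exact: measurable_dot3.
- by move=> x; rewrite normrM ler_piMr// cos_max.
Qed.

Lemma integral_cube_cosZ (r A : R) (m : Z3) :
  (\int[@vol3 R]_(x in @cube R) (r * cos (2 * pi * dot3 (Z3toR3 R m) x + A))%:E =
   (r * ((m == 0)%:R * cos A))%:E)%E.
Proof.
under eq_integral do rewrite EFinM.
rewrite integralZl ?integral_cube_cos//; first exact: measurable_cube.
by have := integrable_cube_cos 1 A m; under eq_fun do rewrite mul1r.
Qed.

Lemma integral_sqr_trig_sum (I : Type) (s : seq I) (c : I -> R[i]) (nu : I -> Z3) :
  (\int[@vol3 R]_(x in @cube R) (normc (trig_sum s c nu x) ^+ 2)%:E =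
   (resonant_energy s c nu)%:E)%E.
Proof.
(* The sine is written as a cosine shifted by pi/2, so that one integral formula covers both
   terms. *)
pose F i j (x : R3 R) := redot (c i) (c j) * cos (2 * pi * dot3 (Z3toR3 R (nu i - nu j)) x + 0) +
  imdot (c i) (c j) * cos (2 * pi * dot3 (Z3toR3 R (nu i - nu j)) x + pi / 2).
have FE x : normc (trig_sum s c nu x) ^+ 2 = \sum_(i <- s) \sum_(j <- s) F i j x.
  rewrite /trig_sum sqr_normc_sum; apply: eq_bigr => i _; apply: eq_bigr => j _.
  by rewrite redotE dot3B /F cosDpihalf addr0 mulrN.
have mC := @measurable_cube R.
have Fi i j : (@vol3 R).-integrable (@cube R) (EFin \o F i j).
  rewrite /F; apply: (@integrableD _ _ _ _ _ mC
    (EFin \o (fun x => redot (c i) (c j) * cos (2 * pi * dot3 (Z3toR3 R (nu i - nu j)) x + 0)))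
    (EFin \o (fun x => imdot (c i) (c j) * cos (2 * pi * dot3 (Z3toR3 R (nu i - nu j)) x + pi / 2))));
    exact: integrable_cube_cos.
under eq_integral do rewrite FE.
apply: integral_finite_sum => // i.
  have -> : EFin \o (fun x => \sum_(j <- s) F i j x) =
     (fun x => \sum_(j <- s) (EFin \o F i j) x)%E.
    by apply/funext => x /=; rewrite sumEFin.
  exact: integrable_sum.
apply: integral_finite_sum => // j.
rewrite /F; under eq_integral do rewrite EFinD.
rewrite integralD//; [|exact: integrable_cube_cos|exact: integrable_cube_cos].
rewrite !integral_cube_cosZ -EFinD cos0 cos_pihalf !mulr0 addr0 mulr1 subr_eq0.
by rewrite mulrC.
Qed.

Lemma L2normT3_trig_sum (I : Type) (s : seq I) (c : I -> R[i]) (nu : I -> Z3) :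
  L2normT3 (trig_sum s c nu) = (Num.sqrt (resonant_energy s c nu))%:E.
Proof.
have E0 : 0 <= resonant_energy s c nu.
  rewrite -lee_fin -integral_sqr_trig_sum; apply: integral_ge0 => x _.
  by rewrite lee_fin sqr_ge0.
by rewrite /L2normT3 L2normE integral_sqr_trig_sum poweR_EFin powR12_sqrt.
Qed.

Lemma resonant_energy_injective (I : eqType) (s : seq I) (c : I -> R[i]) (nu : I -> Z3) :
  uniq s -> {in s &, injective nu} ->
  resonant_energy s c nu = \sum_(i <- s) normc (c i) ^+ 2.
Proof.
move=> us inj; rewrite /resonant_energy big_seq [RHS]big_seq; apply: eq_bigr => i si.
rewrite (big_rem i si)/= eqxx mul1r big_seq big1 ?addr0.
  by rewrite sqr_normc_ReIm /redot !expr2.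
move=> j; rewrite mem_rem_uniq// inE => /andP[ji sj].
case: eqP => [/(inj _ _ si sj) ij|_]; last by rewrite mul0r.
by rewrite ij eqxx in ji.
Qed.

End Parseval.

(** * From the space-time norm to a quadratic form in the coefficients *)

Section SpaceTime.
Variable R : realType.
Implicit Types (t y : R).

Local Notation leb := (@lebesgue_measure R).
Local Notation e := (@expi2pi R).
Local Notation normc := Normc.normc.

(* Fourier transform of the triangle function [2 - |t|] on [-2, 2]. *)
Definition triangle_hat y : R :=
  if y == 0 then 4 else 2 * ((1 - cos (2 * (2 * pi * y))) / (2 * pi * y) ^+ 2).

Lemma triangle_hat_ge0 y : 0 <= triangle_hat y.
Proof.
rewrite /triangle_hat; case: ifP => // _.
by rewrite mulr_ge0// divr_ge0 ?sqr_ge0// subr_ge0 cos_le1.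
Qed.

(** For y^2 <= 1/4 the value is at most 4 and 1 + y^2 at most 5/4, whence the 5; for larger y the
    numerator is at most 2 and (2 pi y)^2 >= 16 y^2. *)
Lemma triangle_hat_le y : triangle_hat y <= 5 / (1 + y ^+ 2).
Proof.
have d0 : 0 < 1 + y ^+ 2 by rewrite ltr_wpDr ?sqr_ge0.
rewrite ler_pdivlMr// /triangle_hat; case: eqP => [->|/eqP y0].
  by rewrite expr0n/= addr0; lra.
have y2 : 0 < y ^+ 2 by rewrite exprn_even_gt0.
set a := 2 * pi * y.
have p2 := pi_ge2 R.
have a2 : 16 * y ^+ 2 <= a ^+ 2.
  have -> : a ^+ 2 = 4 * pi ^+ 2 * y ^+ 2 by rewrite /a; ring.
  by rewrite ler_pM2r//; nra.
have a0 : 0 < a ^+ 2 by apply: lt_le_trans a2; rewrite mulr_gt0.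
have h1 := cos_ge_quadratic (2 * a).
have h2 := cos_geN1 (2 * a).
rewrite mulrA mulrAC ler_pdivrMr//.
have [y4|y4] := leP (y ^+ 2) (1 / 4).
  have : 1 - cos (2 * a) <= 2 * a ^+ 2 by move: h1; rewrite exprMn; lra.
  move: (cos (2 * a)) (a ^+ 2) h2 a0 => c b *; nra.
move: (cos (2 * a)) (a ^+ 2) h2 a2 a0 => c b *; nra.
Qed.

Lemma integral_triangle y :
  (\int[leb]_(t in [set` `[0%R, 2%R]]) ((2 - t) * cos (2 * pi * y * t))%:E =
   (triangle_hat y / 2)%:E)%E.
Proof.
rewrite /triangle_hat; case: eqP => [->|/eqP y0]; last first.
  rewrite integral_fejer; first by congr EFin; rewrite [RHS]mulrAC divff ?mul1r ?pnatr_eq0.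
  by rewrite !mulf_neq0// gt_eqF// pi_gt0.
have dF (x : R) : is_derive x (1 : R) (fun t => 2 * t - 2^-1 * t ^+ 2) (2 - x).
  by apply: trigger_derive => /=; rewrite /GRing.scale/= ?expr1; field.
under eq_integral do rewrite mulr0 mul0r cos0 mulr1.
rewrite (integral_derive _ dF)//; first by congr EFin; field.
by move=> x; apply: cvgB; [exact: cvg_cst|exact: cvg_id].
Qed.

Lemma measurable_time_sum (I : Type) (s : seq I) (c : I -> R[i]) (nu : I -> Z3)
    (lam : I -> R) :
  measurable_fun [set: measurableTypeR R * R3m R]
    (fun tx => normc (trig_sum s (fun i => c i * e (lam i * tx.1)) nu tx.2) ^+ 2).
Proof.
have -> : (fun tx : measurableTypeR R * R3m R =>
      normc (trig_sum s (fun i => c i * e (lam i * tx.1)) nu tx.2) ^+ 2) =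
    (fun tx => \sum_(i <- s) \sum_(j <- s)
     (redot (c i) (c j) *
        cos (2 * pi * ((lam i - lam j) * tx.1 + dot3 (Z3toR3 R (nu i - nu j)) tx.2)) +
      imdot (c i) (c j) *
        cos (2 * pi * ((lam i - lam j) * tx.1 + dot3 (Z3toR3 R (nu i - nu j)) tx.2) + pi / 2))).
  apply/funext => -[t x] /=; rewrite /trig_sum sqr_normc_sum.
  apply: eq_bigr => i _; apply: eq_bigr => j _.
  rewrite -!mulrA -!expi2piD redotE cosDpihalf mulrN -dot3B.
  have -> : lam i * t + dot3 (Z3toR3 R (nu i)) x - (lam j * t + dot3 (Z3toR3 R (nu j)) x) =
     (lam i - lam j) * t + (dot3 (Z3toR3 R (nu i)) x - dot3 (Z3toR3 R (nu j)) x).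
    move: (dot3 (Z3toR3 R (nu i)) x) (dot3 (Z3toR3 R (nu j)) x) => u v; ring.
  by rewrite !mulrA.
have mphase i j : measurable_fun [set: measurableTypeR R * R3m R] (fun tx =>
    2 * pi * ((lam i - lam j) * tx.1 + dot3 (Z3toR3 R (nu i - nu j)) tx.2)).
  apply: measurable_funM => //; apply: measurable_funD.
    by apply: measurable_funM => //; exact: measurable_fst.
  exact: (measurableT_comp (measurable_dot3 _) measurable_snd).
apply: measurable_sum => i; apply: measurable_sum => j.
apply: measurable_funD; apply: measurable_funM => //; apply: measurable_fun_cos => //.
exact: measurable_funD.
Qed.

(** Only a pointwise majorant of [f] by a trigonometric sum is assumed, which is all that the
    evolution provides. Parseval in space leaves pairs of equal frequency; the triangle function
    then turns time into a kernel in the modulations. *)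
Lemma L2norm_space_time_le (I : Type) (s : seq I) (c : I -> R[i]) (nu : I -> Z3)
    (lam : I -> R) (tau : set R) (f : R * R3 R -> R[i]) (E : R) :
  tau `<=` [set` `[0, 1]] ->
  (forall tx, normc (f tx) <= normc (trig_sum s (fun i => c i * e (lam i * tx.1)) nu tx.2)) ->
  \sum_(i <- s) \sum_(j <- s)
    (nu i == nu j)%:R * (normc (c i) * normc (c j) * triangle_hat (lam i - lam j)) <= E ->
  (L2norm (@vol_time_space R) (tau `*` @cube R) f <= (Num.sqrt E)%:E)%E.
Proof.
move=> tau01 fF hE.
pose F (tx : measurableTypeR R * R3m R) :=
  normc (trig_sum s (fun i => c i * e (lam i * tx.1)) nu tx.2) ^+ 2.
pose H t := resonant_energy s (fun i => c i * e (lam i * t)) nu.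
have HE t : (\int[@vol3 R]_(x in @cube R) (F (t, x))%:E = (H t)%:E)%E.
  exact: (integral_sqr_trig_sum s (fun i => c i * e (lam i * t)) nu).
have H0 t : 0 <= H t.
  by rewrite -lee_fin -HE; apply: integral_ge0 => x _; rewrite lee_fin sqr_ge0.
have E0 : 0 <= E.
  apply: le_trans hE; apply: sumr_ge0 => i _; apply: sumr_ge0 => j _.
  by rewrite !mulr_ge0 ?normc_ge0 ?triangle_hat_ge0.
suff : (\int[@vol_time_space R]_(x in tau `*` @cube R) (normc (f x) ^+ 2)%:E <= E%:E)%E.
  move=> h; rewrite L2normE.
  have -> : (Num.sqrt E)%:E = (E%:E `^ 2^-1)%E by rewrite poweR_EFin powR12_sqrt.
  apply: gt0_ler_poweR => //; rewrite in_itv/= leey andbT ?lee_fin//.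
  by apply: integral_ge0 => x _; rewrite lee_fin sqr_ge0.
apply: (@le_trans _ _ (\int[@vol_time_space R]_(x in [set` `[0%R, 1%R]] `*` @cube R) (F x)%:E)%E).
  apply: ge0_le_integral_nonmeasurable.
  - by move=> [t x] [/= /tau01 ? ?].
  - by move=> x _; rewrite lee_fin sqr_ge0.
  - by move=> x _; rewrite lee_fin sqr_ge0.
  - by move=> x _; rewrite lee_fin ler_pXn2r ?nnegrE ?normc_ge0//; exact: fF.
have l1 : (leb [set` `[0%R, 1%R]] < +oo)%E by rewrite lebU ltry.
have FK z : `|F z| <= (\sum_(i <- s) normc (c i)) ^+ 2.
  rewrite ger0_norm ?sqr_ge0// ler_pXn2r ?nnegrE ?normc_ge0//; last first.
    by apply: sumr_ge0 => i _; exact: normc_ge0.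
  apply: le_trans (normc_sum_le _ _) _; apply: ler_sum => i _.
  by rewrite !Normc.normcM !normc_expi2pi !mulr1.
have h := @integral_setX_bounded _ _ _ _ R leb (@vol3 R) [set` `[0%R, 1%R]] (@cube R) F _
  (@measurable_unit_itv R) (@measurable_cube R) l1 (@vol3_cube_fin R) (measurable_time_sum s c nu lam) FK.
rewrite [leLHS](_ : _ = \int[leb]_(t in [set` `[0%R, 1%R]]) (H t)%:E)%E; last first.
  by etransitivity; [exact: h|apply: eq_integral => t _; exact: HE].
(* On [0, 1] the weight 2 - t is at least 1 and H(-t) is nonnegative. Adding H(-t) symmetrises in
   time and removes the sine terms. *)
apply: (@le_trans _ _ (\int[leb]_(t in [set` `[0%R, 2%R]]) ((2 - t) * (H t + H (- t)))%:E)%E).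
  apply: ge0_le_integral_nonmeasurable.
  - by move=> t /=; rewrite !in_itv/= => /andP[? ?]; apply/andP; split; lra.
  - by move=> t _; rewrite lee_fin.
  - by move=> t /=; rewrite in_itv/= => /andP[? ?]; rewrite lee_fin mulr_ge0 ?subr_ge0 ?addr_ge0.
  - move=> t /=; rewrite in_itv/= => /andP[? ?]; rewrite lee_fin.
    have := H0 t; have := H0 (- t); move: (H t) (H (- t)) => u v v0 u0.
    have : 0 <= (1 - t) * (u + v) by rewrite mulr_ge0 ?subr_ge0 ?addr_ge0.
    by lra.
pose G i j t := 2 * ((nu i == nu j)%:R * redot (c i) (c j)) * ((2 - t) * cos (2 * pi * (lam i - lam j) * t)).
have HG t : (2 - t) * (H t + H (- t)) = \sum_(i <- s) \sum_(j <- s) G i j t.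
  rewrite /H /resonant_energy -big_split/= mulr_sumr; apply: eq_bigr => i _.
  rewrite -big_split/= mulr_sumr; apply: eq_bigr => j _.
  rewrite !redotE /G.
  have -> : 2 * pi * (lam i * t - lam j * t) = 2 * pi * (lam i - lam j) * t by ring.
  have -> : 2 * pi * (lam i * - t - lam j * - t) = - (2 * pi * (lam i - lam j) * t) by ring.
  by rewrite cosN sinN; ring.
have m2 : measurable ([set` `[0%R, 2%R]] : set (measurableTypeR R)) by exact: measurable_itv.
have Gi i j : leb.-integrable [set` `[0%R, 2%R]] (EFin \o G i j).
  apply: continuous_compact_integrable; first exact: segment_compact.
  apply: continuous_subspaceT => x; apply: cvgM; first exact: cvg_cst.
  apply: cvgM; first by apply: cvgB; [exact: cvg_cst|exact: cvg_id].
  apply: continuous_comp; last exact: continuous_cos.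
  by apply: cvgM; [exact: cvg_cst|exact: cvg_id].
under eq_integral do rewrite HG.
rewrite (@integral_finite_sum R _ _ leb _ _ s (fun i t => \sum_(j <- s) G i j t) (fun i =>
  \sum_(j <- s) (nu i == nu j)%:R * redot (c i) (c j) * triangle_hat (lam i - lam j))) //.
(* Nonnegativity of [triangle_hat] permits replacing the real parts of the products by products of
   moduli. *)
- rewrite lee_fin; apply: le_trans hE; apply: ler_sum => i _; apply: ler_sum => j _.
  by rewrite -mulrA ler_wpM2l// ler_wpM2r ?triangle_hat_ge0// redot_le.
- move=> i; have -> : EFin \o (fun x => \sum_(j <- s) G i j x) =
     (fun x => \sum_(j <- s) (EFin \o G i j) x)%E.
    by apply/funext => x /=; rewrite sumEFin.
  exact: integrable_sum.
- move=> i; apply: integral_finite_sum => // j.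
  rewrite /G; under eq_integral do rewrite EFinM.
  rewrite integralZl//; last first.
    apply: continuous_compact_integrable; first exact: segment_compact.
    apply: continuous_subspaceT => x.
    apply: cvgM; first by apply: cvgB; [exact: cvg_cst|exact: cvg_id].
    apply: continuous_comp; last exact: continuous_cos.
    by apply: cvgM; [exact: cvg_cst|exact: cvg_id].
  by rewrite integral_triangle -EFinM; congr EFin; field.
Qed.

End SpaceTime.

(** * Fourier coefficients *)

Section FourierCoefficients.
Variable R : realType.
Implicit Types (t y eta : R).

Local Notation e := (@expi2pi R).
Local Notation normc := Normc.normc.
Local Notation vol := (@vol3 R).
Local Notation Q := (@cube R).

Definition square_integrable (f : R3 R -> R[i]) : Prop :=
  [/\ measurable_fun [set: R3m R] (fun x : R3m R => complex.Re (f x)),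
      measurable_fun [set: R3m R] (fun x : R3m R => complex.Im (f x)) &
      (\int[vol]_(x in Q) (normc (f x) ^+ 2)%:E < +oo)%E].

Lemma L2T3_square_integrable f : L2T3 f -> square_integrable f.
Proof.
move=> [_ m1 m2 h]; split => //; rewrite ltey; apply: contraTneq h => h.
by rewrite /L2normT3 L2normE h poweRyr// ltxx.
Qed.

Lemma measurable_sqr_normc (f : R3 R -> R[i]) :
  measurable_fun [set: R3m R] (fun x : R3m R => complex.Re (f x)) ->
  measurable_fun [set: R3m R] (fun x : R3m R => complex.Im (f x)) ->
  measurable_fun [set: R3m R] (fun x : R3m R => normc (f x) ^+ 2).
Proof.
move=> m1 m2; under eq_fun do rewrite sqr_normc_ReIm.
by apply: measurable_funD; apply: measurable_funX.
Qed.

Lemma integrable_sqr_normc f : square_integrable f ->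
  vol.-integrable Q (EFin \o (fun x => normc (f x) ^+ 2)).
Proof.
move=> [m1 m2 h]; apply/integrableP; split.
  apply/measurable_EFinP; apply: measurable_funS (measurable_sqr_normc m1 m2) => //.
by under eq_integral do rewrite /= ger0_norm ?sqr_ge0//.
Qed.

Lemma normc_linear_le (z : R[i]) (a b : R) : a ^+ 2 + b ^+ 2 <= 1 ->
  `|a * complex.Re z + b * complex.Im z| <= normc z.
Proof.
move=> ab; rewrite -(@ler_pXn2r _ 2)// ?nnegrE ?normr_ge0 ?normc_ge0//.
rewrite real_normK ?num_real// sqr_normc_ReIm.
have := sqr_ge0 (a * complex.Im z - b * complex.Re z).
have := addr_ge0 (sqr_ge0 (complex.Re z)) (sqr_ge0 (complex.Im z)).
move: (complex.Re z) (complex.Im z) => p q h1 h2; nra.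
Qed.

Lemma square_integrable_trig_sum (I : Type) (s : seq I) (c : I -> R[i]) (nu : I -> Z3) :
  square_integrable (trig_sum s c nu).
Proof.
have mE i A : measurable_fun [set: R3m R] (fun x : R3m R =>
    cos (2 * pi * dot3 (Z3toR3 R (nu i)) x + A)).
  apply: measurable_fun_cos; apply: measurable_funD => //.
  by apply: measurable_funM => //; exact: measurable_dot3.
split.
- have -> : (fun x : R3m R => complex.Re (trig_sum s c nu x)) = (fun x => \sum_(i <- s)
     (complex.Re (c i) * cos (2 * pi * dot3 (Z3toR3 R (nu i)) x + 0) +
      complex.Im (c i) * cos (2 * pi * dot3 (Z3toR3 R (nu i)) x + pi / 2))).
    apply/funext => x; rewrite /trig_sum Re_sum; apply: eq_bigr => i _.
    by rewrite addr0 cosDpihalf; case: (c i) => p q /=; rewrite mulrN.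
  by apply: measurable_sum => i; apply: measurable_funD; apply: measurable_funM.
- have -> : (fun x : R3m R => complex.Im (trig_sum s c nu x)) = (fun x => \sum_(i <- s)
     (complex.Im (c i) * cos (2 * pi * dot3 (Z3toR3 R (nu i)) x + 0) -
      complex.Re (c i) * cos (2 * pi * dot3 (Z3toR3 R (nu i)) x + pi / 2))).
    apply/funext => x; rewrite /trig_sum Im_sum; apply: eq_bigr => i _.
    by rewrite addr0 cosDpihalf; case: (c i) => p q /=; rewrite mulrN opprK addrC.
  by apply: measurable_sum => i; apply: measurable_funB; apply: measurable_funM.
- by rewrite integral_sqr_trig_sum ltry.
Qed.

(** Dominated by 1 + |f|^2, which is integrable because the cube has finite volume. *)
Lemma integrable_linear f (a b : R3 R -> R) : square_integrable f ->
  measurable_fun [set: R3m R] (a : R3m R -> R) -> measurable_fun [set: R3m R] (b : R3m R -> R) ->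
  (forall x, a x ^+ 2 + b x ^+ 2 <= 1) ->
  vol.-integrable Q (EFin \o (fun x => a x * complex.Re (f x) + b x * complex.Im (f x))).
Proof.
move=> hf ma mb ab; have [m1 m2 _] := hf; have mQ := @measurable_cube R.
have i1 : vol.-integrable Q (EFin \o (fun x => 1 + normc (f x) ^+ 2)).
  apply: (@integrableD _ _ _ _ _ mQ (EFin \o cst 1) (EFin \o (fun x => normc (f x) ^+ 2))).
    by apply: (@bounded_integrable R _ _ _ _ _ 1 mQ (@vol3_cube_fin R)) => // x; rewrite normr1.
  exact: integrable_sqr_normc.
apply: le_integrable i1 => //.
  apply/measurable_EFinP; apply: measurable_funS (_ : measurable_fun setT _) => //.
  by apply: measurable_funD; apply: measurable_funM.
move=> x _; rewrite /= lee_fin; apply: le_trans (normc_linear_le _ (ab x)) _.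
rewrite ger0_norm ?addr_ge0 ?sqr_ge0//; have := sqr_ge0 (normc (f x) - 1); have := normc_ge0 (f x).
by move: (normc _) => w; nra.
Qed.

(** The pointwise bound |w| <= eta + |w|^2/eta for w = f - g takes the place of the Cauchy-Schwarz
    inequality: over the cube, of volume 1, each term integrates to at most eta. *)
Lemma integral_linear_close f g (a b : R3 R -> R) eta :
  square_integrable f -> square_integrable g ->
  measurable_fun [set: R3m R] (a : R3m R -> R) -> measurable_fun [set: R3m R] (b : R3m R -> R) ->
  (forall x, a x ^+ 2 + b x ^+ 2 <= 1) -> 0 < eta ->
  (L2normT3 (fun x => f x - g x)%R < eta%:E)%E ->
  `|\int[vol]_(x in Q) (a x * complex.Re (f x) + b x * complex.Im (f x)) -
    \int[vol]_(x in Q) (a x * complex.Re (g x) + b x * complex.Im (g x))| <= 2 * eta.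
Proof.
move=> hf hg ma mb ab eta0 close.
have [mf1 mf2 _] := hf; have [mg1 mg2 _] := hg; have mQ := @measurable_cube R.
have If := integrable_linear hf ma mb ab; have Ig := integrable_linear hg ma mb ab.
pose w x := f x - g x.
have hw : square_integrable w.
  split.
  - have -> : (fun x : R3m R => complex.Re (w x)) = (fun x => complex.Re (f x) - complex.Re (g x)).
      by apply/funext => x; rewrite /w; case: (f x) => ? ?; case: (g x).
    exact: measurable_funB.
  - have -> : (fun x : R3m R => complex.Im (w x)) = (fun x => complex.Im (f x) - complex.Im (g x)).
      by apply/funext => x; rewrite /w; case: (f x) => ? ?; case: (g x).
    exact: measurable_funB.
  - rewrite ltey; apply: contraTneq close => h.
    by rewrite /L2normT3 L2normE h poweRyr// -leNgt leey.
have Iw := integrable_sqr_normc hw.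
have w2 : \int[vol]_(x in Q) (normc (w x) ^+ 2) <= eta ^+ 2.
  have W0 : 0 <= \int[vol]_(x in Q) (normc (w x) ^+ 2).
    by apply: Rintegral_ge0 => x _; exact: sqr_ge0.
  have fW : ((\int[vol]_(x in Q) (normc (w x) ^+ 2))%:E = \int[vol]_(x in Q) (normc (w x) ^+ 2)%:E)%E.
    by rewrite /Rintegral fineK// integrable_fin_num.
  move: close; rewrite /L2normT3 L2normE -/w -fW poweR_EFin powR12_sqrt// lte_fin => h.
  rewrite -(sqr_sqrtr W0) ler_pXn2r ?nnegrE ?sqrtr_ge0 ?(ltW eta0)//; exact: ltW.
rewrite -RintegralB//.
pose v x := a x * complex.Re (w x) + b x * complex.Im (w x).
have vE x : a x * complex.Re (f x) + b x * complex.Im (f x) -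
    (a x * complex.Re (g x) + b x * complex.Im (g x)) = v x.
  by rewrite /v /w; case: (f x) => ? ?; case: (g x) => ? ? /=; ring.
under eq_Rintegral do rewrite vE.
have Iv : vol.-integrable Q (EFin \o v) by exact: integrable_linear.
apply: le_trans (le_normr_Rintegral mQ Iv) _.
have Ie : vol.-integrable Q (EFin \o cst eta).
  apply: (@bounded_integrable R _ _ _ _ _ `|eta| mQ (@vol3_cube_fin R)) => //.
have Iw' : vol.-integrable Q (EFin \o (fun x => eta^-1 * normc (w x) ^+ 2)).
  exact: (integrableZl mQ eta^-1 Iw).
apply: (@le_trans _ _ (\int[vol]_(x in Q) (eta + eta^-1 * normc (w x) ^+ 2))).
  apply: le_Rintegral => //.
  - exact: (integrable_norm Iv).
  - exact: (integrableD mQ Ie Iw').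
  - move=> x _; rewrite /v.
    apply: le_trans (normc_linear_le _ (ab x)) _.
    have := normc_ge0 (w x); move: (normc _) => u u0.
    rewrite -(ler_pM2l eta0) mulrDr mulVKf ?gt_eqF//.
    have := sqr_ge0 (u - eta); nra.
rewrite RintegralD// RintegralZl// Rintegral_cst//.
have -> : fine (vol Q) = 1 by rewrite vol3_cube.
rewrite mulr1 mulr2n mulrDl mul1r lerD2l ler_pdivrMl// -expr2.
Qed.

Lemma fourierE f (n : Z3) : fourier f n =
  ((\int[vol]_(x in Q) (cos (2 * pi * dot3 (Z3toR3 R n) x) * complex.Re (f x) +
       sin (2 * pi * dot3 (Z3toR3 R n) x) * complex.Im (f x))) +i*
   (\int[vol]_(x in Q) ((- sin (2 * pi * dot3 (Z3toR3 R n) x)) * complex.Re (f x) +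
       cos (2 * pi * dot3 (Z3toR3 R n) x) * complex.Im (f x))))%C.
Proof.
have dotC (x : R3 R) : - dot3 x (Z3toR3 R n) = - dot3 (Z3toR3 R n) x.
  by rewrite /dot3; ring.
rewrite /fourier /integralC; congr (_ +i* _)%C; apply: eq_Rintegral => x _;
  rewrite dotC /expi2pi mulrN cosN sinN; case: (f x) => p q /=; ring.
Qed.

(** Fourier coefficients are continuous in L^2. This identifies those of the evolution, which is
    only given as an L^2 limit of partial sums. *)
Lemma fourier_close f g (n : Z3) eta :
  square_integrable f -> square_integrable g -> 0 < eta ->
  (L2normT3 (fun x => f x - g x)%R < eta%:E)%E ->
  `|complex.Re (fourier f n) - complex.Re (fourier g n)| <= 2 * eta /\
  `|complex.Im (fourier f n) - complex.Im (fourier g n)| <= 2 * eta.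
Proof.
move=> hf hg eta0 close; rewrite !fourierE/=.
have mphase : measurable_fun [set: R3m R] (fun x : R3m R => 2 * pi * dot3 (Z3toR3 R n) x).
  by apply: measurable_funM => //; exact: measurable_dot3.
have mc : measurable_fun [set: R3m R] (fun x : R3m R => cos (2 * pi * dot3 (Z3toR3 R n) x)).
  exact: measurable_fun_cos.
have ms : measurable_fun [set: R3m R] (fun x : R3m R => sin (2 * pi * dot3 (Z3toR3 R n) x)).
  under eq_fun do rewrite -cosBpihalf; apply: measurable_fun_cos.
  exact: measurable_funB.
split.
  apply: (integral_linear_close (a := fun x => cos (2 * pi * dot3 (Z3toR3 R n) x))
    (b := fun x => sin (2 * pi * dot3 (Z3toR3 R n) x)) hf hg mc ms _ eta0 close).
  by move=> x; rewrite cos2Dsin2.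
apply: (integral_linear_close (a := fun x => - sin (2 * pi * dot3 (Z3toR3 R n) x))
    (b := fun x => cos (2 * pi * dot3 (Z3toR3 R n) x)) hf hg _ mc _ eta0 close).
  exact: measurable_funN.
by move=> x; rewrite sqrrN addrC cos2Dsin2.
Qed.

Lemma fourier_trig_sum (s : seq Z3) (c : Z3 -> R[i]) (n : Z3) :
  uniq s -> n \in s -> fourier (trig_sum s c id) n = c n.
Proof.
move=> us ns; rewrite fourierE; have mQ := @measurable_cube R.
have single (d : Z3 -> R) : \sum_(m <- s) ((m - n == 0)%:R * d m) = d n.
  rewrite (big_rem n ns)/= subrr eqxx mul1r big_seq big1 ?addr0// => m.
  rewrite mem_rem_uniq// inE => /andP[mn _].
  by rewrite subr_eq0 (negbTE mn) mul0r.
pose F (p q : Z3 -> R) m (x : R3 R) :=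
  p m * cos (2 * pi * dot3 (Z3toR3 R (m - n)) x + 0) +
  q m * cos (2 * pi * dot3 (Z3toR3 R (m - n)) x + pi / 2).
have IF p q : \int[vol]_(x in Q) (\sum_(m <- s) F p q m x) = p n.
  rewrite /Rintegral (@integral_finite_sum R _ _ vol Q _ s (F p q)
     (fun m => (m - n == 0)%:R * p m))//= ?single//.
    move=> m; apply: (@integrableD _ _ _ _ _ mQ
      (EFin \o (fun x => p m * cos (2 * pi * dot3 (Z3toR3 R (m - n)) x + 0)))
      (EFin \o (fun x => q m * cos (2 * pi * dot3 (Z3toR3 R (m - n)) x + pi / 2))));
      exact: integrable_cube_cos.
  move=> m; rewrite /F; under eq_integral do rewrite EFinD.
  rewrite integralD//; [|exact: integrable_cube_cos|exact: integrable_cube_cos].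
  by rewrite !integral_cube_cosZ -EFinD cos0 cos_pihalf !mulr0 addr0 mulr1 mulrC.
have dB m x : 2 * pi * dot3 (Z3toR3 R (m - n)) x =
    2 * pi * dot3 (Z3toR3 R m) x - 2 * pi * dot3 (Z3toR3 R n) x.
  by rewrite -dot3B mulrBr.
transitivity ((complex.Re (c n)) +i* (complex.Im (c n)))%C; last by case: (c n).
congr (_ +i* _)%C.
  rewrite -[RHS](IF (fun m => complex.Re (c m)) (fun m => complex.Im (c m))).
  apply: eq_Rintegral => x _; rewrite /trig_sum Re_sum Im_sum !mulr_sumr -big_split/=.
  apply: eq_bigr => m _; rewrite /F addr0 cosDpihalf dB cosB sinB.
  by case: (c m) => p q /=; ring.
rewrite -[RHS](IF (fun m => complex.Im (c m)) (fun m => - complex.Re (c m))).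
apply: eq_Rintegral => x _; rewrite /trig_sum Re_sum Im_sum !mulr_sumr -big_split/=.
apply: eq_bigr => m _; rewrite /F addr0 cosDpihalf dB cosB sinB.
by case: (c m) => p q /=; ring.
Qed.

End FourierCoefficients.

(** * Evolution and frequency projections as finite trigonometric sums *)

Section LittlewoodPaley.
Variable R : realType.
Implicit Types (t : R) (phi : R3 R -> R[i]).

Local Notation e := (@expi2pi R).
Local Notation normc := Normc.normc.

Definition int_seq (K : nat) : seq int := [seq i%:Z - K%:Z | i <- iota 0 (2 * K).+1].

Definition box_seq (K : nat) : seq Z3 :=
  [seq (p, k) | p <- [seq (i, j) | i <- int_seq K, j <- int_seq K], k <- int_seq K].

Lemma box_seq_uniq (K : nat) : uniq (box_seq K).
Proof.
have uI : uniq (int_seq K).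
  by rewrite map_inj_uniq ?iota_uniq// => i j /addIr [].
apply: allpairs_uniq => //; last by move=> [? ?] [? ?] _ _ [-> ->].
by apply: allpairs_uniq => // -[? ?] [? ?] _ _ [-> ->].
Qed.

Lemma mem_box_seq (K : nat) (n : Z3) : (n \in box_seq K) = in_zbox 0 K n.
Proof.
have mI (m : int) : (m \in int_seq K) = (`|m| <= K)%N.
  apply/mapP/idP => [[k]|h]; first by rewrite mem_iota => /andP[_ ?] ->; lia.
  exists (`|(m + K%:Z)%R|%N); first by rewrite mem_iota; lia.
  by lia.
case: n => [[a b] c]; rewrite /in_zbox !subr0/= -!mI andbA.
rewrite /box_seq; apply/idP/idP => [|/andP[/andP[ha hb] hc]].
  by move=> /allpairsPdep[p [k [/allpairsPdep[i [j [hi hj ->]]] hk [-> -> ->]]]]; rewrite hi hj hk.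
by apply: allpairs_f => //; apply: allpairs_f.
Qed.

Lemma schrodinger_partialE (alpha : R3 R) t phi (K : nat) (x : R3 R) :
  schrodinger_partial alpha t phi K x =
  trig_sum (box_seq K) (fun n => fourier phi n * e (Qform alpha n * t)) id x.
Proof.
rewrite /schrodinger_partial /trig_sum.
have -> : box K = [set` box_seq K].
  apply/seteqP; split => n /=; rewrite mem_box_seq /in_zbox !subr0.
    by move=> [h1 h2 h3]; apply/and3P.
  by move=> /and3P[].
rewrite -fsbig_seq ?box_seq_uniq//; apply: eq_bigr => n _.
by rewrite -mulrA -expi2piD [Qform _ _ * _ + _]addrC.
Qed.

(* The second alternative is the default value of [xget]; the estimate is then
   trivial, which makes the Riesz-Fischer theorem unnecessary. *)
Lemma fourier_schrodinger (alpha : R3 R) t phi :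
  (forall n, fourier (schrodinger alpha t phi) n = fourier phi n * e (Qform alpha n * t)) \/
  (forall n, fourier (schrodinger alpha t phi) n = 0).
Proof.
set P := [set u | L2T3 u /\
  L2normT3 (fun x => u x - schrodinger_partial alpha t phi K x) @[K --> \oo] --> 0%E].
have [ex|nex] := pselect (exists u, P u); last first.
  right=> n; rewrite /schrodinger xgetPN; last by move=> u Pu; apply: nex; exists u.
  rewrite /fourier /integralC; under eq_Rintegral do rewrite mulr0.
  under [X in (_ +i* X)%C]eq_Rintegral do rewrite mulr0.
  by rewrite !Rintegral_cst ?mul0r//; exact: measurable_cube.
left=> n; have := xgetPex (fun=> 0) ex; rewrite -/(schrodinger alpha t phi).
set V := schrodinger alpha t phi => -[/L2T3_square_integrable hV cvgV].
(* From K0 on the box contains n, so the n-th coefficient of the partial sums no longer changes. *)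
have [K0 nK] : exists K0 : nat, in_zbox 0 K0 n.
  exists (maxn (maxn `|n.1.1| `|n.1.2|) `|n.2|)%N; rewrite /in_zbox !subr0.
  by rewrite !leq_max !leqnn ?orbT.
have close eta : 0 < eta ->
    `|complex.Re (fourier V n) - complex.Re (fourier phi n * e (Qform alpha n * t))| <= 2 * eta /\
    `|complex.Im (fourier V n) - complex.Im (fourier phi n * e (Qform alpha n * t))| <= 2 * eta.
  move=> eta0.
  have small : \forall K \near \oo, (L2normT3 (fun x => (V x - schrodinger_partial alpha t phi K x)%R)
      < eta%:E)%E.
    have /(_ [set y | (y < eta%:E)%E]) := cvgV; apply.
    by apply: open_nbhs_nbhs; split; [exact: open_ereal_lt_ereal|rewrite /= lte_fin].
  have [K1 _ hK1] := small.
  pose K := maxn K0 K1.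
  have := hK1 K (leq_maxr _ _).
  have -> : (fun x => V x - schrodinger_partial alpha t phi K x) =
     (fun x => V x - trig_sum (box_seq K) (fun n => fourier phi n * e (Qform alpha n * t)) id x).
    by apply/funext => x; rewrite schrodinger_partialE.
  move=> sm; have := fourier_close n hV (square_integrable_trig_sum _ _ _) eta0 sm.
  rewrite fourier_trig_sum ?box_seq_uniq// mem_box_seq.
  move: nK => /and3P[h1 h2 h3]; rewrite /in_zbox.
  by rewrite (leq_trans h1 (leq_maxl _ _)) (leq_trans h2 (leq_maxl _ _)) (leq_trans h3 (leq_maxl _ _)).
have zero (u v : R) : (forall eta, 0 < eta -> `|u - v| <= 2 * eta) -> u = v.
  move=> h; apply/eqP; rewrite -subr_eq0 -normr_le0; apply/ler_addgt0Pl => eta eta0.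
  by rewrite addr0; have := h (eta / 2); rewrite divr_gt0// => /(_ isT); rewrite mulrC divfK.
have hRe := zero _ _ (fun eta eta0 => (close eta eta0).1).
have hIm := zero _ _ (fun eta eta0 => (close eta eta0).2).
by move: hRe hIm; case: (fourier V n) => ? ?; case: (_ * _) => ? ? /= -> ->.
Qed.

Lemma cutoff_support (psi : R -> R) (s : R) : cutoff psi -> psi s != 0 -> `|s| < 2.
Proof.
move=> [_ hs _ _ _] h.
have /hs : closure [set s | psi s != 0] s by exact: subset_closure.
by rewrite /= in_itv/= ltr_norml.
Qed.

Lemma normE3_ge0 (x : R3 R) : 0 <= normE3 x. Proof. exact: sqrtr_ge0. Qed.

Lemma sqr_normE3 (n : Z3) : normE3 (Z3toR3 R n) ^+ 2 = (sqZ3 n)%:~R.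
Proof.
rewrite sqr_sqrtr; first by rewrite /dot3 /sqZ3 /= !intrD !rmorphXn/= !expr2.
by rewrite /dot3 /= -!expr2 !addr_ge0 ?sqr_ge0.
Qed.

Lemma normE3_coord (n : Z3) (N : nat) : normE3 (Z3toR3 R n) < N%:R -> in_zbox 0 N n.
Proof.
move=> h; have N0 : 0 <= N%:R :> R by [].
have : normE3 (Z3toR3 R n) ^+ 2 < N%:R ^+ 2.
  by rewrite ltr_pXn2r ?nnegrE ?normE3_ge0.
rewrite sqr_normE3 -natrX pmulrn ltr_int /in_zbox !subr0 /sqZ3 => hs.
have sq (m : int) : m ^+ 2 <= sqZ3 n -> (`|m| <= N)%N.
  move=> hm; rewrite -(@leq_exp2r _ _ 2)// -lez_nat -abszX gez0_abs ?sqr_ge0//.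
  by apply/ltW/(le_lt_trans hm).
have := (sqr_ge0 n.1.1, sqr_ge0 n.1.2, sqr_ge0 n.2) => -[[h1 h2] h3].
by apply/and3P; split; apply: sq; rewrite /sqZ3; lia.
Qed.

(** The upper bound comes from the support of psi in (-2, 2). Below N/2 both dilates of psi equal 1
    and cancel; for N = 1 there is a single dilate, hence no lower bound. *)
Lemma psiN_support (psi : R -> R) (N : nat) (n : Z3) : cutoff psi -> (0 < N)%N ->
  psiN psi N (Z3toR3 R n) != 0 ->
  in_zbox 0 (2 * N) n /\ ((1 < N)%N -> N%:Z ^+ 2 <= 4 * sqZ3 n).
Proof.
move=> hpsi N0; have Nr : 0 < N%:R :> R by rewrite ltr0n.
have supp := @cutoff_support psi _ hpsi; have [_ _ _ _ psi1] := hpsi.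
rewrite /psiN; set r := normE3 _; have r0 : 0 <= r by exact: normE3_ge0.
case: (eqVneq N 1%N) => [->|N1].
  move=> /supp; rewrite ger0_norm// muln1 => h; split => //.
  exact: normE3_coord.
move=> h; split.
  apply: normE3_coord; rewrite -/r natrM.
  have [] : psi (r / N%:R) != 0 \/ psi (2 * r / N%:R) != 0.
    have [p0|p0] := eqVneq (psi (r / N%:R)) 0; last by left.
    by right; apply: contraNneq h => ->; rewrite p0 subr0.
    by move=> /supp; rewrite ger0_norm ?divr_ge0// ltr_pdivrMr.
  move=> /supp; rewrite ger0_norm ?divr_ge0 ?mulr_ge0// ltr_pdivrMr//.
  by apply: le_lt_trans; lra.
move=> _; have : N%:R <= 2 * r.
  rewrite leNgt; apply: contraNN h => h.
  have d1 : 2 * r / N%:R <= 1 by rewrite ler_pdivrMr// mul1r ltW.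
  have d2 : r / N%:R <= 1 by apply: le_trans d1; rewrite ler_pM2r ?invr_gt0//; lra.
  by rewrite !psi1 ?subrr// ger0_norm ?divr_ge0 ?mulr_ge0.
rewrite -(@ler_pXn2r _ 2)// ?nnegrE ?mulr_ge0// exprMn sqr_normE3 => hN.
by rewrite -(ler_int R) rmorphXn rmorphM /=; apply: le_trans hN _; rewrite -natrX.
Qed.

Definition psi_support (psi : R -> R) (N : nat) : seq Z3 :=
  [seq n <- box_seq (2 * N) | psiN psi N (Z3toR3 R n) != 0].

Lemma LPprojE (psi : R -> R) (N : nat) (f : R3 R -> R[i]) (x : R3 R) :
  cutoff psi -> (0 < N)%N -> LPproj psi N f x =
  trig_sum (psi_support psi N) (fun n => (psiN psi N (Z3toR3 R n))%:C%C * fourier f n) id x.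
Proof.
move=> hpsi N0; rewrite /LPproj /trig_sum.
rewrite [RHS]fsbig_seq ?filter_uniq ?box_seq_uniq//; apply/esym.
apply: (@fsbig_widen _ _ _ _ _ _ (fun n => (psiN psi N (Z3toR3 R n))%:C%C * fourier f n *
  e (dot3 (Z3toR3 R n) x))) => // n [_ /= h].
have [p0|p0] := eqVneq (psiN psi N (Z3toR3 R n)) 0; first by rewrite p0 mul0r mul0r.
case: h; rewrite mem_filter p0/= mem_box_seq.
by have [] := psiN_support hpsi N0 p0.
Qed.

End LittlewoodPaley.

(** * Proof of the theorem *)

Section Assembly.
Variable R : realType.
Implicit Types (b t y eps C : R).

Local Notation e := (@expi2pi R).
Local Notation normc := Normc.normc.

Definition total_freq (p : Z3 * Z3 * Z3) : Z3 := p.1.1 + p.1.2 + p.2.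

Definition modulation (alpha : R3 R) (p : Z3 * Z3 * Z3) : R :=
  Qform alpha p.1.1 + Qform alpha p.1.2 + Qform alpha p.2.

Lemma triangle_hatN y : triangle_hat (- y) = triangle_hat y.
Proof. by rewrite /triangle_hat oppr_eq0 !mulrN sqrrN cosN. Qed.

(** With m the integer part of 8 |y|, (1 + m)^2 <= 2 (1 + m^2) <= 128 (1 + y^2), and 640 = 5 * 128.
    The right side is shaped like the summand of [sum_inv_sqr_le] with s = 1 and u = 0. *)
Lemma triangle_hat_floor : exists A : R, 0 < A /\ forall y,
  triangle_hat y <= A * (1 + `|1 * (Num.truncn (8 * `|y|))%:R - 0|) ^- 2.
Proof.
exists (10 * 64); split; first by rewrite mulr_gt0.
move=> y; have y0 : 0 <= 8 * `|y| by rewrite mulr_ge0.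
have /andP[h _] := truncn_itv y0.
rewrite mul1r subr0 normr_nat; move: (Num.truncn _) h => m h.
apply: le_trans (triangle_hat_le y) _.
have d0 : 0 < 1 + y ^+ 2 by rewrite ltr_wpDr ?sqr_ge0.
have m0 : 0 <= m%:R :> R by [].
have m1 : 0 < (1 + m%:R) ^+ 2 :> R by rewrite exprn_gt0// ltr_wpDr.
rewrite ler_pdivrMr// mulrAC ler_pdivlMr//.
have hm : m%:R ^+ 2 <= 64 * y ^+ 2.
  have : m%:R ^+ 2 <= (8 * `|y|) ^+ 2 by rewrite ler_pXn2r ?nnegrE.
  by rewrite exprMn real_normK ?num_real//; lra.
have := sqr_ge0 (m%:R - 1 : R); move: (m%:R) (y ^+ 2) m0 hm => u v *; nra.
Qed.

(** A row of the Schur matrix: layers of thickness 1/8 in the modulation are counted by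
    [resonance_count], and the quadratic decay of the kernel sums over them. The 8 is 2 for the
    signs times 4 from [sum_inv_sqr_le]. *)
Lemma resonance_row_sum eps C : 0 < eps <= 1 / 8 -> 1 < C ->
  exists K : R, 0 < K /\ forall alpha : R3 R,
  C^-1 < alpha.1.1 < C -> C^-1 < alpha.1.2 < C -> C^-1 < alpha.2 < C ->
  forall (N1 N2 N3 : nat) (a : Z3) b (s : seq (Z3 * Z3 * Z3)),
  (0 < N3)%N -> (N3 <= N2)%N -> (N2 <= N1)%N -> uniq s ->
  (forall p, p \in s -> [/\ in_zbox 0 (2 * N1) p.1.1,
     (1 < N1)%N -> (N1%:Z ^+ 2 <= 4 * sqZ3 p.1.1)%R,
     in_zbox 0 (2 * N2) p.1.2, in_zbox 0 (2 * N3) p.2 & total_freq p = a]) ->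
  \sum_(p <- s) triangle_hat (modulation alpha p - b) <=
    K * (N3%:R / N1%:R + N2%:R^-1) `^ (eps / 9) *
    (N2%:R `^ (3 / 2 + 2 * eps) * N3%:R `^ (5 / 2 - 2 * eps)).
Proof.
move=> he C1; have [K [K0 HK]] := @resonance_count R eps C he C1.
have [A [A0 HA]] := triangle_hat_floor.
exists (8 * (A * K)); split; first by rewrite !mulr_gt0.
move=> alpha h1 h2 h3 N1 N2 N3 a b s N30 N32 N21 us hs.
set X := _ `^ (eps / 9); set T := N2%:R `^ _ * _.
have KXT0 : 0 <= K * X * T by rewrite !mulr_ge0 ?powR_ge0 ?(ltW K0).
pose m (p : Z3 * Z3 * Z3) := Num.truncn (8 * `|modulation alpha p - b|).
pose J := (\sum_(p <- s) m p).+1.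
pose w (k : nat) : R := (1 + `|1 * k%:R - 0|) ^- 2.
have w0 k : 0 <= w k by rewrite invr_ge0 exprn_ge0// addr_ge0.
have mJ p : p \in s -> (m p < J)%N.
  by move=> ps; rewrite /J ltnS (big_rem p ps)/= leq_addr.
(* A layer consists of two intervals of length 1/8, one on each side of b; each lies within 1/8 of
   its endpoint b + k/8 or b - k/8. *)
have count (k : nat) : (size [seq p <- s | m p == k])%:R <= 2 * (K * X * T).
  pose pos (p : Z3 * Z3 * Z3) := 0 <= modulation alpha p - b.
  have half (P : pred (Z3 * Z3 * Z3)) b' : (forall p, p \in s -> P p -> m p == k ->
      `|modulation alpha p - b'| <= 1 / 8) ->
      (size [seq p <- [seq p <- s | m p == k] | P p])%:R <= K * X * T.
    move=> hP; apply: (HK alpha h1 h2 h3 N1 N2 N3 a b') => //.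
      by rewrite !filter_uniq.
    move=> p; rewrite !mem_filter => /andP[Pp /andP[mp ps]].
    by have [? ? ? ? ?] := hs p ps; split=> //; split=> //; exact: hP.
  have fl p : m p == k -> k%:R <= 8 * `|modulation alpha p - b| < k%:R + 1.
    by move=> /eqP <-; rewrite natr1 truncn_itv// mulr_ge0.
  have -> : size [seq p <- s | m p == k] = (size [seq p <- [seq p <- s | m p == k] | pos p] +
      size [seq p <- [seq p <- s | m p == k] | predC pos p])%N.
    by rewrite !(size_filter _ [seq p <- s | m p == k]) count_predC.
  rewrite natrD mulr2n mulrDl mul1r; apply: lerD.
    apply: (half pos (b + k%:R / 8)) => p _ pp /fl; rewrite ger0_norm// => /andP[? ?].
    by rewrite ler_norml; apply/andP; split; lra.
  apply: (half (predC pos) (b - k%:R / 8)) => p _; rewrite /= -ltNge => pn /fl.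
  rewrite ltr0_norm// => /andP[? ?].
  by rewrite ler_norml; apply/andP; split; lra.
apply: (@le_trans _ _ (\sum_(p <- s) \sum_(0 <= k < J) A * ((m p == k)%:R * w k))).
  rewrite big_seq [leRHS]big_seq; apply: ler_sum => p ps.
  apply: le_trans (HA _) _; rewrite -/(m p) -/(w (m p)).
  rewrite (bigD1_seq (m p)) ?iota_uniq ?mem_index_iota ?mJ//= eqxx mul1r lerDl.
  by apply: sumr_ge0 => k _; rewrite !mulr_ge0 ?(ltW A0).
rewrite exchange_big/=.
apply: (@le_trans _ _ (\sum_(0 <= k < J) 2 * A * (K * X * T) * w k)).
  apply: ler_sum => k _; rewrite -mulr_sumr -mulr_suml.
  have -> : \sum_(p <- s) (m p == k)%:R = (size [seq p <- s | m p == k])%:R :> R.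
    by rewrite size_filter -sum1_count natr_sum [RHS]big_mkcond; apply: eq_bigr => p _; case: eqP.
  rewrite mulrA ler_wpM2r//; have := ler_wpM2l (ltW A0) (count k).
  by move=> /le_trans; apply; rewrite le_eqVlt; apply/orP; left; apply/eqP; ring.
rewrite -mulr_sumr.
have c0 : 0 <= 2 * A * (K * X * T) by rewrite mulr_ge0// mulr_ge0// ltW.
have := ler_wpM2l c0 (@sum_inv_sqr_le R 1 0 J _); rewrite ltr01 lexx => /(_ isT).
move=> /le_trans; apply.
by rewrite le_eqVlt; apply/orP; left; apply/eqP; field.
Qed.

(** Twice c p c q is at most c p^2 + c q^2, and symmetry identifies the two halves. The hypothesis
    is in summed form, so that row sums need control only for p in s. *)
Lemma schur_test (I : Type) (s : seq I) (A : I -> I -> R) (c : I -> R) (X : R) :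
  (forall p q, 0 <= A p q) -> (forall p q, A p q = A q p) ->
  \sum_(p <- s) \sum_(q <- s) A p q * (c p ^+ 2) <= X * \sum_(p <- s) c p ^+ 2 ->
  \sum_(p <- s) \sum_(q <- s) A p q * (c p * c q) <= X * \sum_(p <- s) c p ^+ 2.
Proof.
move=> A0 AC; apply: le_trans.
apply: (@le_trans _ _ (\sum_(p <- s) \sum_(q <- s)
    (2^-1 * (A p q * c p ^+ 2) + 2^-1 * (A p q * c q ^+ 2)))).
  apply: ler_sum => p _; apply: ler_sum => q _.
  rewrite [leRHS](_ : _ = A p q * ((c p ^+ 2 + c q ^+ 2) / 2)); last by ring.
  rewrite ler_wpM2l//.
  have := sqr_ge0 (c p - c q); nra.
under eq_bigr do rewrite big_split/= -!mulr_sumr.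
rewrite big_split/= -!mulr_sumr.
have -> : \sum_(p <- s) \sum_(q <- s) A p q * c q ^+ 2 = \sum_(p <- s) \sum_(q <- s) A p q * c p ^+ 2.
  by rewrite exchange_big/=; apply: eq_bigr => p _; apply: eq_bigr => q _; rewrite AC.
by rewrite le_eqVlt; apply/orP; left; apply/eqP; field.
Qed.

Definition triples (s1 s2 s3 : seq Z3) : seq (Z3 * Z3 * Z3) :=
  [seq (p, n3) | p <- [seq (n1, n2) | n1 <- s1, n2 <- s2], n3 <- s3].

Lemma triples_uniq s1 s2 s3 : uniq s1 -> uniq s2 -> uniq s3 -> uniq (triples s1 s2 s3).
Proof.
move=> u1 u2 u3; apply: allpairs_uniq => //; last by move=> [? ?] [? ?] _ _ [-> ->].
by apply: allpairs_uniq => // -[? ?] [? ?] _ _ [-> ->].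
Qed.

Lemma mem_triples s1 s2 s3 p : p \in triples s1 s2 s3 ->
  [/\ p.1.1 \in s1, p.1.2 \in s2 & p.2 \in s3].
Proof. by move=> /allpairsPdep[q [n [/allpairsPdep[n1 [n2 [h1 h2 ->]]] h3 ->]]]. Qed.

Lemma sum_triples_prod (T : comNzRingType) s1 s2 s3 (F1 F2 F3 : Z3 -> T) :
  \sum_(p <- triples s1 s2 s3) F1 p.1.1 * F2 p.1.2 * F3 p.2 =
  (\sum_(n <- s1) F1 n) * (\sum_(n <- s2) F2 n) * (\sum_(n <- s3) F3 n).
Proof.
rewrite big_allpairs_dep/= big_allpairs_dep/= !mulr_suml.
apply: eq_bigr => n1 _; rewrite [F1 n1 * _]mulr_sumr mulr_suml.
by apply: eq_bigr => n2 _; rewrite mulr_sumr.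
Qed.

End Assembly.

Theorem proposition4p1 (R : realType) (psi : R -> R) (hpsi : cutoff psi)
    (C : R) (hC : 1 < C)
    (tau0 : interval R) (htau0 : [set` tau0] `<=` `[0, 1])
    (eps : R) (heps : 0 < eps) :
  exists delta : R, 0 < delta /\
  exists c : R, 0 < c /\
  forall alpha1 alpha2 alpha3 : R,
    C^-1 < alpha1 < C -> C^-1 < alpha2 < C -> C^-1 < alpha3 < C ->
  forall phi1 phi2 phi3 : R3 R -> R[i],
    L2T3 phi1 -> L2T3 phi2 -> L2T3 phi3 ->
  forall N1 N2 N3 : nat,
    dyadic N1 -> dyadic N2 -> dyadic N3 ->
    (N2 <= N1)%N -> (N3 <= N2)%N -> (1 <= N3)%N ->
  let u (N : nat) (phi : R3 R -> R[i]) (tx : R * R3 R) : R[i] :=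
    LPproj psi N (schrodinger (alpha1, alpha2, alpha3) tx.1 phi) tx.2 in
  (L2norm (@vol_time_space R) ([set` tau0] `*` @cube R)
     (fun tx => u N1 phi1 tx * u N2 phi2 tx * u N3 phi3 tx)%R
   <= (c * (N3%:R / N1%:R + N2%:R^-1) `^ delta
         * N2%:R `^ (3 / 4 + eps) * N3%:R `^ (5 / 4 - eps))%:E
      * (L2normT3 (LPproj psi N1 phi1) * L2normT3 (LPproj psi N2 phi2)
         * L2normT3 (LPproj psi N3 phi3)))%E.
Proof.
(* The counts require an exponent of at most 1/8; eps is restored at the very end. *)
pose eta := Num.min eps (1 / 8).
have eta01 : 0 < eta <= 1 / 8 by rewrite lt_min heps divr_gt0//= ge_min lexx orbT.
have /andP[eta0 eta8] := eta01.
have etale : eta <= eps by rewrite ge_min lexx.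
have [K [K0 HK]] := @resonance_row_sum R eta C eta01 hC.
(* Half of eta/9, since the count bounds the square of the norm. *)
exists (eta / 18); split; first by rewrite divr_gt0.
exists (Num.sqrt K); split; first by rewrite sqrtr_gt0.
move=> alpha1 alpha2 alpha3 h1 h2 h3 phi1 phi2 phi3 _ _ _ N1 N2 N3 _ _ _ N21 N32 N30.
pose u (N : nat) (phi : R3 R -> R[i]) (tx : R * R3 R) : R[i] :=
  LPproj psi N (schrodinger (alpha1, alpha2, alpha3) tx.1 phi) tx.2.
cbv zeta.
pose alpha : R3 R := (alpha1, alpha2, alpha3).
have N20 : (0 < N2)%N by apply: leq_trans N32.
have N10 : (0 < N1)%N by apply: leq_trans N21.
have r2 : 0 < N2%:R :> R by rewrite ltr0n.
have r3 : 0 < N3%:R :> R by rewrite ltr0n.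
pose c (N : nat) phi n : R[i] := (psiN psi N (Z3toR3 R n))%:C%C * fourier phi n.
pose S N phi : R := \sum_(n <- psi_support psi N) Normc.normc (c N phi n) ^+ 2.
have S0 N phi : 0 <= S N phi by apply: sumr_ge0 => n _; exact: sqr_ge0.
have us N : uniq (psi_support psi N) by rewrite filter_uniq// box_seq_uniq.
have normP N phi : (0 < N)%N -> L2normT3 (LPproj psi N phi) = (Num.sqrt (S N phi))%:E.
  move=> N0; have -> : LPproj psi N phi = trig_sum (psi_support psi N) (c N phi) id.
    by apply/funext => x; rewrite LPprojE.
  by rewrite L2normT3_trig_sum resonant_energy_injective.
pose s := triples (psi_support psi N1) (psi_support psi N2) (psi_support psi N3).
pose cc (p : Z3 * Z3 * Z3) := c N1 phi1 p.1.1 * c N2 phi2 p.1.2 * c N3 phi3 p.2.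
set g := N3%:R / N1%:R + N2%:R^-1.
pose T : R := N2%:R `^ (3 / 2 + 2 * eta) * N3%:R `^ (5 / 2 - 2 * eta).
pose E := K * g `^ (eta / 9) * T * (S N1 phi1 * S N2 phi2 * S N3 phi3).
(* An inequality, so as to include the case in which all coefficients of the evolution are zero. *)
have uE N phi t x : (0 < N)%N -> Normc.normc (u N phi (t, x)) <=
    Normc.normc (\sum_(n <- psi_support psi N)
      c N phi n * expi2pi (Qform alpha n * t + dot3 (Z3toR3 R n) x)).
  move=> N0; rewrite /u /= LPprojE// /trig_sum.
  have [ft|ft] := fourier_schrodinger alpha t phi.
    rewrite le_eqVlt; apply/orP; left; apply/eqP; congr Normc.normc.
    by apply: eq_bigr => n _; rewrite ft /c (expi2piD (Qform alpha n * t)) !mulrA.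
  rewrite big1 ?Normc.normc0 ?normc_ge0// => n _.
  by rewrite ft mulr0 mul0r.
have point tx : Normc.normc (u N1 phi1 tx * u N2 phi2 tx * u N3 phi3 tx) <=
    Normc.normc (trig_sum s (fun p => cc p * expi2pi (modulation alpha p * tx.1)) total_freq tx.2).
  case: tx => t x /=; rewrite !Normc.normcM.
  have -> : trig_sum s (fun p => cc p * expi2pi (modulation alpha p * t)) total_freq x =
    (\sum_(n <- psi_support psi N1) c N1 phi1 n * expi2pi (Qform alpha n * t + dot3 (Z3toR3 R n) x)) *
    (\sum_(n <- psi_support psi N2) c N2 phi2 n * expi2pi (Qform alpha n * t + dot3 (Z3toR3 R n) x)) *
    (\sum_(n <- psi_support psi N3) c N3 phi3 n * expi2pi (Qform alpha n * t + dot3 (Z3toR3 R n) x)).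
    rewrite -sum_triples_prod; apply: eq_bigr => -[[n1 n2] n3] _ /=.
    rewrite /cc /= -mulrA -expi2piD.
    have -> : modulation alpha (n1, n2, n3) * t + dot3 (Z3toR3 R (total_freq (n1, n2, n3))) x =
      (Qform alpha n1 * t + dot3 (Z3toR3 R n1) x) + (Qform alpha n2 * t + dot3 (Z3toR3 R n2) x) +
      (Qform alpha n3 * t + dot3 (Z3toR3 R n3) x).
      by rewrite /modulation /total_freq /dot3 /= !intrD; ring.
    by rewrite !expi2piD; ring.
  rewrite !Normc.normcM; apply: ler_pM; rewrite ?mulr_ge0 ?normc_ge0 ?uE//.
  by apply: ler_pM; rewrite ?normc_ge0 ?uE.
have sumcc : \sum_(p <- s) Normc.normc (cc p) ^+ 2 = S N1 phi1 * S N2 phi2 * S N3 phi3.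
  rewrite -sum_triples_prod; apply: eq_bigr => p _.
  by rewrite /cc !Normc.normcM !exprMn.
have energy : \sum_(p <- s) \sum_(q <- s) (total_freq p == total_freq q)%:R *
    (Normc.normc (cc p) * Normc.normc (cc q) *
     triangle_hat (modulation alpha p - modulation alpha q)) <= E.
  (* Schur's test on the matrix over frequency triples, restricted to pairs of equal total
     frequency, with the symmetric kernel [triangle_hat] of the modulation difference. *)
  rewrite /E -sumcc.
  under eq_bigr do under eq_bigr do rewrite mulrCA mulrC.
  apply: (@schur_test R _ s (fun p q => (total_freq p == total_freq q)%:R *
    triangle_hat (modulation alpha p - modulation alpha q))).
  - by move=> p q; rewrite mulr_ge0 ?triangle_hat_ge0.
  - by move=> p q; rewrite eq_sym -triangle_hatN opprB.
  rewrite mulr_sumr big_seq [leRHS]big_seq; apply: ler_sum => p ps.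
  rewrite -mulr_suml ler_wpM2r ?sqr_ge0//.
  have -> : \sum_(q <- s) (total_freq p == total_freq q)%:R *
      triangle_hat (modulation alpha p - modulation alpha q) =
    \sum_(q <- [seq q <- s | total_freq q == total_freq p])
      triangle_hat (modulation alpha q - modulation alpha p).
    rewrite big_filter [RHS]big_mkcond; apply: eq_bigr => q _.
    rewrite eq_sym -triangle_hatN opprB; case: eqP => _; first by rewrite mul1r.
    by rewrite mul0r.
  apply: (HK alpha h1 h2 h3 N1 N2 N3 (total_freq p)) => //.
    by rewrite filter_uniq// triples_uniq.
  move=> q; rewrite mem_filter => /andP[/eqP qp /mem_triples].
  rewrite !mem_filter => -[/andP[q1 _] /andP[q2 _] /andP[q3 _]].
  have [b1 l1] := psiN_support hpsi N10 q1.
  have [b2 _] := psiN_support hpsi N20 q2.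
  by have [b3 _] := psiN_support hpsi N30 q3.
apply: le_trans (L2norm_space_time_le htau0 point energy) _.
rewrite !normP// -!EFinM lee_fin /E.
have X0 : 0 <= K * g `^ (eta / 9) by rewrite mulr_ge0 ?powR_ge0 ?(ltW K0).
have T0 : 0 <= T by rewrite mulr_ge0 ?powR_ge0.
have half (x a : R) : Num.sqrt (x `^ a) = x `^ (a / 2).
  by rewrite -powR12_sqrt ?powR_ge0// -powRrM.
have sqrtT : Num.sqrt T = N2%:R `^ (3 / 4 + eta) * N3%:R `^ (5 / 4 - eta).
  by rewrite /T sqrtrM ?powR_ge0// !half; congr (_ `^ _ * _ `^ _); field.
have sqrtg : Num.sqrt (g `^ (eta / 9)) = g `^ (eta / 18).
  by rewrite half; congr (_ `^ _); field.
rewrite (@sqrtrM _ (K * g `^ (eta / 9) * T)) ?(mulr_ge0 X0 T0)//.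
rewrite (@sqrtrM _ (K * g `^ (eta / 9)))// (@sqrtrM _ K) ?(ltW K0)// sqrtT sqrtg.
rewrite (@sqrtrM _ (S N1 phi1 * S N2 phi2)) ?mulr_ge0// (@sqrtrM _ (S N1 phi1))//.
rewrite ler_wpM2r ?mulr_ge0 ?sqrtr_ge0// -[leRHS]mulrA ler_wpM2l ?mulr_ge0 ?sqrtr_ge0 ?powR_ge0//.
have nz (x : R) : 0 < x -> forall a, (a == 0) ==> (x != 0).
  by move=> x0 a; rewrite lt0r_neq0 ?implybT.
(* Passing from eta to eps trades the power eps - eta of N3 for that of N2, which is larger since N3
   <= N2. *)
have -> : 3 / 4 + eps = (3 / 4 + eta) + (eps - eta) by ring.
have -> : 5 / 4 - eta = (5 / 4 - eps) + (eps - eta) by ring.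
rewrite (@powRD _ _ (3 / 4 + eta)) ?nz// (@powRD _ _ (5 / 4 - eps)) ?nz//.
rewrite -mulrA ler_wpM2l ?powR_ge0// mulrC ler_wpM2r ?powR_ge0//.
by rewrite ge0_ler_powR ?nnegrE ?subr_ge0// ler_nat.
Qed.
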